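(* There exists a sequence $(h_n)_{n\ge 0}$ of positive real numbers converging to $0$ such that, for every $n$, if $a\ge b>0$ satisfy $b/a=h_n$, then the Dirichlet Laplace operator of the ellipse $\mathcal{E}_{a,b}$ has at least one multiple eigenvalue (an eigenvalue whose eigenspace has dimension at least $2$).
   Context: For $0<b\le a<\infty$, $\mathcal{E}_{a,b}$ denotes the ellipse $\{(x,y)\in\mathbb{R}^2 : (x/a)^2+(y/b)^2\le 1\}$. Its Dirichlet Laplace operator is the self-adjoint operator on $L^2$ of the interior of $\mathcal{E}_{a,b}$ associated with the quadratic form $u\mapsto\int|\nabla u|^2$ with form domain $H^1_0$ of the interior. *)

(* Defs.v *)
From HB Require Import structures.
From mathcomp Require Import all_boot all_order all_algebra.
From mathcomp Require Import all_classical all_reals all_analysis.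

Set Implicit Arguments.
Unset Strict Implicit.
Unset Printing Implicit Defensive.

Import Order.TTheory GRing.Theory Num.Theory.
Import numFieldNormedType.Exports.

Local Open Scope classical_set_scope.
Local Open Scope ring_scope.

Definition ellipse (R : realType) (a b : R) : set (R * R) :=
  [set p | (p.1 / a) ^+ 2 + (p.2 / b) ^+ 2 <= 1].

Section plane_calculus.
Context {R : realType}.
Implicit Types (f : R * R -> R) (D : set (R * R)).

Definition dx f : R * R -> R := 'D_((1, 0) : R * R) f.
Definition dy f : R * R -> R := 'D_((0, 1) : R * R) f.

Fixpoint is_Ck (k : nat) f : Prop :=
  if k is k'.+1 then
    [/\ continuous f,
        forall p, derivable f p ((1, 0) : R * R),
        forall p, derivable f p ((0, 1) : R * R),
        is_Ck k' (dx f) & is_Ck k' (dy f)]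
  else continuous f.

Definition smooth f := forall k, is_Ck k f.

Definition closed_support f : set (R * R) := closure [set p | f p != 0].

(* C_c^oo(D), each test function being extended by zero to the whole plane. *)
Definition test_function D f :=
  [/\ smooth f, compact (closed_support f) & closed_support f `<=` D].

End plane_calculus.

Section dirichlet_laplacian.
Context {R : realType}.
Implicit Types (D : set (R * R)) (u v f : R * R -> R) (g : R * R -> R * R).

Definition area := (@lebesgue_measure R \x @lebesgue_measure R)%E.

(* Elements of L^2(D) are represented by functions on the plane, of which only
   the restriction to D matters; [f \_ D] is f extended by zero outside D. *)
Definition L2 D f := f \_ D \in Lfun area 2%:E.

Definition L2_inner D u v : R := \int[area]_(p in D) (u p * v p).

Definition L2_eq D u v := {ae area, forall p, D p -> u p = v p}.

Definition L2_cvg D (w : nat -> R * R -> R) u :=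
  Lnorm area 2%:E (EFin \o ((w n \- u) \_ D)) @[n --> \oo] --> 0%E.

(* u is in H^1(D) and g is its weak gradient, which is only determined up to
   a negligible set. *)
Definition in_H1 D u g :=
  [/\ L2 D u, L2 D (fst \o g), L2 D (snd \o g) &
      forall phi, test_function D phi ->
        L2_inner D u (dx phi) = - L2_inner D (fst \o g) phi /\
        L2_inner D u (dy phi) = - L2_inner D (snd \o g) phi].

(* H^1_0(D) is the closure of C_c^oo(D) in H^1(D). *)
Definition in_H10 D u g :=
  in_H1 D u g /\
  exists w : nat -> R * R -> R,
    [/\ forall n, test_function D (w n), L2_cvg D w u,
        L2_cvg D (fun n => dx (w n)) (fst \o g) &
        L2_cvg D (fun n => dy (w n)) (snd \o g)].

(* The symmetric bilinear form whose quadratic form is \int_D |grad u|^2, in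
   terms of the gradients g and g' of its two arguments. *)
Definition dirichlet_form D g g' : R :=
  L2_inner D (fst \o g) (fst \o g') + L2_inner D (snd \o g) (snd \o g').

(* The graph of the self-adjoint operator A associated with the form: u is in
   the domain of A and A u = f iff u is in the form domain, f is in L^2(D) and
   the form pairs u with every v in the form domain to (f | v). *)
Definition dirichlet_laplace D u f :=
  L2 D f /\
  exists2 g, in_H10 D u g &
    forall v g', in_H10 D v g' -> dirichlet_form D g g' = L2_inner D f v.

Definition in_eigenspace D (lam : R) u := dirichlet_laplace D u (lam \*o u).

Definition eigenvalue D (lam : R) :=
  exists2 u, in_eigenspace D lam u & ~ L2_eq D u (cst 0).

Definition eigenspace_dim_ge D (lam : R) (k : nat) :=
  exists2 u : 'I_k -> R * R -> R,
    forall i, in_eigenspace D lam (u i) &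
    forall c : 'I_k -> R,
      L2_eq D (fun p => \sum_(i < k) c i * u i p) (cst 0) ->
      forall i, c i = 0.

Definition multiple_eigenvalue D (lam : R) :=
  eigenvalue D lam /\ eigenspace_dim_ge D lam 2.

End dirichlet_laplacian.

(* Main.v *)
(* In elliptic coordinates, the eigenfunctions of the ellipse [x <= x0] separate into
   products of an angular and of a radial Mathieu function, with a frequency [w] and a
   separation constant [tau] tied together by the angular boundary conditions, and
   radial part vanishing at [x0]. For each large [m], follow in [w] the [m]-th mode
   even in the second variable and the lowest odd mode. For [w = 2 m] the even radial
   function has its first zero after that of the odd one; for [w] much larger than [m]
   it comes first. At some [w >= 2 m] in between the two zeros agree; the ellipse
   that they define has a double eigenvalue, and its aspect ratio [tanh x0] tends to 0
   with [m] since [w x0] is bounded.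

   The separated solutions are written as superpositions of standing waves
   [int Phi(t) cos(k x cos t) cos(k y sin t + psi) dt] with [Phi] the angular
   function. These are smooth on the plane and solve the Helmholtz equation, and they
   vanish on the ellipse because along each hyperbola they satisfy the radial
   equation. Being O(height) at the boundary, where height is a defining function of
   the ellipse, they are limits in H^1 of their products with cutoffs
   [exp(-1/((n+1) height - 1))], hence weak eigenfunctions. *)

Require Import Defs.
From HB Require Import structures.
From mathcomp Require Import all_boot all_order all_algebra.
From mathcomp Require Import all_classical all_reals all_analysis.
From mathcomp Require Import measurable_realfun.
From mathcomp Require Import ring lra.

Import Order.TTheory GRing.Theory Num.Theory.
Import numFieldNormedType.Exports.

Local Open Scope classical_set_scope.
Local Open Scope ring_scope.

(** * Calculus and ordinary differential equations *)

(** The Mathieu functions are handled through their Pruefer phases, which solve scalar first-order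
    equations. The angular phase at [pi / 2] fixes the separation constant and, by its multiple [m]
    of [pi], the number of the mode; a radial phase equal to [pi] is a zero of the radial function.
    Phases obey comparison, increase strictly with the coefficient and depend continuously on the
    parameters, so that roots come from the intermediate value theorem and estimates from barriers.

    At [w = 2 m] the angular phase with [tau = 1] moves at speed at most [w] and gains at most
    [m pi] on [[0, pi / 2]]. The [m]-th even mode therefore has [tau >= 1], its radial coefficient
    is at most [sinh ^+ 2], and its radial phase hardly moves. For large [w] both separation
    constants are at most [1 / 4], radial phases have speed at least [3 / 4 * w], and the even one
    is a quarter turn ahead. The bound [m >= 60] makes the zeros small enough for these estimates.

    The two eigenfunctions have opposite parity in the second variable; their independence thus
    reduces to neither being zero, which is detected by derivatives at the centre. *)

Section derivation_rules.
Context {R : realType}.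
Implicit Types (f g : R -> R) (x a b : R).

Lemma drv_cst x c : is_derive x 1 (fun=> c : R) (0 : R).
Proof. exact: is_derive_cst. Qed.

Lemma drv_id x : is_derive x 1 (fun t : R => t) (1 : R).
Proof. exact: is_derive_id. Qed.

Lemma drv_add f g x a b : is_derive x 1 f a -> is_derive x 1 g b ->
  is_derive x 1 (fun t => f t + g t) (a + b).
Proof. by move=> fa gb; exact: is_deriveD. Qed.

Lemma drv_opp f x a : is_derive x 1 f a -> is_derive x 1 (fun t => - f t) (- a).
Proof. by move=> fa; exact: is_deriveN. Qed.

Lemma drv_mul f g x a b : is_derive x 1 f a -> is_derive x 1 g b ->
  is_derive x 1 (fun t => f t * g t) (f x * b + g x * a).
Proof. by move=> fa gb; exact: is_deriveM. Qed.

Lemma drv_sqr f x a : is_derive x 1 f a ->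
  is_derive x 1 (fun t => f t ^+ 2) (2 * f x * a).
Proof.
move=> fa; have := drv_mul _ _ _ _ _ fa fa.
rewrite (_ : 2 * f x * a = f x * a + f x * a); last by ring.
by [].
Qed.

Lemma drv_comp h f x a b : is_derive x 1 f a -> is_derive (f x) 1 h b ->
  is_derive x 1 (fun t => h (f t)) (b * a).
Proof. by move=> fa hb; exact: is_derive1_comp. Qed.

Lemma drv_sin f x a : is_derive x 1 f a ->
  is_derive x 1 (fun t => sin (f t)) (cos (f x) * a).
Proof. by move=> fa; apply: drv_comp => //; exact: is_derive_sin. Qed.

Lemma drv_cos f x a : is_derive x 1 f a ->
  is_derive x 1 (fun t => cos (f t)) (- sin (f x) * a).
Proof. by move=> fa; apply: drv_comp => //; exact: is_derive_cos. Qed.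

Lemma drv_exp f x a : is_derive x 1 f a ->
  is_derive x 1 (fun t => expR (f t)) (expR (f x) * a).
Proof. by move=> fa; apply: drv_comp => //; exact: is_derive_expR. Qed.

Lemma drv_eq f x a b : is_derive x 1 f a -> a = b -> is_derive x 1 f b.
Proof. by move=> + <-. Qed.

Lemma drv_continuous f x a : is_derive x 1 f a -> {for x, continuous f}.
Proof. by move=> [fa _]; apply: differentiable_continuous; exact/derivable1_diffP. Qed.

Lemma drv_within_continuous f (df : R -> R) a b :
  (forall x, x \in `[a, b] -> is_derive x 1 f (df x)) -> {within `[a, b], continuous f}.
Proof.
move=> fdf; apply: continuous_in_subspaceT => x.
by rewrite inE /= => xab; apply: drv_continuous (fdf x _).
Qed.

End derivation_rules.

(** The derivative is computed into a unification variable, which leaves as goal its equality with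
    the claimed one, usually for [ring]. Hypotheses are tried before the rules, so that unknown
    functions can occur. *)
Ltac der := notypeclasses refine (drv_eq _ _ _ _ _ _); [repeat first
  [ eassumption | notypeclasses refine (drv_cst _ _) | notypeclasses refine (drv_id _)
  | notypeclasses refine (drv_opp _ _ _ _) | notypeclasses refine (drv_add _ _ _ _ _ _ _)
  | notypeclasses refine (drv_sqr _ _ _ _) | notypeclasses refine (drv_mul _ _ _ _ _ _ _)
  | notypeclasses refine (drv_sin _ _ _ _) | notypeclasses refine (drv_cos _ _ _ _)
  | notypeclasses refine (drv_exp _ _ _ _) ] | rewrite /=].

Section continuity_rules.
Context {R : realType} {T : topologicalType}.
Implicit Types (f g : T -> R) (x : T).

Lemma cts_cst x (c : R) : continuous_at x (fun=> c : R).
Proof. exact: cvg_cst. Qed.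

Lemma cts_add f g x : continuous_at x f -> continuous_at x g ->
  continuous_at x (fun t => f t + g t).
Proof. exact: continuousD. Qed.

Lemma cts_opp f x : continuous_at x f -> continuous_at x (fun t => - f t).
Proof. exact: continuousN. Qed.

Lemma cts_mul f g x : continuous_at x f -> continuous_at x g ->
  continuous_at x (fun t => f t * g t).
Proof. exact: continuousM. Qed.

Lemma cts_comp (h : R -> R) f x : continuous_at x f -> continuous h ->
  continuous_at x (fun t => h (f t)).
Proof. by move=> cf ch; apply: continuous_comp => //; exact: ch. Qed.

Lemma cts_expn f x n : continuous_at x f -> continuous_at x (fun t => f t ^+ n).
Proof. by move=> cf; apply: (cts_comp (fun t => t ^+ n)) => //; exact: exprn_continuous. Qed.

Lemma cts_cos f x : continuous_at x f -> continuous_at x (fun t => cos (f t)).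
Proof. by move=> cf; apply: cts_comp => //; exact: continuous_cos. Qed.

Lemma cts_sin f x : continuous_at x f -> continuous_at x (fun t => sin (f t)).
Proof. by move=> cf; apply: cts_comp => //; exact: continuous_sin. Qed.

Lemma cts_exp f x : continuous_at x f -> continuous_at x (fun t => expR (f t)).
Proof. by move=> cf; apply: cts_comp => //; exact: continuous_expR. Qed.

Lemma cts_norm f x : continuous_at x f -> continuous_at x (fun t => `|f t|).
Proof. by move=> cf; apply: cts_comp => //; exact: norm_continuous. Qed.

End continuity_rules.

Lemma cts_id {T : topologicalType} (x : T) : continuous_at x (fun t => t).
Proof. exact: cvg_id. Qed.

Lemma cts_fst {T U : topologicalType} (x : T * U) : continuous_at x (fun t => t.1).
Proof. exact: cvg_fst. Qed.

Lemma cts_snd {T U : topologicalType} (x : T * U) : continuous_at x (fun t => t.2).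
Proof. exact: cvg_snd. Qed.

Ltac cont1 :=
  lazymatch goal with
  | |- continuous_at _ (fun=> ?c) => apply: cts_cst
  | |- continuous_at _ (fun t => t) => apply: cts_id
  | |- continuous_at _ (fun t => t.1) => apply: cts_fst
  | |- continuous_at _ (fun t => t.2) => apply: cts_snd
  | |- continuous_at _ (fun t => @GRing.add _ _ _) => apply: cts_add
  | |- continuous_at _ (fun t => @GRing.opp _ _) => apply: cts_opp
  | |- continuous_at _ (fun t => @GRing.mul _ _ _) => apply: cts_mul
  | |- continuous_at _ (fun t => @GRing.exp _ _ _) => apply: cts_expn
  | |- continuous_at _ (fun t => cos _) => apply: cts_cos
  | |- continuous_at _ (fun t => sin _) => apply: cts_sin
  | |- continuous_at _ (fun t => expR _) => apply: cts_exp
  | |- continuous_at _ (fun t => `|_|) => apply: cts_norm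
  | |- continuous_at _ (@fst _ _) => apply: cts_fst
  | |- continuous_at _ (@snd _ _) => apply: cts_snd
  | |- continuous_at _ (@GRing.opp _) => apply: (cts_opp (fun t => t)); exact: cts_id
  | |- continuous_at _ (@cos _) => exact: continuous_cos
  | |- continuous_at _ (@sin _) => exact: continuous_sin
  | |- continuous_at _ (@expR _) => exact: continuous_expR
  | H : continuous ?f |- continuous_at _ (fun t => ?f t) => exact: H
  | H : continuous ?f |- continuous_at _ ?f => exact: H
  | H : continuous ?h |- continuous_at _ (fun t => ?h _) => apply: (cts_comp h); [|exact: H]
  | H : _ |- _ => eassumption
  end.
Ltac cont := try (match goal with |- prop_for _ _ => unfold prop_for end); repeat cont1.
Ltac conts := let x := fresh "x" in move=> x; cont.

(** * Differential inequalities and comparison of solutions *)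

Section gronwall.
Context {R : realType}.
Implicit Types (d : R -> R) (a b t : R).

Lemma le_of_derive_ge0 d (d' : R -> R) a b : a <= b ->
  (forall t, t \in `[a, b] -> is_derive t 1 d (d' t)) ->
  (forall t, t \in `]a, b[ -> 0 <= d' t) -> d a <= d b.
Proof.
move=> ab dd d0; have cd := drv_within_continuous _ _ _ _ dd.
have [ab'|ba|<-] := ltgtP a b; [|by move: ab; rewrite leNgt ba|exact: lexx].
have dd' x : x \in `]a, b[ -> is_derive x 1 d (d' x).
  by move=> xab; apply: dd; apply: subset_itv_oo_cc.
have [c cab e] := MVT ab' dd' cd.
by rewrite -subr_ge0 e mulr_ge0 ?d0// subr_ge0 ltW.
Qed.

(** If [d t1 > 0], let [s0] be the last time before [t1] with [d <= 0]. After [s0] the differential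
    inequality is in force, so [expR (- L * t) * d t] does not increase and cannot become
    positive. *)
Lemma gronwall_le0 d (d' : R -> R) (L T : R) :
  (forall t, t \in `[0, T] -> is_derive t 1 d (d' t)) ->
  (forall t, t \in `[0, T] -> 0 < d t -> d' t <= L * d t) ->
  d 0 <= 0 -> forall t, t \in `[0, T] -> d t <= 0.
Proof.
move=> dd dL d00 t1 t1T; rewrite leNgt; apply/negP => dt1.
have t10 : 0 <= t1 by rewrite (itvP t1T).
have t1T' : t1 <= T by rewrite (itvP t1T).
pose S := [set s | 0 <= s <= t1 /\ d s <= 0].
have S0 : S 0 by split => //; rewrite lexx.
have hS : has_sup S by split; [exists 0 | exists t1 => s [/andP[]]].
pose s0 : R := sup S.
have s00 : 0 <= s0 by apply: ub_le_sup S0; exact: hS.2.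
have s01 : s0 <= t1 by apply: sup_le_ub => [|s [/andP[]]//]; exact: hS.1.
have cd s : s \in `[0, T] -> {for s, continuous d} by move=> /dd; exact: drv_continuous.
have ds0 : d s0 <= 0.
  rewrite leNgt; apply/negP => ds0.
  have : {for s0, continuous d} by apply: cd; rewrite in_itv/= s00 (le_trans s01).
  move=> /(_ [set x | 0 < x]) /= /(_ (open_nbhs_nbhs _)) [].
    by split; [exact: open_gt|].
  move=> e /= e0 He.
  have [s Ss es] := sup_adherent e0 hS.
  have ss0 : s <= s0 by apply: ub_le_sup => //; exact: hS.2.
  have : 0 < d s by apply: He; rewrite /ball_ /= ger0_norm ?subr_ge0// ltrBlDl -ltrBlDr.
  by case: Ss => _ /le_lt_trans H /H; rewrite ltxx.
have dpos s : s0 < s -> s <= t1 -> 0 < d s.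
  move=> ss st; rewrite ltNge; apply/negP => ds.
  suff : s <= s0 by rewrite leNgt ss.
  apply: ub_le_sup; first exact: hS.2.
  by split => //; rewrite st (le_trans s00)// ltW.
pose g (t : R) : R := - (expR (- L * t) * d t).
have gd t : t \in `[s0, t1] ->
    is_derive t 1 g (expR (- L * t) * (L * d t - d' t)).
  move=> ts; have dt : is_derive t 1 d (d' t).
    apply: dd; rewrite in_itv/= (le_trans s00) ?(itvP ts)//.
    by rewrite (le_trans _ t1T')// (itvP ts).
  by rewrite /g; der; ring.
have := le_of_derive_ge0 _ _ _ _ s01 gd.
rewrite /g lerN2 => H.
have {}H : expR (- L * t1) * d t1 <= expR (- L * s0) * d s0.
  apply: H => t ts; rewrite mulr_ge0 ?expR_ge0// subr_ge0 dL//.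
    rewrite in_itv/= (le_trans s00) ?(itvP ts)//.
    by rewrite (le_trans _ t1T')// (itvP ts).
  by apply: dpos; rewrite (itvP ts).
have ds0' : expR (- L * s0) * d s0 <= 0 by apply: mulr_ge0_le0 => //; exact: expR_ge0.
by move: (le_trans H ds0'); rewrite leNgt mulr_gt0 ?expR_gt0.
Qed.

(** [y] is a subsolution and [z] a supersolution. Where [y] exceeds [z], the one-sided Lipschitz
    bound gives the inequality that the Gronwall argument asks of [y - z]. *)
Lemma comparison (f : R -> R -> R) (y y' z z' : R -> R) (L T : R) :
  (forall t a b, t \in `[0, T] -> b <= a -> f t a - f t b <= L * (a - b)) ->
  (forall t, t \in `[0, T] -> is_derive t 1 y (y' t)) ->
  (forall t, t \in `[0, T] -> is_derive t 1 z (z' t)) ->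
  (forall t, t \in `[0, T] -> y' t <= f t (y t)) ->
  (forall t, t \in `[0, T] -> f t (z t) <= z' t) ->
  y 0 <= z 0 -> forall t, t \in `[0, T] -> y t <= z t.
Proof.
move=> fL yy zz yf zf yz0 t tT; rewrite -subr_le0.
apply: (gronwall_le0 (fun t => y t - z t) (fun t => y' t - z' t) L T) => //.
- by move=> s sT; have := yy _ sT; have := zz _ sT => H1 H2; der.
- move=> s sT; rewrite subr_gt0 => zy; apply: le_trans (fL s _ _ sT (ltW zy)).
  by rewrite lerB ?yf ?zf.
- by rewrite subr_le0.
Qed.

End gronwall.

(** * Primitives of continuous functions on the whole line *)

Section primitive.
Context {R : realType}.
Local Notation mu := (@lebesgue_measure R).

Lemma continuous_integrable (g : R -> R) a b : continuous g ->
  mu.-integrable `[a, b] (EFin \o g).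
Proof.
move=> cg; apply: continuous_compact_integrable; first exact: segment_compact.
exact: continuous_subspaceT.
Qed.

Lemma primitive_exists (g : R -> R) : continuous g ->
  exists2 G : R -> R, G 0 = 0 & forall t : R, is_derive t 1 G (g t).
Proof.
move=> cg; pose I (a b : R) := \int[mu]_(s in `[a, b]) g s.
have Iab (a b c : R) : a <= b -> b <= c -> I a c = I a b + I b c.
  move=> ab bc; have := @Rintegral_itvB R g (BLeft a) (BRight c) b (continuous_integrable _ a c cg).
  rewrite !bnd_simp => /(_ ab bc) /eqP; rewrite subr_eq => /eqP e; rewrite /I e.
  rewrite addrC; congr (_ + _); apply: Rintegral_itv_obnd_cbnd.
  apply: integrableS (continuous_integrable _ b c cg) => //.
  by apply: subset_itvr; rewrite bnd_simp.
have I0 (a : R) : I a a = 0 by rewrite /I set_itv1 Rintegral_set1.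
pose G (t : R) : R := if 0 <= t then I 0 t else - I t 0.
have GE (N t : R) : N <= 0 -> N <= t -> G t = I N t - I N 0.
  move=> N0 Nt; rewrite /G; case: leP => t0.
    by rewrite (Iab N 0 t)// addrAC subrr add0r.
  by rewrite (Iab N t 0) ?(ltW t0)// opprD addrA subrr add0r.
exists G; first by rewrite /G lexx I0.
(* A base point to the left of both [0] and [t]: near [t] the function [G] is the integral from [N]
   minus a constant, whatever the sign of [t]. *)
move=> t; pose N : R := - (`|t| + 1).
have N0 : N <= 0 by rewrite /N oppr_le0 addr_ge0.
have Nt : N < t by rewrite /N ltrNl (le_lt_trans (ler_norm _))// normrN ltrDl.
have tt1 : t < t + 1 by rewrite ltrDl.
have [d1 d2] := @continuous_FTC1_closed R g N t (t + 1) tt1 (continuous_integrable _ _ _ cg) Nt (cg t).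
have H : is_derive t 1 (I N) (g t) by apply: DeriveDef; [exact: d1|rewrite -derive1E; exact: d2].
have H2 : is_derive t 1 (fun s => I N s - I N 0) (g t) by der; rewrite addr0.
apply: near_eq_is_derive H2.
near=> s; apply/esym/GE => //; apply/ltW; near: s.
exact: lt_nbhsr.
Unshelve. all: by end_near. Qed.

End primitive.

(** * Growth estimates and global existence by Picard iteration *)

Section growth.
Context {R : realType}.

Lemma derive_le_le (d e : R -> R) (d' e' : R -> R) (T : R) :
  (forall t, t \in `[0, T] -> is_derive t 1 d (d' t)) ->
  (forall t, t \in `[0, T] -> is_derive t 1 e (e' t)) ->
  (forall t, t \in `[0, T] -> d' t <= e' t) -> d 0 <= e 0 ->
  forall t, t \in `[0, T] -> d t <= e t.
Proof.
move=> dd ee de d0 t tT.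
have tge0 : 0 <= t by rewrite (itvP tT).
have sub s : s \in `[0, t] -> s \in `[0, T].
  by move=> st; rewrite in_itv/= (itvP st)/= (le_trans (y := t)) ?(itvP st)// (itvP tT).
have H := le_of_derive_ge0 (fun t => e t - d t) (fun t => e' t - d' t) 0 t tge0.
have {}H : e 0 - d 0 <= e t - d t.
  apply: H => s st.
    exact: (drv_add _ _ _ _ _ (ee _ (sub _ st)) (drv_opp _ _ _ (dd _ (sub _ st)))).
  by rewrite subr_ge0 de// sub//; exact: subset_itv_oo_cc.
by rewrite -subr_ge0 (le_trans _ H)// subr_ge0.
Qed.

(** Comparison with the primitive of the bound. Integration gains a factor [1 / L], which makes the
    Picard map contract for an exponential weight. *)
Lemma exp_growth_pos (d : R -> R) (d' : R -> R) (L K : R) : 0 < L ->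
  d 0 = 0 -> (forall t : R, is_derive t 1 d (d' t)) ->
  (forall t : R, 0 <= t -> `|d' t| <= L * K * expR (L * t)) ->
  forall t : R, 0 <= t -> `|d t| <= K * (expR (L * t) - 1).
Proof.
move=> L0 d0 dd dK t t0.
have de (s : R) : is_derive s 1 (fun t => K * (expR (L * t) - 1)) (L * K * expR (L * s)).
  by der; ring.
have tt : t \in `[0, t] by rewrite in_itv/= t0 lexx.
rewrite ler_norml; apply/andP; split.
- rewrite lerNl; apply: (derive_le_le (fun t => - d t) _ (fun t => - d' t) _ t) => //.
  + by move=> s st; rewrite (le_trans (ler_norm _))// normrN dK// (itvP st).
  + by rewrite d0 mulr0 expR0 subrr mulr0 oppr0.
- apply: (derive_le_le d _ d' _ t) => //.
  + by move=> s st; rewrite (le_trans (ler_norm _))// dK// (itvP st).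
  + by rewrite d0 mulr0 expR0 subrr mulr0.
Qed.

Lemma exp_growth (d : R -> R) (d' : R -> R) (L K : R) : 0 < L ->
  d 0 = 0 -> (forall t : R, is_derive t 1 d (d' t)) ->
  (forall t : R, `|d' t| <= L * K * expR (L * `|t|)) ->
  forall t : R, `|d t| <= K * (expR (L * `|t|) - 1).
Proof.
move=> L0 d0 dd dK t; have [t0|t0] := leP 0 t.
  rewrite (ger0_norm t0); apply: (exp_growth_pos d d') => // s s0.
  by rewrite -{2}(ger0_norm s0).
have nt0 : 0 <= - t by rewrite oppr_ge0 ltW.
rewrite (ltr0_norm t0) -{1}(opprK t).
apply: (exp_growth_pos (fun s => d (- s)) (fun s => - d' (- s))) => //.
- by rewrite oppr0.
- move=> s; have h := dd (- s); apply: drv_eq.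
  by rewrite mulrN1.
- by move=> s s0; rewrite normrN (le_trans (dK _))// normrN (ger0_norm s0).
Qed.

(** The intervals of centre [u n] and radius [2 * B / 2 ^+ n], the tail of the geometric series, are
    nested; the supremum of their left ends lies in all of them. *)
Lemma geometric_cvg (u : nat -> R) (B : R) :
  (forall n, `|u n.+1 - u n| <= B / 2 ^+ n) ->
  exists l, forall n, `|l - u n| <= 2 * B / 2 ^+ n.
Proof.
move=> uB; pose e n : R := 2 * B / 2 ^+ n.
have eS n : e n = e n.+1 + B / 2 ^+ n.
  rewrite /e exprS; have : (2 : R) ^+ n != 0 by rewrite expf_neq0.
  by move: (2 ^+ n) => x x0; field.
have B0 : 0 <= B by have := uB 0%N; rewrite expr0 divr1; exact: le_trans.
have e0 n : 0 <= e n by rewrite /e !mulr_ge0// invr_ge0 exprn_ge0.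
have vS n : u n - e n <= u n.+1 - e n.+1.
  by have := uB n; rewrite ler_norml => /andP[h _]; have := eS n; lra.
have wS n : u n.+1 + e n.+1 <= u n + e n.
  by have := uB n; rewrite ler_norml => /andP[_ h]; have := eS n; lra.
have vmono n k : u n - e n <= u (n + k)%N - e (n + k)%N.
  by elim: k => [|k IH]; [rewrite addn0|rewrite addnS (le_trans IH)].
have wmono n k : u (n + k)%N + e (n + k)%N <= u n + e n.
  by elim: k => [|k IH]; [rewrite addn0|rewrite addnS (le_trans _ IH)].
have vw n m : u n - e n <= u m + e m.
  apply: le_trans (vmono n m) _; rewrite addnC; apply: le_trans _ (wmono m n).
  by have := e0 (m + n)%N; lra.
pose S := [set x : R | exists n, x = u n - e n].
have hS : has_sup S.
  by split; [exists (u 0%N - e 0%N), 0%N | exists (u 0%N + e 0%N) => x [n ->]].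
exists (sup S) => n; rewrite ler_norml.
have h1 : u n - e n <= sup S by apply: ub_le_sup; [exact: hS.2|exists n].
have h2 : sup S <= u n + e n by apply: sup_le_ub => [|x [m ->]]; [exact: hS.1|exact: vw].
by apply/andP; move: h1 h2; rewrite /e; split; lra.
Qed.

Lemma lipschitz_continuous (y : R -> R) (M : R) :
  (forall s t, `|y s - y t| <= M * `|s - t|) -> continuous y.
Proof.
move=> yM t; apply/cvgrPdist_lt => e e0.
have M1 : 0 < `|M| + 1 by rewrite ltr_wpDl.
near=> s; apply: le_lt_trans (yM _ _) _.
apply: (@le_lt_trans _ _ ((`|M| + 1) * `|t - s|)).
  by rewrite ler_wpM2r// (le_trans (ler_norm _))// lerDl.
rewrite mulrC -ltr_pdivlMr//; near: s.
by apply: cvgr_dist_lt; [exact: cvg_id|exact: divr_gt0].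
Unshelve. all: by end_near. Qed.

Lemma derive_lipschitz (y y' : R -> R) (M : R) :
  (forall t : R, is_derive t 1 y (y' t)) -> (forall t, `|y' t| <= M) ->
  forall s t, `|y s - y t| <= M * `|s - t|.
Proof.
move=> dy yM; suff H s t : s < t -> `|y s - y t| <= M * `|s - t|.
  move=> s t; case: (ltgtP s t) => [/H//|/H|->]; last by rewrite !subrr normr0 mulr0.
  by rewrite (distrC (y t)) (distrC t).
move=> st; have [|c _ e] := MVT st (fun x _ => dy x).
  by apply: drv_within_continuous => x _; exact: dy.
by rewrite distrC e normrM (distrC s) ler_wpM2r.
Qed.

(** With a global Lipschitz constant, the iteration contracts by [1 / 2] on the whole line for the
    weight [expR (2 * L * |t|)], and there are no local solutions to continue. The bound [M] gives
    all later iterates the same Lipschitz constant, hence a continuous limit. *)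
Lemma picard (f : R -> R -> R) (L M y0 : R) : 0 < L ->
  (forall y, continuous y -> continuous (fun t => f t (y t))) ->
  (forall t a b, `|f t a - f t b| <= L * `|a - b|) ->
  (forall t a, `|f t a| <= M) ->
  exists2 y : R -> R, y 0 = y0 & forall t : R, is_derive t 1 y (f t (y t)).
Proof.
move=> L0 cf fL fM.
have M0 : 0 <= M := le_trans (normr_ge0 _) (fM 0 0).
(* [I] picks a primitive vanishing at [0] for each continuous function; its value on other functions
   is arbitrary. *)
pose P (g G : R -> R) := continuous g -> G 0 = 0 /\ forall t : R, is_derive t 1 G (g t).
have [I PI] : {I : (R -> R) -> (R -> R) & forall g, P g (I g)}.
  apply: (@choice _ _ P) => g; have [cg|ncg] := pselect (continuous g).
    by have [G G0 dG] := primitive_exists g cg; exists G => _.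
  by exists g => cg; case: (ncg cg).
pose nxt (y : R -> R) : R -> R := fun t => y0 + I (fun s => f s (y s)) t.
have nxt_d y : continuous y -> forall t : R, is_derive t 1 (nxt y) (f t (y t)).
  move=> cy t; have [_ h] := PI _ (cf _ cy); have := h t => {}h.
  by rewrite /nxt; der; rewrite add0r.
have nxt0 y : continuous y -> nxt y 0 = y0.
  by move=> cy; have [h _] := PI _ (cf _ cy); rewrite /nxt h addr0.
pose Y n := iter n nxt (cst y0).
have cY n : continuous (Y n).
  elim: n => [|n IH]; first exact: cst_continuous.
  by move=> t; apply: drv_continuous (nxt_d _ IH t).
have nxt_lip y : continuous y -> forall s t, `|nxt y s - nxt y t| <= M * `|s - t|.
  by move=> cy; apply: derive_lipschitz => [t|t]; [exact: nxt_d|exact: fM].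
have nxt_contr (y z : R -> R) (K : R) : continuous y -> continuous z ->
    (forall t : R, `|y t - z t| <= K * expR (2 * L * `|t|)) ->
    forall t : R, `|nxt y t - nxt z t| <= K / 2 * expR (2 * L * `|t|).
  move=> cy cz yz t; have K0 : 0 <= K.
    by rewrite -(pmulr_lge0 K (expR_gt0 (2 * L * `|t|))) (le_trans _ (yz t)).
  have LL : 0 < 2 * L by rewrite mulr_gt0.
  apply: (@le_trans _ _ (K / 2 * (expR (2 * L * `|t|) - 1))).
    apply: (exp_growth (fun t => nxt y t - nxt z t) (fun t => f t (y t) - f t (z t))) => //.
    - by rewrite !nxt0// subrr.
    - by move=> s; have h1 := nxt_d _ cy s; have h2 := nxt_d _ cz s; der.
    - move=> s; apply: le_trans (fL _ _ _) _.
      rewrite (_ : 2 * L * (K / 2) * _ = L * (K * expR (2 * L * `|s|))); last by field.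
      by rewrite ler_wpM2l// ltW.
  by rewrite ler_wpM2l ?divr_ge0//; lra.
pose C := M / (2 * L).
have C0 : 0 <= C by rewrite divr_ge0// mulr_ge0// ltW.
have Y01 t : `|Y 1%N t - Y 0%N t| <= C * expR (2 * L * `|t|).
  apply: (@le_trans _ _ (C * (expR (2 * L * `|t|) - 1))); last by rewrite ler_wpM2l//; lra.
  apply: (exp_growth (fun t => Y 1%N t - Y 0%N t) (fun t => f t y0)).
  - by rewrite mulr_gt0.
  - by rewrite /Y /= nxt0 ?subrr//; exact: cst_continuous.
  - by move=> s; have h := nxt_d _ (cY 0%N) s; rewrite /Y /=; der; ring.
  - move=> s; apply: le_trans (fM _ _) _.
    rewrite /C (_ : 2 * L * (M / (2 * L)) = M); last by field; lra.
    by rewrite ler_peMr// -expR0 ler_expR !mulr_ge0// ltW.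
have YS n : forall t, `|Y n.+1 t - Y n t| <= C / 2 ^+ n * expR (2 * L * `|t|).
  elim: n => [t|n IH t]; first by rewrite expr0 divr1 Y01.
  have := nxt_contr _ _ _ (cY n.+1) (cY n) IH t.
  by rewrite exprS invfM (mulrC 2^-1) mulrA; exact.
have /choice[y yY] t : exists l, forall n, `|l - Y n t| <= 2 * (C * expR (2 * L * `|t|)) / 2 ^+ n.
  apply: geometric_cvg => n; rewrite (le_trans (YS n t))//.
  by rewrite mulrAC lexx.
have yY' n t : `|y t - Y n t| <= 2 * C / 2 ^+ n * expR (2 * L * `|t|).
  by rewrite (le_trans (yY t n))// !mulrA [leLHS]mulrAC lexx.
have small (a b : R) : 0 <= b -> (forall n, a <= b / 2 ^+ n) -> a <= 0.
  move=> b0 ab; rewrite leNgt; apply/negP => a0.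
  have [n nb] : exists n : nat, b / a < n%:R.
    by exists (Num.bound (b / a)); apply: archi_boundP; rewrite divr_ge0// ltW.
  have := ab n; rewrite leNgt => /negP; apply.
  rewrite ltr_pdivrMr ?exprn_gt0// mulrC -ltr_pdivrMr// (lt_le_trans nb)//.
  by rewrite -natrX ler_nat ltnW// ltn_expl.
have cy : continuous y.
  apply: (lipschitz_continuous _ M) => s t; rewrite -subr_le0.
  apply: (small _ (2 * C * expR (2 * L * `|s|) + 2 * C * expR (2 * L * `|t|))).
    by rewrite addr_ge0// mulr_ge0 ?expR_ge0// mulr_ge0.
  move=> n; have h1 := yY' n.+1 s; have h2 := yY' n.+1 t.
  have h3 := nxt_lip _ (cY n) s t; rewrite -/(Y n.+1) in h3.
  have : `|y s - y t| <= `|y s - Y n.+1 s| + `|Y n.+1 s - Y n.+1 t| + `|y t - Y n.+1 t|.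
    rewrite (distrC (y t)).
    rewrite (_ : y s - y t = (y s - Y n.+1 s) + (Y n.+1 s - Y n.+1 t) + (Y n.+1 t - y t)); last by ring.
    by rewrite (le_trans (ler_normD _ _))// lerD2r ler_normD.
  have p2 : 2 * C / 2 ^+ n.+1 <= 2 * C / 2 ^+ n.
    have -> : 2 * C / 2 ^+ n = 2 * (2 * C / 2 ^+ n.+1).
      rewrite exprS; have : (2 : R) ^+ n != 0 by rewrite expf_neq0.
      by move: (2 ^+ n) => x x0; field.
    have : 0 <= 2 * C / 2 ^+ n.+1 by rewrite divr_ge0 ?exprn_ge0// mulr_ge0.
    by lra.
  have h1' := ler_wpM2r (expR_ge0 (2 * L * `|s|)) p2.
  have h2' := ler_wpM2r (expR_ge0 (2 * L * `|t|)) p2.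
  rewrite (mulrDl _ _ (2 ^+ n)^-1) (mulrAC (2 * C) _ (2 ^+ n)^-1) (mulrAC (2 * C) _ (2 ^+ n)^-1).
  move: h1 h2 h3 h1' h2'; rewrite -/(Y n.+1).
  by lra.
have ynxt t : y t = nxt y t.
  apply/eqP; rewrite -subr_eq0 -normr_le0.
  apply: (small _ (4 * C * expR (2 * L * `|t|))); first by rewrite mulr_ge0 ?expR_ge0// mulr_ge0.
  move=> n; have h1 := yY' n.+1 t.
  have h2 := nxt_contr _ _ _ cy (cY n) (yY' n) t; rewrite -/(Y n.+1) in h2.
  have : `|y t - nxt y t| <= `|y t - Y n.+1 t| + `|nxt y t - Y n.+1 t|.
    rewrite (distrC (nxt y t)) (_ : y t - nxt y t = (y t - Y n.+1 t) + (Y n.+1 t - nxt y t)); last by ring.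
    exact: ler_normD.
  have p2 : 2 * C / 2 ^+ n.+1 * expR (2 * L * `|t|) = C / 2 ^+ n * expR (2 * L * `|t|).
    rewrite exprS; have : (2 : R) ^+ n != 0 by rewrite expf_neq0.
    by move: (2 ^+ n) => x x0; field.
  have p3 : 2 * C / 2 ^+ n / 2 * expR (2 * L * `|t|) = C / 2 ^+ n * expR (2 * L * `|t|).
    by rewrite (mulrAC _ _ 2^-1) (mulrAC 2) divff// mul1r.
  have p4 : 4 * C * expR (2 * L * `|t|) / 2 ^+ n = 4 * (C / 2 ^+ n * expR (2 * L * `|t|)).
    by rewrite -!mulrA (mulrC (expR _)).
  have p5 : 0 <= C / 2 ^+ n * expR (2 * L * `|t|).
    by rewrite mulr_ge0 ?expR_ge0// divr_ge0 ?exprn_ge0.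
  by lra.
exists y; first by rewrite ynxt nxt0.
move=> t; rewrite (_ : y = nxt y); last by apply/funext.
by rewrite -ynxt; exact: nxt_d.
Qed.

End growth.

(** * Mathieu phases *)

Section phase.
Context {R : realType}.
Implicit Types (w K T s t eta : R) (q y z : R -> R).

(* Pruefer phase: if [u'' = - w^2 q u], then [u = r sin y] and [u' = w r cos y]
   with [r > 0] and [y] a solution of this first-order equation. *)
Definition phase w q (y0 : R) y :=
  y 0 = y0 /\ forall t : R, is_derive t 1 y (w * (cos (y t) ^+ 2 + q t * sin (y t) ^+ 2)).

Lemma phase_rhs_lip w K (c a b : R) : 0 <= w -> `|c| <= K ->
  `|w * (cos a ^+ 2 + c * sin a ^+ 2) - w * (cos b ^+ 2 + c * sin b ^+ 2)|
  <= 2 * w * (K + 1) * `|a - b|.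
Proof.
move=> w0 cK; have K0 := le_trans (normr_ge0 _) cK.
apply: (derive_lipschitz (fun a => w * (cos a ^+ 2 + c * sin a ^+ 2))
  (fun a => 2 * w * ((c - 1) * (sin a * cos a)))) => t; first by der; ring.
rewrite normrM (ger0_norm (mulr_ge0 _ _))// ler_wpM2l ?mulr_ge0//.
rewrite normrM; apply: (@le_trans _ _ ((K + 1) * 1)); last by rewrite mulr1.
apply: ler_pM => //; first by rewrite (le_trans (ler_normB _ _))// normr1 lerD2r.
rewrite normrM; apply: (@le_trans _ _ (1 * 1)); last by rewrite mulr1.
by apply: ler_pM => //; [exact: sin_max|exact: cos_max].
Qed.

Lemma phase_exists w q (y0 : R) K : 0 < w -> continuous q -> (forall t, `|q t| <= K) ->
  exists y, phase w q y0 y.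
Proof.
move=> w0 cq qK; have K0 := le_trans (normr_ge0 _) (qK 0).
have [||||y yy0 dy] := picard (fun t (y : R) => w * (cos y ^+ 2 + q t * sin y ^+ 2))
  (2 * w * (K + 1)) (w * (1 + K)) y0.
- by rewrite !mulr_gt0// ltr_wpDl.
- by move=> y cy; conts.
- by move=> t a b; apply: phase_rhs_lip; [exact: ltW|exact: qK].
- move=> t a; rewrite normrM gtr0_norm//; apply: ler_wpM2l; first exact: ltW.
  rewrite (le_trans (ler_normD _ _))// lerD//.
    by rewrite normrX exprn_ile1// cos_max.
  rewrite normrM; apply: (@le_trans _ _ (K * 1)); last by rewrite mulr1.
  by apply: ler_pM => //; rewrite normrX exprn_ile1// sin_max.
- by exists y.
Qed.

(** One chosen solution (the zero function if there is none), which turns the phase into a function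
    of its parameters. *)
Definition phase_sol w q (y0 : R) : R -> R := xget (cst 0) [set y | phase w q y0 y].

Lemma phase_solP w q (y0 : R) K : 0 < w -> continuous q -> (forall t, `|q t| <= K) ->
  phase w q y0 (phase_sol w q y0).
Proof.
by move=> w0 cq qK; apply: (@xgetPex _ (cst 0) [set y | phase w q y0 y]); exact: phase_exists.
Qed.

Lemma phase_continuous w q (y0 : R) y : phase w q y0 y -> continuous y.
Proof. by move=> [_ dy] t; apply: drv_continuous (dy t). Qed.

(** A supersolution is an upper barrier. The explicit upper bounds on angular and radial phases all
    come from a constant or affine [z]. *)
Lemma phase_le w q (y0 : R) y (z z' : R -> R) K T : 0 < w -> (forall t, `|q t| <= K) ->
  phase w q y0 y ->
  (forall t, t \in `[0, T] -> is_derive t 1 z (z' t)) ->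
  (forall t, t \in `[0, T] -> w * (cos (z t) ^+ 2 + q t * sin (z t) ^+ 2) <= z' t) ->
  y0 <= z 0 -> forall t, t \in `[0, T] -> y t <= z t.
Proof.
move=> w0 qK [y0E dy] dz zz yz0.
apply: (comparison (fun t (y : R) => w * (cos y ^+ 2 + q t * sin y ^+ 2)) y
  (fun t => w * (cos (y t) ^+ 2 + q t * sin (y t) ^+ 2)) z z' (2 * w * (K + 1)) T) => //.
- move=> t a b _ ba; apply: le_trans (ler_norm _) _.
  by rewrite -(@ger0_norm _ (a - b)) ?subr_ge0//; apply: phase_rhs_lip => //; exact: ltW.
- by rewrite y0E.
Qed.

Lemma phase_ge w q (y0 : R) y (z z' : R -> R) K T : 0 < w -> (forall t, `|q t| <= K) ->
  phase w q y0 y ->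
  (forall t, t \in `[0, T] -> is_derive t 1 z (z' t)) ->
  (forall t, t \in `[0, T] -> z' t <= w * (cos (z t) ^+ 2 + q t * sin (z t) ^+ 2)) ->
  z 0 <= y0 -> forall t, t \in `[0, T] -> z t <= y t.
Proof.
move=> w0 qK [y0E dy] dz zz yz0.
apply: (comparison (fun t (y : R) => w * (cos y ^+ 2 + q t * sin y ^+ 2)) z z' y
  (fun t => w * (cos (y t) ^+ 2 + q t * sin (y t) ^+ 2)) (2 * w * (K + 1)) T) => //.
- move=> t a b _ ba; apply: le_trans (ler_norm _) _.
  by rewrite -(@ger0_norm _ (a - b)) ?subr_ge0//; apply: phase_rhs_lip => //; exact: ltW.
- by rewrite y0E.
Qed.

(** The added term solves [e' = L * e + 2 * eta] with [e 0 = 0]. Its growth [L * e] pays for the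
    Lipschitz dependence on the phase, and [2 * eta] for the errors in front of [cos ^+ 2] and
    [sin ^+ 2]; hence [z + e] is a supersolution of the equation of [y]. *)
Lemma phase_close_le (w1 w2 : R) (q1 q2 : R -> R) (y0 : R) y z K (L : R) T eta : 0 < w1 ->
  2 * w1 * (K + 1) <= L ->
  (forall t, `|q1 t| <= K) -> 0 <= eta ->
  phase w1 q1 y0 y -> phase w2 q2 y0 z ->
  `|w1 - w2| <= eta -> (forall t, t \in `[0, T] -> `|w1 * q1 t - w2 * q2 t| <= eta) ->
  forall t, t \in `[0, T] ->
    y t <= z t + 2 * eta / L * (expR (L * t) - 1).
Proof.
move=> w0 KL qK eta0 yp [z0 dz] ww qq t tT.
have K0 := le_trans (normr_ge0 _) (qK 0).
have L0 : 0 < L by rewrite (lt_le_trans _ KL)// !mulr_gt0// ltr_wpDl.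
apply: (phase_le _ _ _ _ (fun t => z t + 2 * eta / L * (expR (L * t) - 1))
  (fun t => w2 * (cos (z t) ^+ 2 + q2 t * sin (z t) ^+ 2) + 2 * eta * expR (L * t)) K T w0 qK yp) => //.
- by move=> s _; have h := dz s; der; field; lra.
- move=> s sT.
  have s0 : 0 <= s by rewrite (itvP sT).
  have e1 : 0 <= expR (L * s) - 1 by rewrite subr_ge0 -expR0 ler_expR mulr_ge0// ltW.
  set e := 2 * eta / L * (expR (L * s) - 1).
  have e0 : 0 <= e by rewrite /e; apply: mulr_ge0 => //; apply: divr_ge0; [exact: mulr_ge0|exact: ltW].
  have := phase_rhs_lip w1 K (q1 s) (z s + e) (z s) (ltW w0) (qK s).
  rewrite (_ : z s + e - z s = e); last by ring.
  rewrite (ger0_norm e0) => h0.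
  have {h0} := le_trans h0 (ler_wpM2r e0 KL).
  rewrite (_ : L * e = 2 * eta * (expR (L * s) - 1)); last by rewrite /e; field; lra.
  move=> /(le_trans (ler_norm _)) h1.
  have h2 : `|(w1 - w2) * cos (z s) ^+ 2| <= eta * 1.
    rewrite normrM; apply: ler_pM => //.
    by rewrite normrX exprn_ile1// cos_max.
  have h3 : `|(w1 * q1 s - w2 * q2 s) * sin (z s) ^+ 2| <= eta * 1.
    rewrite normrM; apply: ler_pM => //; first exact: qq.
    by rewrite normrX exprn_ile1// sin_max.
  move: h2 h3; rewrite !ler_norml => /andP[_ h2] /andP[_ h3].
  move: h1 h2 h3; set X := w1 * _; lra.
- by rewrite z0 mulr0 expR0 subrr mulr0 addr0.
Qed.

Lemma phase_close (w1 w2 : R) (q1 q2 : R -> R) (y0 : R) y z K (L : R) T eta :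
  0 < w1 -> 0 < w2 -> 2 * w1 * (K + 1) <= L -> 2 * w2 * (K + 1) <= L ->
  (forall t, `|q1 t| <= K) -> (forall t, `|q2 t| <= K) -> 0 <= eta ->
  phase w1 q1 y0 y -> phase w2 q2 y0 z ->
  `|w1 - w2| <= eta -> (forall t, t \in `[0, T] -> `|w1 * q1 t - w2 * q2 t| <= eta) ->
  forall t, t \in `[0, T] -> `|y t - z t| <= 2 * eta / L * (expR (L * t) - 1).
Proof.
move=> w10 w20 KL1 KL2 q1K q2K eta0 yp zp ww qq t tT.
rewrite ler_distlC; apply/andP; split.
  rewrite lerBlDr; apply: (phase_close_le w1 w2 q1 q2 y0 y z K L T eta) => //.
apply: (phase_close_le w2 w1 q2 q1 y0 z y K L T eta) => //; first by rewrite distrC.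
by move=> s sT; rewrite distrC; exact: qq.
Qed.

(* The derivative at [t] of a coefficient perturbation is [w (tau2 - tau1) sin^2 y]:
   were the two phases to agree at [T], they would agree on [0, T] with [sin y = 0]
   throughout, whereas [y' = w > 0] wherever [sin y = 0]. *)
Lemma phase_strict w (a : R -> R) (tau1 tau2 : R) (y0 : R) y z K T : 0 < w -> 0 < T ->
  continuous a -> (forall t, `|a t + tau1| <= K) -> (forall t, `|a t + tau2| <= K) ->
  tau1 < tau2 ->
  phase w (fun t => a t + tau1) y0 y -> phase w (fun t => a t + tau2) y0 z ->
  y T < z T.
Proof.
move=> w0 T0 ca a1 a2 tau12 yp zp.
have TT : T \in `[0, T] by rewrite in_itv/= lexx ltW.
have yz t : t \in `[0, T] -> y t <= z t.
  apply: (phase_le _ _ _ _ z (fun t => w * (cos (z t) ^+ 2 + (a t + tau2) * sin (z t) ^+ 2)) K T w0 a1 yp).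
  - by move=> s _; exact: zp.2.
  - move=> s _; rewrite ler_wpM2l ?(ltW w0)// lerD2l ler_wpM2r ?sqr_ge0//.
    by rewrite lerD2l ltW.
  - by rewrite zp.1.
rewrite lt_neqAle yz// andbT; apply/eqP => yzT.
set L := 2 * w * (K + 1).
pose g (t : R) : R := expR (L * t) * (z t - y t).
pose P (t : R) : R := w * (cos (z t) ^+ 2 + (a t + tau2) * sin (z t) ^+ 2).
pose Q (t : R) : R := w * (cos (y t) ^+ 2 + (a t + tau1) * sin (y t) ^+ 2).
have dg (t : R) : is_derive t 1 g (expR (L * t) * (P t - Q t + L * (z t - y t))).
  have h1 := yp.2 t; have h2 := zp.2 t; rewrite /g; der.
  by rewrite -/(P t) -/(Q t); ring.
have g'0 (t : R) : t \in `[0, T] -> w * (tau2 - tau1) * sin (y t) ^+ 2 <= P t - Q t + L * (z t - y t).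
  move=> tT; have := phase_rhs_lip w K (a t + tau2) (z t) (y t) (ltW w0) (a2 t).
  rewrite -/L -/(P t) (ger0_norm (_ : 0 <= z t - y t)) ?subr_ge0 ?yz//.
  rewrite ler_norml => /andP[h _]; move: h; rewrite /Q; lra.
have tau0 : 0 <= w * (tau2 - tau1) by rewrite mulr_ge0 ?subr_ge0 ?ltW.
have g0 (t : R) : t \in `[0, T] -> g t = 0.
  move=> tT; apply/eqP; rewrite eq_le; apply/andP; split; last first.
    by rewrite mulr_ge0 ?expR_ge0 ?subr_ge0 ?yz.
  have gT : g T = 0 by rewrite /g yzT subrr mulr0.
  rewrite -gT; apply: (le_of_derive_ge0 g _ t T); first by rewrite (itvP tT).
  move=> s sT; have sT' : s \in `[0, T].
    by rewrite in_itv/= (le_trans (y := t)) ?(itvP tT) ?(itvP sT)//= (itvP sT).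
  by rewrite mulr_ge0 ?expR_ge0// (le_trans _ (g'0 _ sT'))// mulr_ge0 ?sqr_ge0.
have s0 (t : R) : t \in `]0, T[ -> sin (y t) = 0.
  move=> tT; have tT' := subset_itv_oo_cc tT.
  have gd0 : is_derive t 1 g 0.
    apply: near_eq_is_derive (drv_cst t (0 : R)).
    have : \forall s \near t, s \in `]0, T[ by apply: near_in_itvoo.
    by apply: filterS => s sT; rewrite g0//; exact: subset_itv_oo_cc.
  have E : expR (L * t) * (P t - Q t + L * (z t - y t)) = 0.
    by have := @derive_val _ _ _ _ _ _ _ gd0; have := @derive_val _ _ _ _ _ _ _ (dg t) => -> .
  have {}E : P t - Q t + L * (z t - y t) = 0.
    by move/eqP: E; rewrite mulf_eq0 gt_eqF ?expR_gt0//= => /eqP.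
  have := g'0 _ tT'; rewrite E pmulr_rle0; last by rewrite mulr_gt0// subr_gt0.
  by move=> h; apply/eqP; rewrite -sqrf_eq0 eq_le h sqr_ge0.
have T2 : T / 2 \in `]0, T[ by rewrite in_itv/=; lra.
have ds1 : is_derive (T / 2) 1 (fun t => sin (y t)) (cos (y (T / 2)) * Q (T / 2)).
  by have h := yp.2 (T / 2); der; rewrite /Q; ring.
have ds0 : is_derive (T / 2) 1 (fun t => sin (y t)) 0.
  apply: near_eq_is_derive (drv_cst (T / 2) (0 : R)).
  by apply: filterS (near_in_itvoo T2) => s sT; rewrite s0.
have : cos (y (T / 2)) * Q (T / 2) = 0.
  by have := @derive_val _ _ _ _ _ _ _ ds0; have := @derive_val _ _ _ _ _ _ _ ds1 => ->.
rewrite /Q (s0 _ T2) expr0n/= mulr0 addr0 => /eqP.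
have c0 : cos (y (T / 2)) != 0.
  by rewrite -sqrf_eq0 cos2sin2 (s0 _ T2) expr0n/= subr0 oner_eq0.
by rewrite !mulf_eq0 (gt_eqF w0) (negbTE c0).
Qed.

(** Undoes the Pruefer substitution: the amplitude satisfies [r' = w * (1 - q) * sin y * cos y * r],
    which the exponential of a primitive solves while staying positive. *)
Lemma phase_linear w q (y0 : R) y : continuous q -> phase w q y0 y ->
  exists r : R -> R, [/\ r 0 = 1, forall t, 0 < r t,
    forall t : R, is_derive t 1 (fun t => r t * sin (y t)) (w * (r t * cos (y t))) &
    forall t : R, is_derive t 1 (fun t => r t * cos (y t)) (- (w * q t * (r t * sin (y t))))].
Proof.
move=> cq yp; have cy := phase_continuous _ _ _ _ yp.
pose g (t : R) : R := w * (1 - q t) * (sin (y t) * cos (y t)).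
have cg : continuous g.
  by rewrite /g; conts.
have [G G0 dG] := primitive_exists g cg.
exists (fun t => expR (G t)); split => [|t|t|t].
- by rewrite G0 expR0.
- exact: expR_gt0.
- have h1 := dG t; have h2 := yp.2 t; der; rewrite /g.
  by have := sin2cos2 (y t); set c := cos _; set s := sin _ => e; ring: e.
- have h1 := dG t; have h2 := yp.2 t; der; rewrite /g.
  by have := sin2cos2 (y t); set c := cos _; set s := sin _ => e; ring: e.
Qed.

End phase.

Section root_continuity.
Context {R : realType}.
Implicit Types (s t x : R).

(* Continuity of the root [g s] of [F s], given only separate continuity in [s]. *)
Lemma root_continuous (F : R -> R -> R) (g : R -> R) (lo hi u : R) :
  (forall x, lo <= x <= hi -> {for u, continuous (F ^~ x)}) ->
  (forall s, lo < g s < hi) ->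
  (forall s x, lo <= x <= hi -> x < g s -> F s x < 0) ->
  (forall s x, lo <= x <= hi -> g s < x -> 0 < F s x) ->
  {for u, continuous g}.
Proof.
move=> cF glh Fneg Fpos; apply/cvgrPdist_le => e e0.
have /andP[lg gh] := glh u.
pose x1 : R := Num.max ((lo + g u) / 2) (g u - e).
pose x2 : R := Num.min ((hi + g u) / 2) (g u + e).
have x1g : x1 < g u by rewrite /x1 gt_max; apply/andP; split; lra.
have x2g : g u < x2 by rewrite /x2 lt_min; apply/andP; split; lra.
have x1lo : lo <= x1 by rewrite /x1 le_max; apply/orP; left; lra.
have x2hi : x2 <= hi by rewrite /x2 ge_min; apply/orP; left; lra.
have x1I : lo <= x1 <= hi by rewrite x1lo/= (le_trans (ltW x1g))// ltW.
have x2I : lo <= x2 <= hi by rewrite x2hi andbT (le_trans _ (ltW x2g))// ltW.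
have n1 : \forall s \near u, F s x1 < 0.
  exact: (cvgr_lt _ (cF _ x1I) _ (Fneg _ _ x1I x1g)).
have n2 : \forall s \near u, 0 < F s x2.
  exact: (cvgr_gt _ (cF _ x2I) _ (Fpos _ _ x2I x2g)).
near=> s.
have h1 : x1 <= g s.
  rewrite leNgt; apply/negP => /(Fpos _ _ x1I); apply/negP; rewrite -leNgt ltW//.
  by near: s.
have h2 : g s <= x2.
  rewrite leNgt; apply/negP => /(Fneg _ _ x2I); apply/negP; rewrite -leNgt ltW//.
  by near: s.
have e1 : g u - e <= x1 by rewrite /x1 le_max lexx orbT.
have e2 : x2 <= g u + e by rewrite /x2 ge_min lexx orbT.
by rewrite ler_distlC; apply/andP; split; lra.
Unshelve. all: by end_near. Qed.

End root_continuity.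

Section hyperbolic.
Context {R : realType}.
Implicit Types (t : R).

Definition coshR t : R := (expR t + expR (- t)) / 2.
Definition sinhR t : R := (expR t - expR (- t)) / 2.

Lemma coshR0 : coshR 0 = 1.
Proof. by rewrite /coshR oppr0 expR0; lra. Qed.

Lemma sinhR0 : sinhR 0 = 0.
Proof. by rewrite /sinhR oppr0 expR0; lra. Qed.

Lemma cosh2 t : coshR t ^+ 2 = 1 + sinhR t ^+ 2.
Proof.
by have := expRxMexpNx_1 t; rewrite /coshR /sinhR; set x := expR t; set y := expR _ => e; field: e.
Qed.

Lemma coshR_gt0 t : 0 < coshR t.
Proof. by rewrite divr_gt0// addr_gt0// expR_gt0. Qed.

Lemma sinhR_gt0 t : 0 < t -> 0 < sinhR t.
Proof. by move=> t0; rewrite divr_gt0// subr_gt0 ltr_expR; lra. Qed.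

Lemma is_derive_coshR t : is_derive t 1 coshR (sinhR t).
Proof. by rewrite /coshR /sinhR; der; ring. Qed.

Lemma is_derive_sinhR t : is_derive t 1 sinhR (coshR t).
Proof. by rewrite /coshR /sinhR; der; ring. Qed.

(** [1 + x <= expR x] bounds [expR t] by [(1 - t)^-1] and [expR (- t)] below by [1 - t], whence
    [sinhR t <= 9 / 8 * t], and [(9 / 8) ^+ 2 < 2]. *)
Lemma sinhR_sqr_le t : 0 <= t <= 1 / 9 -> sinhR t ^+ 2 <= 2 * t ^+ 2.
Proof.
move=> /andP[t0 t9].
have e1 : expR t <= (1 - t)^-1.
  rewrite -[t in expR t]opprK expRN lef_pV2 ?posrE ?expR_gt0 ?subr_gt0//; last lra.
  exact: expR_ge1Dx.
have e2 : 1 - t <= expR (- t) by exact: expR_ge1Dx.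
have e3 : expR (- t) <= expR t by rewrite ler_expR; lra.
have s0 : 0 <= sinhR t by rewrite divr_ge0// subr_ge0.
have s1 : sinhR t <= 9 / 8 * t.
  rewrite /sinhR; apply: (@le_trans _ _ (((1 - t)^-1 - (1 - t)) / 2)); first lra.
  rewrite ler_pdivrMr// lerBlDr invf_ple ?posrE; [|lra|nra].
  rewrite -[leLHS]mul1r ler_pdivrMr; nra.
have : sinhR t ^+ 2 <= (9 / 8 * t) ^+ 2 by rewrite lerXn2r// nnegrE; lra.
by have := sqr_ge0 t; lra.
Qed.

(* [cosh^2] truncated at 2, which keeps the radial equation globally Lipschitz;
   only arguments in [0, 1/9], where the truncation is void, matter. *)
Definition cosh2cap t : R := Num.min (coshR t ^+ 2) 2.

Lemma continuous_cosh2cap : continuous cosh2cap.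
Proof.
rewrite (_ : cosh2cap = fun t => (coshR t ^+ 2 + 2 - `|coshR t ^+ 2 - 2|) / 2).
  by rewrite /coshR; conts.
by apply/funext => t; rewrite /cosh2cap minr_absE.
Qed.

Lemma cosh2cap_ge1 t : 1 <= cosh2cap t.
Proof. by rewrite /cosh2cap le_min cosh2 lerDl sqr_ge0/=; lra. Qed.

Lemma cosh2cap_le2 t : cosh2cap t <= 2.
Proof. by rewrite /cosh2cap ge_min lexx orbT. Qed.

Lemma cosh2capE t : 0 <= t <= 1 / 9 -> cosh2cap t = coshR t ^+ 2.
Proof.
move=> t9; rewrite /cosh2cap min_l// cosh2.
have := sinhR_sqr_le _ t9; have : t ^+ 2 <= (1 / 9) ^+ 2.
  by case/andP: t9 => t0 t9; rewrite lerXn2r// nnegrE; lra.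
by lra.
Qed.

Lemma cosh2cap_le t : 0 <= t <= 1 / 9 -> cosh2cap t <= 1 + 2 * t ^+ 2.
Proof. by move=> t9; rewrite cosh2capE// cosh2 lerD2l sinhR_sqr_le. Qed.

End hyperbolic.

(** * Dependence of phases on frequency, separation constant and endpoint *)

Section phase_family.
Context {R : realType} (a : R -> R) (ca : continuous a) (a2 : forall t, `|a t| <= 2).
Implicit Types (w tau s t : R).

(** Common form of the two Mathieu equations: [a] is [- cos ^+ 2] in the angular one, and the
    truncated [cosh ^+ 2] in the radial one, with [- tau] for [tau]. *)
Definition fam w tau (y0 : R) : R -> R := phase_sol w (fun t => a t + tau) y0.

Lemma fam_bound tau t : `|a t + tau| <= 2 + `|tau|.
Proof. by rewrite (le_trans (ler_normD _ _))// lerD2r. Qed.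

Lemma fam_phase w tau (y0 : R) : 0 < w -> phase w (fun t => a t + tau) y0 (fam w tau y0).
Proof. by move=> w0; apply: (phase_solP _ _ _ (2 + `|tau|)) => // [|t]; [conts|exact: fam_bound]. Qed.

Lemma fam_derive w tau (y0 : R) t : 0 < w -> is_derive t 1 (fam w tau y0)
  (w * (cos (fam w tau y0 t) ^+ 2 + (a t + tau) * sin (fam w tau y0 t) ^+ 2)).
Proof. by move=> w0; exact: (fam_phase _ _ _ w0).2. Qed.

Lemma fam_strict w tau1 tau2 (y0 : R) (T : R) : 0 < w -> 0 < T -> tau1 < tau2 ->
  fam w tau1 y0 T < fam w tau2 y0 T.
Proof.
move=> w0 T0 tt; apply: (phase_strict w a tau1 tau2 y0 _ _ (2 + (`|tau1| + `|tau2|))) => //.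
- by move=> t; rewrite (le_trans (fam_bound _ _))// lerD2l lerDl.
- by move=> t; rewrite (le_trans (fam_bound _ _))// lerD2l lerDr.
- exact: fam_phase.
- exact: fam_phase.
Qed.

(** The variation splits into that of one fixed phase between two times and that of two phases at
    the same time; the latter is controlled on [[0, T]] by the changes of [w] and [w * tau]. *)
Lemma fam_continuous (W Th X : R -> R) (y0 T u : R) : 0 <= T -> (forall s, 0 < W s) ->
  {for u, continuous W} -> {for u, continuous Th} -> {for u, continuous X} ->
  (forall s, 0 <= X s <= T) ->
  {for u, continuous (fun s => fam (W s) (Th s) y0 (X s))}.
Proof.
move=> T0 W0 cW cTh cX XT; apply/cvgrPdist_lt => e e0.
(* [K] and [L] serve all parameters within distance [1] of [W u] and [Th u]; [eta] is then a
   perturbation that moves the phase by at most [e / 2]. *)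
pose K : R := 3 + `|Th u|.
have K0 : 0 < K by rewrite ltr_wpDr.
pose L := 2 * (W u + 1) * (K + 1).
have L0 : 0 < L by rewrite /L !mulr_gt0// addr_gt0.
pose E := 2 / L * (expR (L * T) - 1) + 1.
have E0 : 0 < E.
  rewrite ltr_wpDl// mulr_ge0 ?divr_ge0 ?subr_ge0 ?(ltW L0)//.
  by rewrite -expR0 ler_expR mulr_ge0// ltW.
pose eta : R := e / 2 / E.
have eta0 : 0 < eta by rewrite !divr_gt0.
have Xu := XT u.
have cy : {for X u, continuous (fam (W u) (Th u) y0)} by apply: drv_continuous (fam_derive _ _ _ _ (W0 u)).
have cyX : {for u, continuous (fun s => fam (W u) (Th u) y0 (X s))} by apply: continuous_comp.
have cWT : {for u, continuous (fun s => W s * Th s)} by cont.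
near=> s.
have h1 : `|fam (W u) (Th u) y0 (X u) - fam (W u) (Th u) y0 (X s)| < e / 2.
  by near: s; apply: (cvgr_dist_lt _ _ cyX); rewrite divr_gt0.
have w1 : `|W u - W s| <= eta / 4.
  by near: s; apply: (cvgr_dist_le _ _ cW); rewrite divr_gt0.
have w2 : `|W u * Th u - W s * Th s| <= eta / 4.
  by near: s; apply: (cvgr_dist_le _ _ cWT); rewrite divr_gt0.
have w3 : `|W u - W s| <= 1 by near: s; apply: (cvgr_dist_le _ _ cW).
have w4 : `|Th u - Th s| <= 1 by near: s; apply: (cvgr_dist_le _ _ cTh).
have w3' : W s <= W u + 1 by move: w3; rewrite ler_norml => /andP[]; lra.
have w4' : `|Th s| <= `|Th u| + 1.
  rewrite (_ : Th s = Th u - (Th u - Th s)); last by ring.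
  by rewrite (le_trans (ler_normB _ _))// lerD2l.
have XsT : X s \in `[0, T] by rewrite in_itv/= XT.
have h2 : `|fam (W u) (Th u) y0 (X s) - fam (W s) (Th s) y0 (X s)| <=
    2 * eta / L * (expR (L * X s) - 1).
  apply: (phase_close (W u) (W s) (fun t => a t + Th u) (fun t => a t + Th s) y0 _ _ K L T) => //.
  - by rewrite /L ler_wpM2r ?ler_wpM2l ?lerDl//; lra.
  - by rewrite /L ler_wpM2r ?ler_wpM2l//; lra.
  - by move=> t; rewrite (le_trans (fam_bound _ _))// /K; lra.
  - by move=> t; rewrite (le_trans (fam_bound _ _))// /K; lra.
  - exact: ltW.
  - exact: fam_phase.
  - exact: fam_phase.
  - by rewrite (le_trans w1)//; lra.
  - move=> t _; rewrite (_ : _ - _ = (W u - W s) * a t + (W u * Th u - W s * Th s)); last by ring.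
    rewrite (le_trans (ler_normD _ _))// normrM.
    have : `|W u - W s| * `|a t| <= eta / 4 * 2 by apply: ler_pM.
    by move: w2; lra.
have h3 : 2 * eta / L * (expR (L * X s) - 1) <= e / 2.
  have : 2 * eta / L * (expR (L * X s) - 1) <= eta * E.
    rewrite (_ : eta * E = eta * (2 / L * (expR (L * T) - 1)) + eta); last by rewrite /E; ring.
    apply: (@le_trans _ _ (eta * (2 / L * (expR (L * T) - 1)))); last by rewrite lerDl ltW.
    rewrite (_ : 2 * eta / L * _ = eta * (2 / L * (expR (L * X s) - 1))); last by ring.
    apply: ler_wpM2l; first exact: ltW.
    apply: ler_wpM2l; first by rewrite divr_ge0// ltW.
    rewrite lerD2r ler_expR; apply: ler_wpM2l; first exact: ltW.
    by rewrite (itvP XsT).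
  by rewrite /eta divfK// gt_eqF.
rewrite (_ : _ - _ = (fam (W u) (Th u) y0 (X u) - fam (W u) (Th u) y0 (X s)) +
   (fam (W u) (Th u) y0 (X s) - fam (W s) (Th s) y0 (X s))); last by ring.
rewrite (le_lt_trans (ler_normD _ _))//.
by move: (le_trans h2 h3) h1; lra.
Unshelve. all: by end_near. Qed.

End phase_family.

(** * Bounds on the Mathieu phases and crossing of the two radial zeros *)

Section crossing.
Context {R : realType}.
Implicit Types (w tau s t x : R).

Definition mcos2 t : R := - cos t ^+ 2.

Lemma continuous_mcos2 : continuous mcos2.
Proof. by rewrite /mcos2; conts. Qed.

Lemma cos2_le1 t : cos t ^+ 2 <= 1.
Proof. by have := sin2cos2 t; have := sqr_ge0 (sin t); lra. Qed.

Lemma mcos2_bound t : `|mcos2 t| <= 2.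
Proof. by rewrite /mcos2 normrN ger0_norm ?sqr_ge0// (le_trans (cos2_le1 t))// ler1n. Qed.

Lemma cosh2cap_bound t : `|cosh2cap t| <= 2.
Proof. by rewrite ger0_norm ?cosh2cap_le2// (le_trans _ (cosh2cap_ge1 t)). Qed.

(* Phases of the two Mathieu equations obtained from the Helmholtz equation in the
   elliptic coordinates [(c cosh x cos t, c sinh x sin t)], with separation constant
   [w^2 tau]: [Phi'' = - w^2 (tau - cos^2) Phi] and [Q'' = - w^2 (cosh^2 - tau) Q]. *)
Definition ang := @fam R mcos2.
Definition rad w tau (y0 : R) : R -> R := @fam R cosh2cap w (- tau) y0.

Let ang_bound tau t : `|mcos2 t + tau| <= 2 + `|tau|.
Proof. exact: fam_bound mcos2_bound _ _. Qed.
Let rad_bound tau t : `|cosh2cap t - tau| <= 2 + `|- tau|.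
Proof. exact: fam_bound cosh2cap_bound _ _. Qed.
Let ang_phase w tau (y0 : R) : 0 < w ->
  phase w (fun t => mcos2 t + tau) y0 (ang w tau y0).
Proof. exact: (fam_phase _ continuous_mcos2 mcos2_bound). Qed.
Let rad_phase w tau (y0 : R) : 0 < w ->
  phase w (fun t => cosh2cap t - tau) y0 (rad w tau y0).
Proof. exact: (fam_phase _ continuous_cosh2cap cosh2cap_bound). Qed.

Lemma half_pi_itv : (pi / 2 : R) \in `[0, pi / 2].
Proof. by rewrite in_itv/= lexx andbT divr_ge0// pi_ge0. Qed.

(** The coefficient [- cos ^+ 2] is nonpositive, so [y' <= 0] at [y = pi / 2] and the phase cannot
    rise through this value. This is the lower end of the bracket for separation constants. *)
Lemma ang_tau0 w (y0 : R) : 0 < w -> y0 <= pi / 2 -> ang w 0 y0 (pi / 2) <= pi / 2.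
Proof.
move=> w0 y0p; apply: (phase_le w _ y0 _ (fun=> pi / 2) (fun=> 0) _ (pi / 2) w0 (ang_bound 0) (ang_phase _ _ _ w0)) => //.
- move=> t _; rewrite cos_pihalf sin_pihalf /mcos2.
  rewrite expr0n/= expr1n mulr1 addr0 add0r pmulr_rle0// oppr_le0; exact: sqr_ge0.
- exact: half_pi_itv.
Qed.

(** The coefficient is at most [1], so the speed is at most [w]. For [w = 2 m] and [y0 = pi / 2] the
    bound is exactly the phase required of the [m]-th even mode, which forces its separation
    constant to be at least [1]. *)
Lemma ang_tau1 w (y0 : R) : 0 < w -> ang w 1 y0 (pi / 2) <= y0 + w * (pi / 2).
Proof.
move=> w0; apply: (phase_le w _ y0 _ (fun t => y0 + w * t) (fun=> w) _ (pi / 2) w0 (ang_bound 1) (ang_phase _ _ _ w0)).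
- by move=> t _; der; ring.
- move=> t _; rewrite ger_pMr// /mcos2.
  set z := y0 + _; rewrite (cos2sin2 z).
  have := sqr_ge0 (sin z); have := sqr_ge0 (cos t); have := cos2_le1 t; nra.
- by rewrite mulr0 addr0.
- exact: half_pi_itv.
Qed.

(** The coefficient is at least [1], so the speed is at least [w]: for [w >= 2 m] the [m]-th even
    mode has its separation constant at most [2]. *)
Lemma ang_tau2 w (y0 : R) : 0 < w -> y0 + w * (pi / 2) <= ang w 2 y0 (pi / 2).
Proof.
move=> w0; apply: (phase_ge w _ y0 _ (fun t => y0 + w * t) (fun=> w) _ (pi / 2) w0 (ang_bound 2) (ang_phase _ _ _ w0)).
- by move=> t _; der; ring.
- move=> t _; rewrite ler_pMr// /mcos2.
  set z := y0 + _; rewrite (cos2sin2 z).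
  have := sqr_ge0 (sin z); have := sqr_ge0 (cos t); have := cos2_le1 t; nra.
- by rewrite mulr0 addr0.
- exact: half_pi_itv.
Qed.

Lemma cos_near_half_pi t : `|cos t| <= `|t - pi / 2|.
Proof.
have := derive_lipschitz (@cos R) (fun t => - sin t) 1 _ _ t (pi / 2).
rewrite cos_pihalf subr0 mul1r; apply => // s.
by rewrite normrN sin_max.
Qed.

(** The phase cannot fall through [0], where [y' = w]. Over the last length [1 / 3] before [pi / 2],
    [cos t ^+ 2 <= 1 / 9]; since [1 / 4 - 1 / 9 >= 1 / 8], the speed there is at least [w / 8]. *)
Lemma ang_tau14 w (y0 : R) : 0 < w -> 0 <= y0 -> w / 24 <= ang w (1 / 4) y0 (pi / 2).
Proof.
move=> w0 y00; have pi2 := @pi_ge2 R.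
have h1 : 0 <= ang w (1 / 4) y0 (pi / 2 - 1 / 3).
  apply: (phase_ge w _ y0 _ (fun=> 0) (fun=> 0) _ (pi / 2) w0 (ang_bound (1 / 4)) (ang_phase _ _ _ w0)) => //.
  - by move=> t _; rewrite cos0 sin0 expr1n expr0n/= mulr0 addr0 mulr1 ltW.
  - by rewrite in_itv/=; apply/andP; split; lra.
pose g t : R := ang w (1 / 4) y0 t - w / 8 * t.
have := le_of_derive_ge0 g (fun t => w * (cos (ang w (1 / 4) y0 t) ^+ 2 + (mcos2 t + 1 / 4) * sin (ang w (1 / 4) y0 t) ^+ 2) - w / 8) (pi / 2 - 1 / 3) (pi / 2).
rewrite /g => H; suff : ang w (1 / 4) y0 (pi / 2 - 1 / 3) - w / 8 * (pi / 2 - 1 / 3) <=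
    ang w (1 / 4) y0 (pi / 2) - w / 8 * (pi / 2) by lra.
apply: H; first lra.
- by move=> t _; have h := (ang_phase _ (1 / 4) y0 w0).2 t; der; ring.
- move=> t tI; set z := ang _ _ _ _.
  have ct : cos t ^+ 2 <= 1 / 9.
    rewrite -(ger0_norm (sqr_ge0 _)) normrX (_ : 1 / 9 = (1 / 3) ^+ 2); last by field.
    have c3 : `|cos t| <= 1 / 3.
      rewrite (le_trans (cos_near_half_pi t))// ler_norml.
      by move: tI; rewrite in_itv/= => /andP[] ? ?; apply/andP; split; lra.
    by rewrite lerXn2r// nnegrE; lra.
  rewrite /mcos2 (_ : w / 8 = w * (1 / 8)); last by field.
  rewrite subr_ge0 ler_wpM2l ?(ltW w0)//.
  have : cos t ^+ 2 * sin z ^+ 2 <= 1 / 9 * sin z ^+ 2 by rewrite ler_wpM2r ?sqr_ge0.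
  by have := cos2Dsin2 z; have := sqr_ge0 (sin z); have := sqr_ge0 (cos z); lra.
Qed.

Lemma ang_strict w tau1 tau2 (y0 : R) : 0 < w -> tau1 < tau2 ->
  ang w tau1 y0 (pi / 2) < ang w tau2 y0 (pi / 2).
Proof.
move=> w0; apply: (fam_strict _ continuous_mcos2 mcos2_bound) => //.
by rewrite divr_gt0// pi_gt0.
Qed.

Lemma ang_continuous (W Th : R -> R) (y0 u : R) : (forall s, 0 < W s) ->
  {for u, continuous W} -> {for u, continuous Th} ->
  {for u, continuous (fun s => ang (W s) (Th s) y0 (pi / 2))}.
Proof.
move=> W0 cW cTh.
apply: (fam_continuous _ continuous_mcos2 mcos2_bound W Th (fun=> pi / 2) y0 (pi / 2)) => //.
- by rewrite divr_ge0// pi_ge0.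
- exact: cts_cst.
- by move=> s; rewrite lexx andbT divr_ge0// pi_ge0.
Qed.

Lemma rad_continuous (W Th X : R -> R) (y0 u : R) : (forall s, 0 < W s) ->
  {for u, continuous W} -> {for u, continuous Th} -> {for u, continuous X} ->
  (forall s, 0 <= X s <= 1) ->
  {for u, continuous (fun s => rad (W s) (Th s) y0 (X s))}.
Proof.
move=> W0 cW cTh cX X1.
by apply: (fam_continuous _ continuous_cosh2cap cosh2cap_bound W (fun s => - Th s) X y0 1) => //; cont.
Qed.

Lemma ang_root w (y0 v hi : R) : 0 < w -> 0 <= hi ->
  ang w 0 y0 (pi / 2) <= v -> v <= ang w hi y0 (pi / 2) ->
  exists2 tau, 0 <= tau <= hi & ang w tau y0 (pi / 2) = v.
Proof.
move=> w0 hi0 lv vh.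
have [|||c chi e] := @IVT R (fun tau => ang w tau y0 (pi / 2)) 0 hi v => //.
- apply: continuous_subspaceT => u.
  by apply: (ang_continuous (fun=> w) (fun t => t)) => //; cont.
- by rewrite ge_min le_max lv vh orbT.
- by exists c => //; move: chi; rewrite in_itv.
Qed.

Lemma rad_ge w tau (y0 : R) x z : 0 < w -> tau <= 1 / 4 -> x <= z ->
  3 / 4 * w * (z - x) <= rad w tau y0 z - rad w tau y0 x.
Proof.
move=> w0 tau4 xz.
pose g t : R := rad w tau y0 t - 3 / 4 * w * t.
have := le_of_derive_ge0 g (fun t => w * (cos (rad w tau y0 t) ^+ 2 + (cosh2cap t - tau) * sin (rad w tau y0 t) ^+ 2) - 3 / 4 * w) x z xz.
rewrite /g => H; suff : rad w tau y0 x - 3 / 4 * w * x <= rad w tau y0 z - 3 / 4 * w * z by lra.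
apply: H.
- by move=> t _; have h := (rad_phase _ tau y0 w0).2 t; der; ring.
- move=> t _; set v := rad _ _ _ _.
  rewrite subr_ge0 mulrC ler_wpM2l ?(ltW w0)//.
  rewrite (cos2sin2 v); have := cosh2cap_ge1 t.
  have := sqr_ge0 (sin v); have := sin2cos2 v; have := sqr_ge0 (cos v); nra.
Qed.

Lemma rad_le w tau (y0 : R) x : 0 < w -> 0 <= tau -> 0 <= x <= 1 / 9 ->
  rad w tau y0 x <= y0 + 3 / 2 * w * x.
Proof.
move=> w0 tau0 x9; apply: (phase_le w _ y0 _ (fun t => y0 + 3 / 2 * w * t) (fun=> 3 / 2 * w) _ (1 / 9) w0 (rad_bound tau) (rad_phase _ _ _ w0)).
- by move=> t _; der; ring.
- move=> t tI; rewrite [leRHS]mulrC ler_wpM2l ?(ltW w0)//.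
  set v := y0 + _; rewrite (cos2sin2 v).
  have t9 : 0 <= t <= 1 / 9 by move: tI; rewrite in_itv.
  have := cosh2cap_le _ t9; have : t ^+ 2 <= (1 / 9) ^+ 2.
    by case/andP: t9 => t0 t9; rewrite lerXn2r// nnegrE; lra.
  have := sqr_ge0 (sin v); have := sin2cos2 v; have := sqr_ge0 (cos v); nra.
- by rewrite mulr0 addr0.
- by rewrite in_itv.
Qed.

(* With [tau >= 1] the coefficient [cosh^2 - tau] is at most [sinh^2], so that the
   phase hardly leaves the equilibrium [pi / 2] of the equation [y' = w cos^2 y]. *)
Lemma rad_slow w tau x : 0 < w -> 1 <= tau -> 0 <= x <= 1 / 20 ->
  3 * w * x <= 16 -> rad w tau (pi / 2) x <= pi.
Proof.
move=> w0 tau1 /andP[x0 x20] wx; have pi2 := @pi_ge2 R.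
(* As [w * x <= 16 / 3], the barrier stays within [19 / 300] of [pi / 2]. Its slope [w / 100]
   suffices because [(19 / 300) ^+ 2 + 2 * (1 / 20) ^+ 2 < 1 / 100]. *)
apply: (@le_trans _ _ (pi / 2 + 1 / 100 * (1 + w * x))); last lra.
apply: (phase_le w _ (pi / 2) _ (fun t => pi / 2 + 1 / 100 * (1 + w * t)) (fun=> w / 100) _ x w0 (rad_bound tau) (rad_phase _ _ _ w0)).
- by move=> t _; der; ring.
- move=> t; rewrite in_itv/= => /andP[t0 tx]; rewrite ler_wpM2l ?(ltW w0)//.
  set d := 1 / 100 * _; rewrite (addrC (pi / 2)) cosDpihalf sinDpihalf sqrrN.
  have wt : w * t <= w * x by rewrite ler_wpM2l// ltW.
  have wt0 : 0 <= w * t by rewrite mulr_ge0// ltW.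
  have d0 : 0 <= d <= 19 / 300 by rewrite /d; apply/andP; split; lra.
  have sd : sin d ^+ 2 <= d ^+ 2.
    rewrite -(ger0_norm (sqr_ge0 (sin d))) normrX lerXn2r ?nnegrE//; first by case/andP: d0.
    have := cos_near_half_pi (d + pi / 2); rewrite cosDpihalf normrN addrK (ger0_norm (_ : 0 <= d))//.
    by case/andP: d0.
  have d2 : d ^+ 2 <= (19 / 300) ^+ 2.
    by case/andP: d0 => d0 d1; rewrite lerXn2r// nnegrE; lra.
  have t9 : 0 <= t <= 1 / 9 by apply/andP; split; lra.
  have := cosh2cap_le _ t9; have t2 : t ^+ 2 <= (1 / 20) ^+ 2 by rewrite lerXn2r// ?nnegrE; lra.
  have := sqr_ge0 (sin d); have := sin2cos2 d; have := sqr_ge0 (cos d); nra.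
- by rewrite mulr0 addr0; lra.
- by rewrite in_itv/= x0 lexx.
Qed.

(** The phase climbs from [0] to [pi] at a speed between [3 / 4 * w] and [3 / 2 * w]; the constant
    [16] comes from [pi < 4]. With [w >= 48] the zero lies below [1 / 9], where the truncation is
    void. *)
Lemma rad_root w tau : 48 <= w -> 0 <= tau <= 1 / 4 ->
  exists2 x, [/\ 0 < x, 3 * w * x <= 16 & 2 / 3 * pi <= w * x] & rad w tau 0 x = pi.
Proof.
move=> w48 /andP[tau0 tau4]; have w0 : 0 < w by lra.
have pi2 := @pi_ge2 R; have pi4 := @pihalf_lt2 R.
have r0 : rad w tau 0 0 = 0 by exact: (rad_phase _ _ _ w0).1.
have [|||x xI e] := @IVT R (rad w tau 0) 0 1 pi => //.
- by apply: continuous_subspaceT; exact: phase_continuous (rad_phase _ _ _ w0).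
- rewrite ge_min le_max r0 pi_ge0/=; apply/orP; right.
  by have := rad_ge w tau 0 0 1 w0 tau4 ler01; rewrite r0; lra.
have x0 : 0 < x.
  rewrite lt_neqAle; apply/andP; split; last by rewrite (itvP xI).
  by apply/eqP => x0; move: e; rewrite -x0 r0; lra.
have wx : 3 * w * x <= 16.
  by have := rad_ge w tau 0 0 x w0 tau4 (ltW x0); rewrite r0 e; lra.
exists x => //; split => //.
have x9 : 0 <= x <= 1 / 9.
  rewrite (ltW x0)/=; have : 48 * x <= w * x by rewrite ler_wpM2r// ltW.
  by lra.
by have := rad_le w tau 0 x w0 tau0 x9; rewrite e; lra.
Qed.

(* The parameter [s] describes the frequency [w = W s]; [th s] and [nu s] are the
   separation constants of the [m]-th even and of the lowest odd angular mode, and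
   [xi s] is the first zero of the odd radial mode. At [s = 0] one has [th >= 1] and
   the even radial phase at [xi] is still below [pi]; for large [s] the even mode
   behaves like the odd one but starts with a phase advance of [pi / 2]. *)
Lemma phase_crossing (m : nat) : (60 <= m)%N ->
  exists w taue tauo x,
    [/\ 2 * m%:R <= w, 0 < x /\ 3 * w * x <= 16,
        ang w taue (pi / 2) (pi / 2) = pi / 2 + m%:R * pi /\
          ang w tauo 0 (pi / 2) = pi / 2 &
        rad w taue (pi / 2) x = pi /\ rad w tauo 0 x = pi].
Proof.
move=> m60; have m60' : (60 : R) <= m%:R by rewrite ler_nat.
have pi2 := @pi_ge2 R; have pi4 := @pihalf_lt2 R; have pi0 := @pi_ge0 R.
(* The square gives [W s >= 2 m] for every real [s], so that the roots exist and are continuous on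
   the whole line. *)
pose W s : R := 2 * m%:R + s ^+ 2.
have Wm s : 2 * m%:R <= W s by rewrite /W lerDl sqr_ge0.
have W120 s : 120 <= W s by have := Wm s; lra.
have W0 s : 0 < W s by have := W120 s; lra.
have cW : continuous W by rewrite /W; conts.
pose v : R := pi / 2 + m%:R * pi.
have /choice[nu nuP] s : exists tau, 0 <= tau <= 1 / 4 /\ ang (W s) tau 0 (pi / 2) = pi / 2.
  have [|||tau tI e] := ang_root (W s) 0 (pi / 2) (1 / 4) (W0 s).
  - lra.
  - by apply: ang_tau0 => //; lra.
  - by have := ang_tau14 (W s) 0 (W0 s) (lexx _); have := W120 s; lra.
  - by exists tau.
have /choice[th thP] s : exists tau, 0 <= tau <= 2 /\ ang (W s) tau (pi / 2) (pi / 2) = v.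
  have [|||tau tI e] := ang_root (W s) (pi / 2) v 2 (W0 s).
  - lra.
  - rewrite (le_trans (ang_tau0 _ _ (W0 s) (lexx _)))// /v lerDl mulr_ge0//; lra.
  - have := ang_tau2 (W s) (pi / 2) (W0 s).
    have : 2 * m%:R * (pi / 2) <= W s * (pi / 2) by rewrite ler_wpM2r//; lra.
    rewrite /v; lra.
  - by exists tau.
have cnu : continuous nu.
  (* The window is wider than [[0, 1 / 4]] because the root must lie strictly inside it. *)
  move=> u; apply: (root_continuous (fun s x => ang (W s) x 0 (pi / 2) - pi / 2) nu (-1) 1).
  - move=> x _; apply: cts_add; last exact: cts_cst.
    by apply: ang_continuous => //; [exact: cW|exact: cts_cst].
  - by move=> s; have [/andP[h1 h2] _] := nuP s; apply/andP; split; lra.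
  - by move=> s x _ xs; rewrite subr_lt0 -[in ltRHS](nuP s).2 ang_strict.
  - by move=> s x _ xs; rewrite subr_gt0 -[in ltLHS](nuP s).2 ang_strict.
have cth : continuous th.
  move=> u; apply: (root_continuous (fun s x => ang (W s) x (pi / 2) (pi / 2) - v) th (-1) 3).
  - move=> x _; apply: cts_add; last exact: cts_cst.
    by apply: ang_continuous => //; [exact: cW|exact: cts_cst].
  - by move=> s; have [/andP[h1 h2] _] := thP s; apply/andP; split; lra.
  - by move=> s x _ xs; rewrite subr_lt0 -(thP s).2 ang_strict.
  - by move=> s x _ xs; rewrite subr_gt0 -(thP s).2 ang_strict.
have /choice[xi xiP] s : exists x, [/\ 0 < x, 3 * W s * x <= 16 & 2 / 3 * pi <= W s * x]
    /\ rad (W s) (nu s) 0 x = pi.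
  have [|x h e] := rad_root (W s) (nu s) _ (nuP s).1; first by have := W120 s; lra.
  by exists x.
(* From [120 * xi s <= 16 / 3]; this puts the zero in the range of [rad_slow]. *)
have xi20 s : 0 < xi s <= 1 / 20.
  have [[h1 h2 _] _] := xiP s; rewrite h1/=.
  have : 120 * xi s <= W s * xi s by rewrite ler_wpM2r// ltW.
  by lra.
have xi1 s : 0 <= xi s <= 1 by have /andP[h1 h2] := xi20 s; apply/andP; split; lra.
have cxi : continuous xi.
  move=> u; apply: (root_continuous (fun s x => rad (W s) (nu s) 0 x - pi) xi 0 1).
  - move=> x x1; apply: cts_add; last exact: cts_cst.
    by apply: (rad_continuous W nu (fun=> x)) => //; [exact: cW|exact: cnu|exact: cts_cst].
  - by move=> s; have /andP[h1 h2] := xi20 s; apply/andP; split; lra.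
  - move=> s x _ xs; have [/andP[_ n4] _] := nuP s.
    have := rad_ge (W s) (nu s) 0 _ _ (W0 s) n4 (ltW xs); rewrite (xiP s).2.
    have : 0 < W s * (xi s - x) by rewrite mulr_gt0// subr_gt0.
    lra.
  - move=> s x _ xs; have [/andP[_ n4] _] := nuP s.
    have := rad_ge (W s) (nu s) 0 _ _ (W0 s) n4 (ltW xs); rewrite (xiP s).2.
    have : 0 < W s * (x - xi s) by rewrite mulr_gt0// subr_gt0.
    lra.
pose D s : R := rad (W s) (th s) (pi / 2) (xi s).
have cD : continuous D.
  by move=> u; apply: rad_continuous => //; [exact: cW|exact: cth|exact: cxi].
have D0 : D 0 <= pi.
  have W00 : W 0 = 2 * m%:R by rewrite /W expr0n addr0.
  have [[h1 h2 _] _] := xiP 0; have /andP[_ h3] := xi20 0.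
  apply: rad_slow => //; last by rewrite (ltW h1).
  rewrite leNgt; apply/negP => th1.
  have := ang_strict (W 0) _ _ (pi / 2) (W0 0) th1; rewrite (thP 0).2.
  have := ang_tau1 (W 0) (pi / 2) (W0 0); rewrite W00 /v; lra.
(* Large enough for [W s1 / 24], a lower bound of the angular phase at [tau = 1 / 4], to exceed the
   target [v < 4 * (m + 1)]; hence [th s1 <= 1 / 4]. *)
pose s1 : R := 100 * (m%:R + 1).
have s10 : 0 <= s1 by rewrite /s1; lra.
have D1 : pi <= D s1.
  have Wbig : 100 * (m%:R + 1) <= W s1.
    rewrite /W; have : s1 <= s1 ^+ 2 by rewrite expr2 ler_peMl// /s1; lra.
    by rewrite /s1; lra.
  have th14 : th s1 <= 1 / 4.
    rewrite leNgt; apply/negP => th1.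
    have := ang_strict (W s1) _ _ (pi / 2) (W0 s1) th1; rewrite (thP s1).2.
    have := ang_tau14 (W s1) (pi / 2) (W0 s1) _.
    have : (0 : R) <= m%:R * (4 - pi) by apply: mulr_ge0; lra.
    rewrite /v => h1 /(_ _) h2 h3; have {}h2 : W s1 / 24 <= ang (W s1) (1 / 4) (pi / 2) (pi / 2) by apply: h2; lra.
    by move: h1 h2 h3 Wbig; lra.
  (* Starting from [pi / 2], the even radial phase gains at least [3 / 4 * W s1 * xi s1 >= 3 / 4 *
     (2 / 3 * pi) = pi / 2]. *)
  have [[h1 h2 h3] _] := xiP s1.
  have := rad_ge (W s1) (th s1) (pi / 2) 0 (xi s1) (W0 s1) th14 (ltW h1).
  have -> : rad (W s1) (th s1) (pi / 2) 0 = pi / 2 by exact: (rad_phase _ _ _ (W0 s1)).1.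
  by rewrite -/(D s1); lra.
have [|||s _ e] := @IVT R D 0 s1 pi => //.
- exact: continuous_subspaceT.
- by rewrite ge_min le_max D0 D1 orbT.
exists (W s), (th s), (nu s), (xi s).
by have [[h1 h2 _] h4] := xiP s; have [_ h5] := nuP s; have [_ h6] := thP s.
Qed.

End crossing.

(** * Superpositions of standing waves *)

Section partial_derivatives.
Context {R : realType}.
Implicit Types (f : R * R -> R) (x y l : R).

Lemma is_derive_dx f x y l :
  is_derive x 1 (fun s => f (s, y)) l <-> is_derive (x, y) ((1, 0) : R * R) f l.
Proof.
have E : (fun h : R => h^-1 *: (f (h *: ((1, 0) : R * R) + (x, y)) - f (x, y))) =
         (fun h : R => h^-1 *: (f (h *: (1 : R) + x, y) - f (x, y))).
  apply/funext => h; congr (_ *: (f _ - _)).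
  by rewrite -[LHS]/(h *: (1 : R) + x, h *: (0 : R) + y) scaler0 add0r.
by split => -[h1 h2]; apply: DeriveDef; move: h1 h2; rewrite /derivable /derive E.
Qed.

Lemma is_derive_dy f x y l :
  is_derive y 1 (fun s => f (x, s)) l <-> is_derive (x, y) ((0, 1) : R * R) f l.
Proof.
have E : (fun h : R => h^-1 *: (f (h *: ((0, 1) : R * R) + (x, y)) - f (x, y))) =
         (fun h : R => h^-1 *: (f (x, h *: (1 : R) + y) - f (x, y))).
  apply/funext => h; congr (_ *: (f _ - _)).
  by rewrite -[LHS]/(h *: (0 : R) + x, h *: (1 : R) + y) scaler0 add0r.
by split => -[h1 h2]; apply: DeriveDef; move: h1 h2; rewrite /derivable /derive E.
Qed.

Lemma lipschitz2_continuous f (C : R) :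
  (forall p q, `|f p - f q| <= C * (`|p.1 - q.1| + `|p.2 - q.2|)) -> continuous f.
Proof.
move=> fC q; apply/cvgrPdist_lt => e e0.
pose h (p : R * R) : R := C * (`|q.1 - p.1| + `|q.2 - p.2|).
have ch : continuous_at q h by rewrite /h; cont.
have h0 : h q < e by rewrite /h !subrr normr0 addr0 mulr0.
near=> p; apply: le_lt_trans (fC _ _) _; rewrite -/(h p).
by near: p; exact: (cvgr_lt _ ch _ h0).
Unshelve. all: by end_near. Qed.

End partial_derivatives.

(** * Integrals over a segment, and their derivatives in a parameter *)

Section segment_integral.
Context {R : realType}.
Local Notation mu := (@lebesgue_measure R).
Implicit Types (g f G : R -> R) (a b t x z : R).

Lemma Rint_FTC G g a b : a < b -> (forall t, is_derive t 1 G (g t)) -> continuous g ->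
  \int[mu]_(t in `[a, b]) g t = G b - G a.
Proof.
move=> ab dG cg; rewrite /Rintegral (@continuous_FTC2 R g G a b)//.
- exact: continuous_subspaceT.
- split.
  + by move=> t _; have [] := dG t.
  + by apply: cvg_at_right_filter; exact: drv_continuous (dG a).
  + by apply: cvg_at_left_filter; exact: drv_continuous (dG b).
- by move=> t _; rewrite derive1E; have [_ ->] := dG t.
Qed.

Lemma Rint_bound f a b (B : R) : a < b -> continuous f ->
  (forall t, t \in `[a, b] -> `|f t| <= B) -> `|\int[mu]_(t in `[a, b]) f t| <= B * (b - a).
Proof.
move=> ab cf fB; have [F _ dF] := primitive_exists f cf.
rewrite (Rint_FTC F)//.
have [|c cab ->] := MVT ab (fun t _ => dF t).
  by apply: drv_within_continuous => t _; exact: dF.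
rewrite normrM (ger0_norm (_ : 0 <= b - a)) ?subr_ge0 ?(ltW ab)//.
by rewrite ler_wpM2r ?subr_ge0 ?(ltW ab)// fB//; exact: subset_itv_oo_cc.
Qed.

Lemma rectangle_bound (F : R * R -> R) a b c d : a <= b -> c <= d -> continuous F ->
  exists B : R, forall x t, x \in `[a, b] -> t \in `[c, d] -> `|F (x, t)| <= B.
Proof.
move=> ab cd cF.
have [|||p _ pmax] := @compact_EVT_max _ R (fun p => `|F p|) (`[a, b] `*` `[c, d]).
- by exists (a, c); split; rewrite /= in_itv/= lexx.
- by apply: compact_setX; exact: segment_compact.
- by apply: continuous_subspaceT; conts.
- exists `|F p| => x t xab tcd.
  by apply: (pmax (x, t)); rewrite inE; split.
Qed.

Lemma segment_bound f a b : a <= b -> continuous f ->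
  exists2 B : R, 0 <= B & forall t, t \in `[a, b] -> `|f t| <= B.
Proof.
move=> ab cf; have cabs : continuous (fun t => `|f t|) by conts.
have [c _ cmax] := EVT_max ab (continuous_subspaceT cabs).
by exists `|f c|.
Qed.

Lemma derive_under_integral (K K' : R -> R -> R) a b : a <= b ->
  (forall x, continuous (K x)) ->
  (forall x t, is_derive x 1 (K ^~ t) (K' x t)) ->
  continuous (fun p : R * R => K' p.1 p.2) ->
  forall x, is_derive x 1 (fun x => \int[mu]_(t in `[a, b]) K x t) (\int[mu]_(t in `[a, b]) K' x t).
Proof.
move=> ab cK dK cK' x.
have [B KB] := rectangle_bound (fun p => K' p.1 p.2) (x - 1) (x + 1) a b (ltac:(lra)) ab cK'.
have dE z t : partial1of2 K z t = K' z t.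
  by rewrite partial1of2E; have [_ ->] := dK z t.
have xI : `]x - 1, x + 1[%classic x by rewrite /= in_itv/=; apply/andP; split; lra.
have B0 : 0 <= B.
  apply: le_trans (KB x a _ _) => //; rewrite ?in_itv/= ?lexx//.
  by apply/andP; split; lra.
have mI : measurable (`[a, b]%classic : set (measurableTypeR R)) by exact: measurable_itv.
have iK z : `]x - 1, x + 1[%classic z -> mu.-integrable `[a, b] (EFin \o K z).
  by move=> _; exact: continuous_integrable.
have dK1 z t : `]x - 1, x + 1[%classic z -> `[a, b]%classic t -> derivable (K ^~ t) z 1.
  by move=> _ _; have [] := dK z t.
have iB : mu.-integrable `[a, b] (EFin \o (fun=> B)).
  by apply: continuous_integrable; conts.
have KB' z t : `]x - 1, x + 1[%classic z -> `[a, b]%classic t -> `|partial1of2 K z t| <= B.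
  move=> zI tI; rewrite dE; apply: (KB z t) => //.
  by apply: subset_itv_oo_cc.
apply: DeriveDef.
  exact: (derivable_under_integral mI xI iK dK1 (fun=> B0) iB KB').
rewrite -derive1E (differentiation_under_integral mI xI iK dK1 (fun=> B0) iB KB').
by apply: eq_Rintegral => t _; exact: dE.
Qed.

End segment_integral.

Section wave.
Context {R : realType}.
Local Notation mu := (@lebesgue_measure R).
Variables (alpha beta : R -> R).
Hypotheses (calpha : continuous alpha) (cbeta : continuous beta).
Implicit Types (g : R -> R) (phi psi x y t : R).

(* The standing waves of frequency vector [(alpha t, beta t)], superposed with
   density [g]; the phases [phi] and [psi] make the family stable under [dx], [dy]. *)
Definition wave g phi psi (p : R * R) : R :=
  \int[mu]_(t in `[0, pi / 2]) (g t * (cos (p.1 * alpha t + phi) * cos (p.2 * beta t + psi))).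

Let pi20 : 0 < pi / 2 :> R. Proof. by rewrite divr_gt0// pi_gt0. Qed.

Lemma is_derive_wavex g phi psi x y : continuous g ->
  is_derive x 1 (fun s => wave g phi psi (s, y))
    (wave (fun t => g t * alpha t) (phi + pi / 2) psi (x, y)).
Proof.
move=> cg; rewrite /wave /=.
apply: (derive_under_integral (fun x t => g t * (cos (x * alpha t + phi) * cos (y * beta t + psi)))
  (fun x t => g t * alpha t * (cos (x * alpha t + (phi + pi / 2)) * cos (y * beta t + psi)))).
- exact: ltW.
- by move=> z; conts.
- by move=> z t; der; rewrite addrA cosDpihalf; ring.
- by conts.
Qed.

Lemma is_derive_wavey g phi psi x y : continuous g ->
  is_derive y 1 (fun s => wave g phi psi (x, s))
    (wave (fun t => g t * beta t) phi (psi + pi / 2) (x, y)).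
Proof.
move=> cg; rewrite /wave /=.
apply: (derive_under_integral (fun y t => g t * (cos (x * alpha t + phi) * cos (y * beta t + psi)))
  (fun y t => g t * beta t * (cos (x * alpha t + phi) * cos (y * beta t + (psi + pi / 2))))).
- exact: ltW.
- by move=> z; conts.
- by move=> z t; der; rewrite addrA cosDpihalf; ring.
- by conts.
Qed.

Lemma wave_dx g phi psi : continuous g ->
  dx (wave g phi psi) = wave (fun t => g t * alpha t) (phi + pi / 2) psi.
Proof.
move=> cg; apply/funext => -[x y]; rewrite /dx.
by have /is_derive_dx[_ ->] := is_derive_wavex g phi psi x y cg.
Qed.

Lemma wave_dy g phi psi : continuous g ->
  dy (wave g phi psi) = wave (fun t => g t * beta t) phi (psi + pi / 2).
Proof.
move=> cg; apply/funext => -[x y]; rewrite /dy.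
by have /is_derive_dy[_ ->] := is_derive_wavey g phi psi x y cg.
Qed.

Lemma wave_bound g phi psi : continuous g ->
  exists2 B, 0 <= B & forall p, `|wave g phi psi p| <= B.
Proof.
move=> cg; have [B B0 gB] := segment_bound g 0 (pi / 2) (ltW pi20) cg.
exists (B * (pi / 2 - 0)); first by rewrite mulr_ge0// subr0 ltW.
move=> p; apply: Rint_bound => //; first by conts.
move=> t tI; rewrite normrM -[B]mulr1; apply: ler_pM => //; first exact: gB.
by rewrite normrM -[1]mulr1; apply: ler_pM => //; exact: cos_max.
Qed.

Lemma wave_lipschitz g phi psi : continuous g ->
  exists C, forall p q, `|wave g phi psi p - wave g phi psi q| <= C * (`|p.1 - q.1| + `|p.2 - q.2|).
Proof.
move=> cg.
have [|B1 B10 b1] := wave_bound (fun t => g t * alpha t) (phi + pi / 2) psi _; first by conts.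
have [|B2 B20 b2] := wave_bound (fun t => g t * beta t) phi (psi + pi / 2) _; first by conts.
exists (B1 + B2) => -[x y] [x' y'] /=.
have h1 : `|wave g phi psi (x, y) - wave g phi psi (x', y)| <= B1 * `|x - x'|.
  by apply: (derive_lipschitz (fun s => wave g phi psi (s, y))) => [t|t]; [exact: is_derive_wavex|exact: b1].
have h2 : `|wave g phi psi (x', y) - wave g phi psi (x', y')| <= B2 * `|y - y'|.
  by apply: (derive_lipschitz (fun s => wave g phi psi (x', s))) => [t|t]; [exact: is_derive_wavey|exact: b2].
rewrite (_ : _ - _ = (wave g phi psi (x, y) - wave g phi psi (x', y)) +
   (wave g phi psi (x', y) - wave g phi psi (x', y'))); last by ring.
rewrite (le_trans (ler_normD _ _))//.
have := mulr_ge0 B10 (normr_ge0 (y - y')); have := mulr_ge0 B20 (normr_ge0 (x - x')).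
by move: h1 h2; lra.
Qed.

Lemma wave_continuous g phi psi : continuous g -> continuous (wave g phi psi).
Proof. by move=> cg; have [C /lipschitz2_continuous] := wave_lipschitz g phi psi cg. Qed.

Lemma wave_smooth g phi psi : continuous g -> smooth (wave g phi psi).
Proof.
move=> cg k; elim: k g phi psi cg => [|k IH] g phi psi cg; first exact: wave_continuous.
split.
- exact: wave_continuous.
- by move=> [x y]; have /is_derive_dx[] := is_derive_wavex g phi psi x y cg.
- by move=> [x y]; have /is_derive_dy[] := is_derive_wavey g phi psi x y cg.
- by rewrite wave_dx//; apply: IH; conts.
- by rewrite wave_dy//; apply: IH; conts.
Qed.

Lemma wave_ext g g' phi psi p : g =1 g' -> wave g phi psi p = wave g' phi psi p.
Proof. by move=> /funext ->. Qed.

Lemma wave_helmholtz g phi psi (k : R) : continuous g ->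
  (forall t, alpha t ^+ 2 + beta t ^+ 2 = k ^+ 2) ->
  forall p, dx (dx (wave g phi psi)) p + dy (dy (wave g phi psi)) p = - k ^+ 2 * wave g phi psi p.
Proof.
move=> cg abk p; rewrite wave_dx// wave_dx; last by conts.
rewrite wave_dy// wave_dy; last by conts.
rewrite /wave -RintegralD//; last 2 first.
- by apply: continuous_integrable; conts.
- by apply: continuous_integrable; conts.
rewrite -RintegralZl//; last by apply: continuous_integrable; conts.
apply: eq_Rintegral => t _ /=.
rewrite !addrA !cosDpihalf !sinDpihalf -(abk t); ring.
Qed.

End wave.

(** * Vanishing of a superposition on the ellipse *)

Section separation.
Context {R : realType}.
Local Notation mu := (@lebesgue_measure R).
Implicit Types (t x : R).
(** The angular Mathieu equation as a first-order system. The conditions at [0] treat both parities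
    at once: [psi = 0] asks for [Psi 0 = 0], and [psi = - pi / 2] for [Phi 0 = 0]. *)
Variables (Phi Psi : R -> R) (w tau psi eta : R).
Hypotheses (dPhi : forall t, is_derive t 1 Phi (w * Psi t))
  (dPsi : forall t, is_derive t 1 Psi (- (w * (tau - cos t ^+ 2) * Phi t)))
  (Phi0 : Phi 0 * sin psi = 0) (Psi0 : Psi 0 * cos psi = 0) (Psi1 : Psi (pi / 2) = 0).

(** At the point with elliptic coordinates [(x, eta)], [X] and [Y] are, up to the shift [psi], the
    arguments of the two cosines of the wave in direction [t]. Primes, and the indices of [E1] and
    [E2], denote derivatives in [x]. *)
Let X x t := w * coshR x * cos eta * cos t.
Let X' x t := w * sinhR x * cos eta * cos t.
Let Y x t := w * sinhR x * sin eta * sin t.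
Let Y' x t := w * coshR x * sin eta * sin t.
Let E x t := cos (X x t) * cos (Y x t + psi).
Let E1 x t := - (sin (X x t) * X' x t * cos (Y x t + psi)) - cos (X x t) * sin (Y x t + psi) * Y' x t.
Let E2 x t := - (cos (X x t) * X' x t ^+ 2 * cos (Y x t + psi)) - sin (X x t) * X x t * cos (Y x t + psi)
  + 2 * (sin (X x t) * X' x t * sin (Y x t + psi) * Y' x t)
  - cos (X x t) * cos (Y x t + psi) * Y' x t ^+ 2 - cos (X x t) * sin (Y x t + psi) * Y x t.

Let cPhi : continuous Phi. Proof. by move=> t; exact: drv_continuous (dPhi t). Qed.
Let cPsi : continuous Psi. Proof. by move=> t; exact: drv_continuous (dPsi t). Qed.
Let cch : continuous (@coshR R). Proof. by move=> t; exact: drv_continuous (is_derive_coshR t). Qed.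
Let csh : continuous (@sinhR R). Proof. by move=> t; exact: drv_continuous (is_derive_sinhR t). Qed.
Let dE x t : is_derive x 1 (E ^~ t) (E1 x t).
Proof.
have h1 := is_derive_coshR x; have h2 := is_derive_sinhR x.
by rewrite /E /E1 /X /Y /X' /Y'; der; ring.
Qed.
Let dE1 x t : is_derive x 1 (E1 ^~ t) (E2 x t).
Proof.
have h1 := is_derive_coshR x; have h2 := is_derive_sinhR x.
by rewrite /E1 /E2 /X /Y /X' /Y'; der; ring.
Qed.
Let U x := \int[mu]_(t in `[0, pi / 2]) (Phi t * E x t).
Let U1 x := \int[mu]_(t in `[0, pi / 2]) (Phi t * E1 x t).
Let U2 x := \int[mu]_(t in `[0, pi / 2]) (Phi t * E2 x t).

Let pi20 : 0 < pi / 2 :> R. Proof. by rewrite divr_gt0// pi_gt0. Qed.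
Let dU x : is_derive x 1 U (U1 x).
Proof.
apply: (derive_under_integral (fun x t => Phi t * E x t) (fun x t => Phi t * E1 x t)).
- exact: ltW.
- by move=> z; rewrite /E /X /Y; conts.
- by move=> z t; have h := dE z t; der; ring.
- by rewrite /E1 /X /Y /X' /Y'; conts.
Qed.
Let dU1 x : is_derive x 1 U1 (U2 x).
Proof.
apply: (derive_under_integral (fun x t => Phi t * E1 x t) (fun x t => Phi t * E2 x t)).
- exact: ltW.
- by move=> z; rewrite /E1 /X /Y /X' /Y'; conts.
- by move=> z t; have h := dE1 z t; der; ring.
- by rewrite /E2 /X /Y /X' /Y'; conts.
Qed.

(* The kernel satisfies [E_xx + E_tt = - w^2 (cosh^2 x - cos^2 t) E], so that
   [Phi (E_xx + w^2 (cosh^2 x - tau) E)] is minus the [t]-derivative of the bilinear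
   concomitant [G = Phi E_t - Phi' E], which vanishes at both ends. *)
Let radial x : U2 x = - (w ^+ 2 * (coshR x ^+ 2 - tau) * U x).
Proof.
pose Et t := sin (X x t) * (w * coshR x * cos eta * sin t) * cos (Y x t + psi)
  - cos (X x t) * sin (Y x t + psi) * (w * sinhR x * sin eta * cos t).
pose G t := Phi t * Et t - w * Psi t * E x t.
pose g t := - (Phi t * E2 x t + w ^+ 2 * (coshR x ^+ 2 - tau) * (Phi t * E x t)).
have dG t : is_derive t 1 G (g t).
  have h1 := dPhi t; have h2 := dPsi t.
  rewrite /G /g /Et /E /E2 /X /Y /X' /Y'; der.
  by ring: (sin2cos2 t) (sin2cos2 eta) (cosh2 x).
have cg : continuous g by rewrite /g /E /E2 /X /Y /X' /Y'; conts.
have G0 : G 0 = 0.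
  rewrite /G /Et /E /X /Y sin0 cos0 !mulr0 add0r.
  have -> : Phi 0 * (0 * cos psi - cos (w * coshR x * cos eta * 1) * sin psi * (w * sinhR x * sin eta * 1)) =
     - (cos (w * coshR x * cos eta * 1) * (w * sinhR x * sin eta) * (Phi 0 * sin psi)) by ring.
  have -> : w * Psi 0 * (cos (w * coshR x * cos eta * 1) * cos psi) =
     w * cos (w * coshR x * cos eta * 1) * (Psi 0 * cos psi) by ring.
  by rewrite Phi0 Psi0 !mulr0 !oppr0 addr0.
have G1 : G (pi / 2) = 0.
  by rewrite /G /Et /E /X /Y Psi1 cos_pihalf sin_pihalf !mulr0 sin0 !mul0r subrr mulr0 subrr.
have := Rint_FTC G g 0 (pi / 2) pi20 dG cg.
rewrite G0 G1 subrr /g.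
have -> : (fun t => - (Phi t * E2 x t + w ^+ 2 * (coshR x ^+ 2 - tau) * (Phi t * E x t))) =
  (fun t => (-1) * (Phi t * E2 x t + w ^+ 2 * (coshR x ^+ 2 - tau) * (Phi t * E x t))).
  by apply/funext => t; rewrite mulN1r.
rewrite RintegralZl//; last first.
  by apply: continuous_integrable; rewrite /E /E2 /X /Y /X' /Y'; conts.
rewrite RintegralD//; last 2 first.
- by apply: continuous_integrable; rewrite /E /E2 /X /Y /X' /Y'; conts.
- by apply: continuous_integrable; rewrite /E /E2 /X /Y /X' /Y'; conts.
rewrite RintegralZl//; last first.
  by apply: continuous_integrable; rewrite /E /E2 /X /Y /X' /Y'; conts.
by rewrite -/(U x) -/(U2 x); lra.
Qed.

(* [U] and [Q] solve the same second-order equation with proportional initial data,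
   so their Wronskian vanishes. *)
Lemma separated_zero (Q S : R -> R) x0 : 0 <= x0 -> w != 0 ->
  (forall t, t \in `[0, x0] -> is_derive t 1 Q (w * S t)) ->
  (forall t, t \in `[0, x0] -> is_derive t 1 S (- (w * (coshR t ^+ 2 - tau) * Q t))) ->
  cos psi * S 0 = 0 -> sin psi * Q 0 = 0 -> Q x0 = 0 -> S x0 != 0 ->
  \int[mu]_(t in `[0, pi / 2]) (Phi t * (cos (w * coshR x0 * cos eta * cos t) *
    cos (w * sinhR x0 * sin eta * sin t + psi))) = 0.
Proof.
move=> x00 w0 dQ dS S0 Q0 Qx Sx; rewrite -[LHS]/(U x0).
pose V t := U t * (w * S t) - U1 t * Q t.
have dV t : t \in `[0, x0] -> is_derive t 1 V 0.
  move=> tI; have h1 := dQ _ tI; have h2 := dS _ tI; have h3 := dU t; have h4 := dU1 t.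
  by rewrite /V; der; rewrite radial; ring.
have V0 : V 0 = 0.
  (* At [x = 0] the ellipse degenerates to the focal segment: [U] is a multiple of [cos psi] and
     [U1] of [sin psi], as the initial data of [Q] require. *)
  have e1 : U 0 = cos psi * \int[mu]_(t in `[0, pi / 2]) (Phi t * cos (w * cos eta * cos t)).
    rewrite -RintegralZl//; last by apply: continuous_integrable; conts.
    apply: eq_Rintegral => t _; rewrite /E /X /Y coshR0 sinhR0 !(mulr0, mul0r, mulr1) add0r; ring.
  have e2 : U1 0 = sin psi * \int[mu]_(t in `[0, pi / 2]) (- (Phi t * cos (w * cos eta * cos t) * (w * sin eta * sin t))).
    rewrite -RintegralZl//; last by apply: continuous_integrable; conts.
    apply: eq_Rintegral => t _; rewrite /E1 /X /Y /X' /Y' coshR0 sinhR0 !(mulr0, mul0r, mulr1) add0r; ring.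
  rewrite /V e1 e2; move: (\int[mu]_(t in _) _) (\int[mu]_(t in _) _) => B A.
  have -> : cos psi * A * (w * S 0) = A * w * (cos psi * S 0) by ring.
  have -> : sin psi * B * Q 0 = B * (sin psi * Q 0) by ring.
  by rewrite S0 Q0 !mulr0 subrr.
have Vx : V x0 = 0.
  apply/eqP; rewrite eq_le -{1}oppr_ge0 -V0; apply/andP; split.
    rewrite V0 -[0]oppr0 -[in X in X <= _]V0.
    by apply: (le_of_derive_ge0 (fun t => - V t) (fun=> 0)) => // t tI; have h := dV t tI; der; rewrite oppr0.
  by apply: (le_of_derive_ge0 V (fun=> 0)) => // t tI; exact: dV.
move: Vx; rewrite /V Qx mulr0 subr0 => /eqP.
by rewrite !mulf_eq0 (negbTE w0) (negbTE Sx) !orbF => /eqP.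
Qed.

End separation.

(** * Nonvanishing of the superpositions *)

Section nonvanishing.
Context {R : realType}.
Local Notation mu := (@lebesgue_measure R).
Implicit Types (t x : R) (g : R -> R).

(* As [n] grows, [cos^2n] concentrates at [0], where [g] is positive. *)
Lemma moment_pos g (d : R) : continuous g -> 0 < d -> d < pi / 2 ->
  (forall t, 0 < t <= d -> 0 < g t) ->
  exists n, 0 < \int[mu]_(t in `[0, pi / 2]) (g t * (cos t ^+ 2) ^+ n).
Proof.
move=> cg d0 dpi gpos.
have pi0 : 0 < pi :> R := pi_gt0 R.
have [c cI cmin] := @EVT_min R g (d / 4) (d / 2) (ltac:(lra)) (continuous_subspaceT cg).
have m0 : 0 < g c by apply: gpos; move: cI; rewrite in_itv/= => /andP[h1 h2]; apply/andP; split; lra.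
have [M M0 gM] := segment_bound g 0 (pi / 2) (ltac:(lra)) cg.
(* On [[d / 4, d / 2]] the integrand is at least [g c * a ^+ n], beyond [d] at least
   [- (M * b ^+ n)], and elsewhere nonnegative; as [b < a], the first contribution wins for large
   [n]. *)
pose a : R := cos (d / 2) ^+ 2; pose b : R := cos d ^+ 2.
have c1 : 0 < cos (d / 2) by apply: cos_gt0_pihalf; apply/andP; split; lra.
have c2 : 0 < cos d by apply: cos_gt0_pihalf; apply/andP; split; lra.
have c12 : cos d < cos (d / 2) by rewrite ltr_cos ?in_itv/=; [lra|apply/andP; split; lra|apply/andP; split; lra].
have a0 : 0 < a by rewrite exprn_gt0.
have b0 : 0 < b by rewrite exprn_gt0.
have ba : b < a by rewrite /a /b ltrXn2r// ?nnegrE ltW.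
have ba1 : `|b / a| < 1 by rewrite ger0_norm ?divr_ge0 ?(ltW a0) ?(ltW b0)// ltr_pdivrMr// mul1r.
have eps0 : 0 < g c * (d / 4) / (2 * M + 1) by rewrite !divr_gt0 ?mulr_gt0//; lra.
have [n _ /(_ n (leqnn n))] := cvgr0_norm_lt _ (cvg_expr ba1) _ eps0.
rewrite ger0_norm; last by rewrite exprn_ge0// divr_ge0// ltW.
rewrite exprMn exprVn ltr_pdivrMr ?exprn_gt0// => nn.
exists n.
pose h t := g t * (cos t ^+ 2) ^+ n.
have ch : continuous h by rewrite /h; conts.
have [F _ dF] := primitive_exists h ch.
rewrite (Rint_FTC F h)//; last by rewrite divr_gt0.
have lb (u v k : R) : u <= v -> (forall t, t \in `]u, v[ -> k <= h t) -> k * (v - u) <= F v - F u.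
  move=> uv kh; have H := le_of_derive_ge0 (fun t => F t - k * t) (fun t => h t - k) u v uv.
  suff : F u - k * u <= F v - k * v by lra.
  by apply: H => [t _|t tI]; [have hh := dF t; der; ring|rewrite subr_ge0 kh].
have hp t : 0 < t <= d -> 0 <= h t.
  move=> tI; apply: mulr_ge0; first exact: ltW (gpos _ tI).
  by rewrite exprn_ge0// sqr_ge0.
have l1 : 0 * (d / 4 - 0) <= F (d / 4) - F 0.
  by apply: lb => [|t]; [lra|rewrite in_itv/= => /andP[h1 h2]; apply: hp; apply/andP; split; lra].
have l3 : 0 * (d - d / 2) <= F d - F (d / 2).
  by apply: lb => [|t]; [lra|rewrite in_itv/= => /andP[h1 h2]; apply: hp; apply/andP; split; lra].
have l2 : g c * a ^+ n * (d / 2 - d / 4) <= F (d / 2) - F (d / 4).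
  apply: lb => [|t tI]; first lra.
  have tI' := subset_itv_oo_cc tI.
  apply: ler_pM; [exact: ltW|by rewrite exprn_ge0// ltW|exact: cmin|].
  rewrite lerXn2r ?nnegrE ?sqr_ge0 ?(ltW a0)// /a.
  move: tI; rewrite in_itv/= => /andP[h1 h2].
  have ct : cos (d / 2) < cos t by rewrite ltr_cos ?in_itv/=; [lra|apply/andP; split; lra|apply/andP; split; lra].
  by rewrite lerXn2r ?nnegrE ?(ltW c1) ?(ltW ct)// ltW// (lt_trans c1).
have l4 : - (M * b ^+ n) * (pi / 2 - d) <= F (pi / 2) - F d.
  apply: lb => [|t tI]; first lra.
  move: (tI); rewrite in_itv/= => /andP[h1 h2].
  have ct0 : 0 < cos t by apply: cos_gt0_pihalf; apply/andP; split; lra.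
  have ct : cos t < cos d by rewrite ltr_cos ?in_itv/=; [lra|apply/andP; split; lra|apply/andP; split; lra].
  have : `|h t| <= M * b ^+ n.
    rewrite normrM; apply: ler_pM => //; first by apply: gM; rewrite in_itv/=; apply/andP; split; lra.
    rewrite ger0_norm; last by rewrite exprn_ge0// sqr_ge0.
    have e : cos t ^+ 2 <= b.
      by rewrite /b; apply: lerXn2r; rewrite ?nnegrE; exact: ltW.
    by apply: lerXn2r => //; rewrite nnegrE ?sqr_ge0// ltW.
  by rewrite ler_norml => /andP[].
have pi4 := @pihalf_lt2 R.
have bn0 : 0 <= b ^+ n by rewrite exprn_ge0// ltW.
have an0 : 0 < a ^+ n by rewrite exprn_gt0.
have l5 : M * b ^+ n * (pi / 2 - d) <= 2 * M * b ^+ n.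
  by rewrite (mulrC 2) -mulrA -(mulrA M) ler_wpM2l// mulrC ler_wpM2r//; lra.
have l6 : (2 * M + 1) * b ^+ n < g c * (d / 4) * a ^+ n.
  by move: nn; rewrite mulrAC ltr_pdivlMr ?[b ^+ n * _]mulrC//; lra.
have -> : F (pi / 2) - F 0 = (F (d / 4) - F 0) + (F (d / 2) - F (d / 4)) + (F d - F (d / 2)) + (F (pi / 2) - F d) by ring.
have l7 : g c * a ^+ n * (d / 2 - d / 4) = g c * (d / 4) * a ^+ n by field.
by move: l1 l2 l3 l4 l5 l6; rewrite l7; lra.
Qed.

Lemma dx_eq0 (f : R * R -> R) (D : set (R * R)) : open D ->
  (forall p, D p -> f p = 0) -> forall p, D p -> dx f p = 0.
Proof.
move=> oD f0 p Dp; rewrite /dx (near_eq_derive _ (g := cst 0)); first exact: derive_cst.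
by apply: filterS (open_nbhs_nbhs (conj oD Dp)) => q Dq; rewrite f0.
Qed.

Lemma dy_eq0 (f : R * R -> R) (D : set (R * R)) : open D ->
  (forall p, D p -> f p = 0) -> forall p, D p -> dy f p = 0.
Proof.
move=> oD f0 p Dp; rewrite /dy (near_eq_derive _ (g := cst 0)); first exact: derive_cst.
by apply: filterS (open_nbhs_nbhs (conj oD Dp)) => q Dq; rewrite f0.
Qed.

(* The derivatives [dx^2n] at the origin are the moments of [g] against [cos^2n]. *)
Lemma wave_cos_nonzero g (k d : R) (D : set (R * R)) : k != 0 -> continuous g ->
  0 < d -> d < pi / 2 -> (forall t, 0 < t <= d -> 0 < g t) ->
  open D -> D (0, 0) ->
  ~ (forall p, D p -> wave (fun t => k * cos t) (fun t => k * sin t) g 0 0 p = 0).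
Proof.
move=> k0 cg d0 dpi gpos oD D0 W0.
have ca : continuous (fun t : R => k * cos t) by conts.
have cb : continuous (fun t : R => k * sin t) by conts.
have [n] := moment_pos g d cg d0 dpi gpos.
suff H : forall n p, D p ->
    wave (fun t => k * cos t) (fun t => k * sin t) (fun t => g t * (cos t ^+ 2) ^+ n) 0 0 p = 0.
  have := H n _ D0; rewrite /wave/=.
  under eq_Rintegral do rewrite !mul0r addr0 cos0 !mulr1.
  by move=> ->; rewrite ltxx.
elim=> [|m IH] p Dp.
  by rewrite -[RHS](W0 p Dp); apply: wave_ext => t; rewrite expr0 mulr1.
have cm : continuous (fun t => g t * (cos t ^+ 2) ^+ m) by conts.
have := dx_eq0 _ _ oD (dx_eq0 _ _ oD IH) p Dp.
rewrite wave_dx// wave_dx//; last by conts.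
rewrite /wave => H.
have k20 : - k ^+ 2 != 0 by rewrite oppr_eq0 expf_neq0.
apply: (mulfI k20); rewrite mulr0 -[RHS]H -RintegralZl//; last by apply: continuous_integrable; conts.
apply: eq_Rintegral => t _ /=.
rewrite (_ : p.1 * (k * cos t) + (0 + pi / 2 + pi / 2) = p.1 * (k * cos t) + pi / 2 + pi / 2); last by ring.
by rewrite cosDpihalf sinDpihalf !addr0 (exprS _ m); ring.
Qed.

(** Differentiation in the second variable brings the phase to [0] and multiplies the density by
    [k * sin t], positive on the same interval: the cosine case applies. *)
Lemma wave_sin_nonzero g (k d : R) (D : set (R * R)) : 0 < k -> continuous g ->
  0 < d -> d < pi / 2 -> (forall t, 0 < t <= d -> 0 < g t) ->
  open D -> D (0, 0) ->
  ~ (forall p, D p -> wave (fun t => k * cos t) (fun t => k * sin t) g 0 (- (pi / 2)) p = 0).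
Proof.
move=> k0 cg d0 dpi gpos oD D0 W0.
have ca : continuous (fun t : R => k * cos t) by conts.
have cb : continuous (fun t : R => k * sin t) by conts.
apply: (wave_cos_nonzero (fun t => g t * (k * sin t)) k d D) => //.
- by rewrite gt_eqF.
- by conts.
- move=> t td; rewrite mulr_gt0 ?gpos// mulr_gt0// sin_gt0_pihalf//.
  by case/andP: td => t0 td; rewrite t0/=; lra.
- move=> p Dp; have := dy_eq0 _ _ oD W0 p Dp.
  by rewrite wave_dy// addNr.
Qed.

End nonvanishing.

(** * Weak formulation *)

Section plane_measure.
Context {R : realType}.
Local Notation plane := (measurableTypeR R * measurableTypeR R)%type.
Local Notation area := (@area R).
Implicit Types (D : set plane) (f u v F : R * R -> R).

(** Measurability refers to the product sigma-algebra; an open set is the countable union of the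
    rational boxes that it contains. *)
Lemma open_measurable_plane (U : set (R * R)) : open U -> measurable (U : set plane).
Proof.
move=> oU.
pose box (q : rat * rat * (rat * rat)) : set plane :=
  `]ratr q.1.1, ratr q.1.2[%classic `*` `]ratr q.2.1, ratr q.2.2[%classic.
have -> : U = \bigcup_q [set p | box q p /\ box q `<=` U].
  apply/seteqP; split => [[x y] Uxy|p [q _ [qp qU]]]; last exact: qU.
  have [[A B] /= [nA nB] AB] : nbhs (x, y) U by exact: open_nbhs_nbhs.
  have [e1 /= e10 H1] := (nbhs_ballP _ _).1 nA.
  have [e2 /= e20 H2] := (nbhs_ballP _ _).1 nB.
  have /rat_in_itvoo[a1 ha1] : x - e1 < x by rewrite ltrBlDr ltrDl.
  have /rat_in_itvoo[a2 ha2] : x < x + e1 by rewrite ltrDl.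
  have /rat_in_itvoo[b1 hb1] : y - e2 < y by rewrite ltrBlDr ltrDl.
  have /rat_in_itvoo[b2 hb2] : y < y + e2 by rewrite ltrDl.
  exists ((a1, a2), (b1, b2)) => //; split.
    by split; rewrite /= in_itv/=; rewrite ?(itvP ha1) ?(itvP ha2) ?(itvP hb1) ?(itvP hb2).
  move=> [z t] [/=]; rewrite !in_itv/= => /andP[z1 z2] /andP[t1 t2].
  apply: AB; split; [apply: H1|apply: H2] => /=; rewrite /ball/= ltr_distlC; apply/andP; split.
  - by rewrite (lt_trans _ z1)// (itvP ha1).
  - by rewrite (lt_trans z2)// (itvP ha2).
  - by rewrite (lt_trans _ t1)// (itvP hb1).
  - by rewrite (lt_trans t2)// (itvP hb2).
apply: countable_bigcupT_measurable => // q.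
have [bU|nbU] := pselect (box q `<=` U).
  rewrite (_ : [set p | _] = box q); first by apply: measurableX; exact: measurable_itv.
  by apply/seteqP; split => [p []|p].
by rewrite (_ : [set p | _] = set0)//; apply/seteqP; split => [p []|p].
Qed.

Lemma continuous_measurable_plane f : continuous f -> measurable_fun [set: plane] f.
Proof.
move=> cf; apply: (measurability _ (RGenOpens.measurableE R)).
move=> _ [_ [a [b ->] <-]]; rewrite setTI; apply: open_measurable_plane.
by have /continuousP := cf; apply; exact: interval_open.
Qed.

Lemma area_box (a b c d : R) : (area (`[a, b]%classic `*` `[c, d]%classic) < +oo)%E.
Proof.
rewrite /Defs.area product_measure1E; [|exact: measurable_itv|exact: measurable_itv].
have fin (x y : R) : (@lebesgue_measure R `[x, y] < +oo)%E.
  by rewrite lebesgue_measure_itv /=; case: ifPn => _; rewrite -?EFinD ltry.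
apply: lte_mul_pinfty; [exact: measure_ge0| |exact: fin].
by rewrite ge0_fin_numE; [exact: fin|exact: measure_ge0].
Qed.

Lemma bounded_integrable D f (M : R) : measurable D -> (area D < +oo)%E ->
  measurable_fun [set: plane] f -> (forall p, D p -> `|f p| <= M) ->
  area.-integrable D (EFin \o f).
Proof.
move=> mD aD mf fM; apply: measurable_bounded_integrable => //.
  exact: measurable_funTS.
exists M; split; first exact: num_real.
by move=> y My p Dp /=; apply: le_trans (fM p Dp) _; exact: ltW.
Qed.

Lemma Lnorm2E F : Lnorm area 2%:E (EFin \o F) = ((\int[area]_p ((F p) ^+ 2)%:E) `^ 2^-1)%E.
Proof.
rewrite unlock; congr (_ `^ _)%E; apply: eq_integral => p _ /=.
by rewrite powR_mulrn// real_normK// num_real.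
Qed.

Lemma L2_bounded D f (M : R) : measurable D -> (area D < +oo)%E ->
  measurable_fun [set: plane] f -> (forall p, D p -> `|f p| <= M) -> L2 D f.
Proof.
move=> mD aD mf fM; rewrite /L2 inE; apply/andP; split; rewrite inE/=.
  by apply/(measurable_restrictT _ mD); exact: measurable_funTS.
rewrite /finite_norm Lnorm2E poweR_lty//.
have : area.-integrable D (EFin \o (fun p => f p ^+ 2)).
  apply: (bounded_integrable _ _ (M ^+ 2)) => //; first exact: measurable_funX.
  move=> p Dp; rewrite normrX lerXn2r ?nnegrE//; last exact: fM.
  by rewrite (le_trans _ (fM p Dp)).
move=> /(integrable_mkcond _ mD).1 /integrableP[_].
apply: le_lt_trans; apply: ge0_le_integral => //.
- by move=> p _; rewrite lee_fin sqr_ge0.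
- apply/measurable_EFinP; apply: measurable_funX.
  by apply/(measurable_restrictT _ mD); exact: measurable_funTS.
- apply: measurableT_comp => //; apply/(measurable_restrictT _ mD).
  by apply/measurable_EFinP; apply: measurable_funTS; exact: measurable_funX.
- move=> p _; rewrite !patchE; case: ifPn => _ /=; last by rewrite expr0n/= normr0.
  by rewrite lee_fin ler_norm.
Qed.

Lemma L2_measurable D f : L2 D f -> measurable_fun [set: plane] (f \_ D).
Proof. by rewrite /L2 inE => /andP[]; rewrite inE. Qed.

Lemma L2_mul_integrable D f v : measurable D -> L2 D f -> L2 D v ->
  area.-integrable D (EFin \o (fun p => f p * v p)).
Proof.
move=> mD fD vD; apply/(integrable_mkcond _ mD).2.
have := Lfun2_mul_Lfun1 fD vD => /Lfun1_integrable.
apply: eq_integrable => // p _ /=; rewrite !patchE; case: ifPn => //.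
by rewrite mul0r.
Qed.

Lemma L2_cvg_dominated D (w : nat -> R * R -> R) u (K : R) :
  measurable D -> (area D < +oo)%E ->
  (forall n, measurable_fun [set: plane] (w n)) -> measurable_fun [set: plane] u ->
  (forall n p, D p -> `|w n p - u p| <= K) ->
  (forall p, D p -> w n p @[n --> \oo] --> u p) -> L2_cvg D w u.
Proof.
move=> mD aD mw mu wK wu.
pose g n (p : plane) : \bar R := ((w n p - u p) ^+ 2)%:E.
have mg n : measurable_fun [set: plane] (g n : plane -> \bar R).
  by apply/measurable_EFinP; apply: measurable_funX; exact: measurable_funB.
have [|||||_ _] := @dominated_convergence _ plane R area D mD g (cst 0%E) (cst (K ^+ 2)%:E).
- by move=> n; exact: measurable_funTS.
- exact: measurable_cst.
- apply/aeW => p Dp; rewrite /g; apply/cvg_EFin; first by apply: nearW.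
  have h : w n p - u p @[n --> \oo] --> 0.
    by rewrite -(subrr (u p)); apply: cvgB; [exact: wu|exact: cvg_cst].
  have E0 : (0 : R) ^+ 2 = 0 by rewrite expr0n.
  rewrite -[X in _ --> X]E0.
  by apply: (cvg_comp (fun n => w n p - u p) (fun t => t ^+ 2) h); exact: exprn_continuous.
- by apply: (bounded_integrable D (cst (K ^+ 2)) `|K ^+ 2|).
- apply/aeW => p n Dp; rewrite /g /= lee_fin normrX lerXn2r ?nnegrE//; last exact: wK.
  by rewrite (le_trans _ (wK n p Dp)).
rewrite integral_cst//= mul0e => H.
rewrite /L2_cvg.
have E n : Lnorm area 2%:E (EFin \o ((w n \- u) \_ D)) = sqrte (\int[area]_(p in D) g n p).
  rewrite Lnorm2E poweR12_sqrt; last by apply: integral_ge0 => p _; rewrite lee_fin sqr_ge0.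
  congr sqrte; rewrite [RHS]integral_mkcond; apply: eq_integral => p _.
  by rewrite !patchE; case: ifPn => //; rewrite expr0n.
under eq_fun do rewrite E.
move: H; set I := fun n => _.
move=> /fine_cvgP[Hfin Hc]; apply/fine_cvgP; split.
  by apply: filterS Hfin => n; rewrite -/(I n); case: (I n).
have -> : fine \o (fun n => sqrte (\int[area]_(p in D) g n p)%E) = (fun n => Num.sqrt (fine (I n))).
  by apply/funext => n /=; rewrite -/(I n); case: (I n) => [r||] //=; rewrite sqrtr0.
rewrite -[X in _ --> X]sqrtr0.
by apply: (cvg_comp (fun n => fine (I n)) Num.sqrt Hc); exact: sqrt_continuous.
Qed.

(** Cauchy-Schwarz, as the Hoelder inequality with both exponents [2]. *)
Lemma L2_inner_cvg D f v (w : nat -> R * R -> R) : measurable D -> L2 D f -> L2 D v ->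
  (forall n, L2 D (w n)) -> L2_cvg D w v ->
  L2_inner D f (w n) @[n --> \oo] --> L2_inner D f v.
Proof.
move=> mD fD vD wD wv.
have CS n : (`|L2_inner D f v - L2_inner D f (w n)|%:E <=
    Lnorm area 2%:E (EFin \o (f \_ D)) * Lnorm area 2%:E (EFin \o ((w n \- v)%R \_ D)))%E.
  have mwv : measurable_fun [set: plane] ((w n \- v) \_ D).
    rewrite (_ : _ \_ D = ((w n) \_ D) \- (v \_ D)).
      by apply: measurable_funB; exact: L2_measurable.
    by apply/funext => p; rewrite /= !patchE; case: ifPn => //; rewrite subrr.
  have i1 := L2_mul_integrable _ _ _ mD fD vD; have i2 := L2_mul_integrable _ _ _ mD fD (wD n).
  rewrite /L2_inner distrC -RintegralB//.
  have i3 : area.-integrable D (EFin \o (fun p => f p * w n p - f p * v p)).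
    by under [X in integrable _ _ X]eq_fun do rewrite /= EFinB; exact: integrableB.
  rewrite EFin_normr_Rintegral//; apply: le_trans (le_abse_integral _ mD _) _.
    by case/integrableP: i3.
  apply: le_trans (hoelder area (L2_measurable _ _ fD) mwv _ _ _) => //; last by rewrite [RHS]splitr !div1r.
  rewrite Lnorm1 [leLHS]integral_mkcond; apply: ge0_le_integral => //.
  - by move=> p _; rewrite patchE; case: ifPn.
  - apply/(measurable_restrictT _ mD); apply: measurableT_comp => //.
    by case/integrableP: i3.
  - apply: measurableT_comp => //; apply/measurable_EFinP.
    by apply: measurable_funM => //; exact: L2_measurable.
  - move=> p _; rewrite /= !patchE; case: ifPn => _ /=; last by rewrite mul0r normr0.
    by rewrite mulrBr.
have fN : Lnorm area 2%:E (EFin \o (f \_ D)) \is a fin_num.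
  by rewrite ge0_fin_numE ?Lnorm_ge0//; move: fD; rewrite /L2 inE => /andP[_]; rewrite inE.
have /fine_cvgP[_ H] : (`|L2_inner D f v - L2_inner D f (w n)|%:E @[n --> \oo] --> 0%:E)%E.
  apply: (@squeeze_cvge _ _ _ _ (cst 0%E) _
    (fun n => Lnorm area 2%:E (EFin \o (f \_ D)) * Lnorm area 2%:E (EFin \o ((w n \- v)%R \_ D)))%E).
  - by apply: nearW => n; rewrite CS andbT lee_fin.
  - exact: cvg_cst.
  - by rewrite -[X in _ --> X](mule0 (Lnorm area 2%:E (EFin \o (f \_ D)))); exact: cvgeZl.
by apply/cvgrPdist_lt => e e0; apply: filterS (cvgr0_norm_lt _ H _ e0) => n /=; rewrite normr_id.
Qed.

End plane_measure.

(** * Closure properties of smooth functions on the plane *)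

Section smooth_functions.
Context {R : realType}.
Implicit Types (f g : R * R -> R) (k n : nat).

Lemma is_CkS k f : is_Ck k.+1 f -> is_Ck k f.
Proof.
elim: k f => [|k IH] f; first by case.
by move=> [cf fx fy /IH h1 /IH h2]; split.
Qed.

Lemma dx_cst (c : R) : dx (fun=> c) = fun=> 0.
Proof. by apply/funext => p; exact: derive_cst. Qed.

Lemma dy_cst (c : R) : dy (fun=> c) = fun=> 0.
Proof. by apply/funext => p; exact: derive_cst. Qed.

Lemma is_Ck_cst k (c : R) : is_Ck k (fun=> c).
Proof.
elim: k c => [|k IH] c; first by conts.
split; [by conts|by move=> p; exact: derivable_cst|by move=> p; exact: derivable_cst| |].
- by rewrite dx_cst.
- by rewrite dy_cst.
Qed.

Lemma is_CkD k f g : is_Ck k f -> is_Ck k g -> is_Ck k (fun p => f p + g p).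
Proof.
elim: k f g => [|k IH] f g; first by move=> /= cf cg; conts.
move=> [cf fx fy fxk fyk] [cg gx gy gxk gyk]; split.
- by conts.
- by move=> p; exact: derivableD.
- by move=> p; exact: derivableD.
- rewrite (_ : dx _ = fun p => dx f p + dx g p); first exact: IH.
  by apply/funext => p; exact: deriveD.
- rewrite (_ : dy _ = fun p => dy f p + dy g p); first exact: IH.
  by apply/funext => p; exact: deriveD.
Qed.

Lemma dxM f g p : derivable f p ((1, 0) : R * R) -> derivable g p ((1, 0) : R * R) ->
  dx (fun p => f p * g p) p = f p * dx g p + g p * dx f p.
Proof. by move=> fx gx; exact: (deriveM fx gx). Qed.

Lemma dyM f g p : derivable f p ((0, 1) : R * R) -> derivable g p ((0, 1) : R * R) ->
  dy (fun p => f p * g p) p = f p * dy g p + g p * dy f p.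
Proof. by move=> fx gx; exact: (deriveM fx gx). Qed.

Lemma is_CkM k f g : is_Ck k f -> is_Ck k g -> is_Ck k (fun p => f p * g p).
Proof.
elim: k f g => [|k IH] f g; first by move=> /= cf cg; conts.
move=> fk gk; have fk' := is_CkS _ _ fk; have gk' := is_CkS _ _ gk.
move: fk gk => [cf fx fy fxk fyk] [cg gx gy gxk gyk]; split.
- by conts.
- by move=> p; exact: derivableM.
- by move=> p; exact: derivableM.
- rewrite (_ : dx _ = fun p => f p * dx g p + g p * dx f p).
    by apply: is_CkD; exact: IH.
  by apply/funext => p; exact: dxM.
- rewrite (_ : dy _ = fun p => f p * dy g p + g p * dy f p).
    by apply: is_CkD; exact: IH.
  by apply/funext => p; exact: dyM.
Qed.

Lemma is_derive_fst (x y : R) : is_derive (x, y) ((1, 0) : R * R) (@fst R R) 1.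
Proof. by apply/is_derive_dx; exact: drv_id. Qed.

Lemma is_derive_snd (x y : R) : is_derive (x, y) ((0, 1) : R * R) (@snd R R) 1.
Proof. by apply/is_derive_dy; exact: drv_id. Qed.

Lemma is_derive_fst0 (x y : R) : is_derive (x, y) ((0, 1) : R * R) (@fst R R) 0.
Proof. by apply/is_derive_dy; exact: drv_cst. Qed.

Lemma is_derive_snd0 (x y : R) : is_derive (x, y) ((1, 0) : R * R) (@snd R R) 0.
Proof. by apply/is_derive_dx; exact: drv_cst. Qed.

Lemma smooth_fst : smooth (@fst R R).
Proof.
case=> [|k]; first by move=> p; exact: cts_fst.
split; first by move=> p; exact: cts_fst.
- by move=> [x y]; have [] := is_derive_fst x y.
- by move=> [x y]; have [] := is_derive_fst0 x y.
- rewrite (_ : dx _ = fun=> 1); first exact: is_Ck_cst.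
  by apply/funext => -[x y]; have [_] := is_derive_fst x y.
- rewrite (_ : dy _ = fun=> 0); first exact: is_Ck_cst.
  by apply/funext => -[x y]; have [_] := is_derive_fst0 x y.
Qed.

Lemma smooth_snd : smooth (@snd R R).
Proof.
case=> [|k]; first by move=> p; exact: cts_snd.
split; first by move=> p; exact: cts_snd.
- by move=> [x y]; have [] := is_derive_snd0 x y.
- by move=> [x y]; have [] := is_derive_snd x y.
- rewrite (_ : dx _ = fun=> 0); first exact: is_Ck_cst.
  by apply/funext => -[x y]; have [_] := is_derive_snd0 x y.
- rewrite (_ : dy _ = fun=> 1); first exact: is_Ck_cst.
  by apply/funext => -[x y]; have [_] := is_derive_snd x y.
Qed.

Lemma derivable_slicex f (x y : R) : derivable f (x, y) ((1, 0) : R * R) ->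
  is_derive x 1 (fun s => f (s, y)) (dx f (x, y)).
Proof. by move=> fx; apply/is_derive_dx; exact: DeriveDef. Qed.

Lemma derivable_slicey f (x y : R) : derivable f (x, y) ((0, 1) : R * R) ->
  is_derive y 1 (fun s => f (x, s)) (dy f (x, y)).
Proof. by move=> fx; apply/is_derive_dy; exact: DeriveDef. Qed.

End smooth_functions.

(** * The cutoff profile *)

Section bump.
Context {R : realType}.
Implicit Types (s : R) (n k : nat).

(* [s^-n exp (-1/s)] for [s > 0], and 0 for [s <= 0]: a family of smooth functions
   closed under derivation up to linear combinations. *)
Definition flat n s : R := if 0 < s then s^-1 ^+ n * expR (- s^-1) else 0.

(** With [r = s^-1], [1 + x <= expR x] at [x = r / (n + 1)] gives [expR r >= (r / (n + 1)) ^+ n.+1],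
    one power more than [r ^+ n]; the spare power is the factor [s]. *)
Lemma flat_bound n s : `|flat n s| <= n.+1%:R ^+ n.+1 * `|s|.
Proof.
rewrite /flat; case: ifPn => s0; last by rewrite normr0 mulr_ge0// exprn_ge0.
have r0 : 0 < s^-1 by rewrite invr_gt0.
rewrite ger0_norm ?mulr_ge0 ?exprn_ge0 ?expR_ge0 ?(ltW r0)// (gtr0_norm s0).
have N0 : 0 < n.+1%:R :> R by rewrite ltr0n.
have h : (s^-1 / n.+1%:R) ^+ n.+1 <= expR s^-1.
  have -> : expR s^-1 = expR (s^-1 / n.+1%:R) ^+ n.+1.
    by rewrite -expRM_natl mulrC divfK// lt0r_neq0.
  apply: lerXn2r; rewrite ?nnegrE ?expR_ge0//; first by rewrite divr_ge0 ?ltW.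
  by apply: le_trans (expR_ge1Dx _); rewrite lerDr.
rewrite expRN ler_pdivrMr ?expR_gt0//.
have : n.+1%:R ^+ n.+1 * s * ((s^-1 / n.+1%:R) ^+ n.+1) <= n.+1%:R ^+ n.+1 * s * expR s^-1.
  by apply: ler_wpM2l => //; rewrite mulr_ge0 ?exprn_ge0// ltW.
apply: le_trans; rewrite expr_div_n mulrA mulrAC [_ * s * _]mulrAC.
by rewrite divff ?expf_neq0 ?lt0r_neq0// mul1r exprS mulrA mulfV ?lt0r_neq0// mul1r.
Qed.

Lemma flat_continuous0 n : {for 0, continuous (flat n)}.
Proof.
rewrite /prop_for /continuous_at {2}/flat ltxx; apply/cvgrPdist_lt => e e0.
pose h s : R := n.+1%:R ^+ n.+1 * `|s|.
have ch : continuous_at 0 h by rewrite /h; cont; exact: norm_continuous.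
have h0 : h 0 < e by rewrite /h normr0 mulr0.
apply: filterS (cvgr_lt _ ch _ h0) => s hs.
by rewrite sub0r normrN (le_lt_trans (flat_bound n s)).
Qed.

(** At [0] the difference quotient of [flat n] is [flat n.+1] itself, which tends to [0]. *)
Lemma is_derive_flat n s : is_derive s 1 (flat n) (flat n.+2 s - n%:R * flat n.+1 s).
Proof.
have [s0|s0|->] := ltgtP s 0.
- have e0 : flat n.+2 s - n%:R * flat n.+1 s = 0.
    by rewrite /flat ltNge (ltW s0)/= mulr0 subrr.
  rewrite e0; apply: near_eq_is_derive (drv_cst s (0 : R)).
  by near=> t; rewrite /flat ltNge (ltW (_ : t < 0))//; near: t; exact: lt_nbhsl.
- apply: (@near_eq_is_derive _ _ _ (fun s => s^-1 ^+ n * expR (- s^-1))).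
    by near=> t; rewrite /flat ifT//; near: t; exact: lt_nbhsr.
  have dV : is_derive s 1 (fun s => s^-1) (- (s^-1 ^+ 2)).
    have := @is_deriveV R id s 1 1 (lt0r_neq0 s0) (is_derive_id _ _).
    by rewrite /GRing.scale/= mulr1 exprVn.
  have dVn : is_derive s 1 (fun s => s^-1 ^+ n) (- (n%:R * s^-1 ^+ n.+1)).
    elim: n => [|m IH].
      by under eq_fun do rewrite expr0; rewrite mul0r oppr0; exact: drv_cst.
    have := drv_mul _ _ _ _ _ dV IH.
    under eq_fun do rewrite -exprS.
    move=> /drv_eq; apply; rewrite -natr1 !exprS; ring.
  by der; rewrite /flat s0 !exprS; ring.
- have -> : flat n.+2 0 - n%:R * flat n.+1 0 = 0 :> R by rewrite /flat ltxx mulr0 subrr.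
  have E : (fun h : R => h^-1 *: (flat n (h *: (1 : R) + 0) - flat n 0)) = flat n.+1.
    apply/funext => h; rewrite /GRing.scale/= mulr1 addr0 /flat ltxx subr0.
    by case: ifPn => _; rewrite ?mulr0// exprS mulrA.
  have c0 : flat n.+1 h @[h --> 0^'] --> (0 : R).
    have c : flat n.+1 h @[h --> 0] --> (0 : R).
      by have := flat_continuous0 n.+1; rewrite /prop_for /continuous_at {2}/flat ltxx.
    move=> P /c.
    by apply: (@filterS _ (nbhs (0 : R)) _ (fun t => P (flat n.+1 t)) (fun t => t != 0 -> P (flat n.+1 t))).
  by apply: DeriveDef; [rewrite /derivable E; apply/cvg_ex; exists 0|rewrite /derive E; exact: cvg_lim].
Unshelve. all: by end_near. Qed.

Lemma flat_continuous n : continuous (flat n).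
Proof. by move=> s; apply: drv_continuous (is_derive_flat n s). Qed.

Lemma dx_flat n (f : R * R -> R) (p : R * R) : derivable f p ((1, 0) : R * R) ->
  is_derive p ((1, 0) : R * R) (fun p => flat n (f p)) ((flat n.+2 (f p) - n%:R * flat n.+1 (f p)) * dx f p).
Proof.
case: p => x y fx; apply/is_derive_dx; have h := derivable_slicex _ _ _ fx.
by apply: drv_comp h _; exact: is_derive_flat.
Qed.

Lemma dy_flat n (f : R * R -> R) (p : R * R) : derivable f p ((0, 1) : R * R) ->
  is_derive p ((0, 1) : R * R) (fun p => flat n (f p)) ((flat n.+2 (f p) - n%:R * flat n.+1 (f p)) * dy f p).
Proof.
case: p => x y fx; apply/is_derive_dy; have h := derivable_slicey _ _ _ fx.
by apply: drv_comp h _; exact: is_derive_flat.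
Qed.

Lemma is_Ck_flat k n (f : R * R -> R) : is_Ck k f -> is_Ck k (fun p => flat n (f p)).
Proof.
have sub m (g : R * R -> R) i j (c : R) : is_Ck m (fun p => flat i (g p)) ->
    is_Ck m (fun p => flat j (g p)) -> is_Ck m (fun p => flat i (g p) - c * flat j (g p)).
  move=> h1 h2; rewrite (_ : (fun p => _) = fun p => flat i (g p) + (- c) * flat j (g p)).
    by apply: is_CkD => //; apply: is_CkM => //; exact: is_Ck_cst.
  by apply/funext => p; rewrite mulNr.
have cflat (g : R * R -> R) i : continuous g -> continuous (fun p => flat i (g p)).
  by move=> cg; have cf := flat_continuous i; conts.
elim: k n f => [|k IH] n f; first by move=> /= cf; exact: cflat.
move=> fk; have fk' := is_CkS _ _ fk; move: fk => [cf fx fy fxk fyk]; split.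
- exact: cflat.
- by move=> p; have [] := dx_flat n f p (fx p).
- by move=> p; have [] := dy_flat n f p (fy p).
- rewrite (_ : dx _ = fun p => (flat n.+2 (f p) - n%:R * flat n.+1 (f p)) * dx f p).
    by apply: is_CkM => //; apply: sub; exact: IH.
  by apply/funext => p; have [_] := dx_flat n f p (fx p).
- rewrite (_ : dy _ = fun p => (flat n.+2 (f p) - n%:R * flat n.+1 (f p)) * dy f p).
    by apply: is_CkM => //; apply: sub; exact: IH.
  by apply/funext => p; have [_] := dy_flat n f p (fy p).
Qed.

Lemma flat0_near1 s : 0 < s -> `|flat 0 s - 1| <= s^-1.
Proof.
move=> s0; rewrite /flat s0 expr0 mul1r distrC ger0_norm.
  by have := expR_ge1Dx (- s^-1); lra.
by rewrite subr_ge0 -expR0 ler_expR oppr_le0 invr_ge0 ltW.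
Qed.

Lemma flat0_ge0 s : 0 <= flat 0 s.
Proof. by rewrite /flat; case: ifPn => // _; rewrite expr0 mul1r expR_ge0. Qed.

Lemma flat0_le1 s : flat 0 s <= 1.
Proof.
rewrite /flat; case: ifPn => // s0; rewrite expr0 mul1r -expR0 ler_expR.
by rewrite oppr_le0 invr_ge0 ltW.
Qed.

Lemma flat2_bound s : 1 <= s -> `|(s + 1) * flat 2 s| <= 2 / s.
Proof.
move=> s1; have s0 : 0 < s by lra.
rewrite /flat s0 ger0_norm; last first.
  by rewrite mulr_ge0 ?addr_ge0 ?(ltW s0)// mulr_ge0 ?expR_ge0// exprn_ge0// invr_ge0 ltW.
have e1 : expR (- s^-1) <= 1 by rewrite -expR0 ler_expR oppr_le0 invr_ge0 ltW.
have -> : 2 / s = (2 * s) * (s^-1 ^+ 2 * 1) by field; lra.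
apply: ler_pM; rewrite ?mulr_ge0 ?expR_ge0 ?exprn_ge0 ?invr_ge0 ?(ltW s0)//; try lra.
by rewrite ler_wpM2l// exprn_ge0// invr_ge0 ltW.
Qed.

(** [flat 2] is the derivative of [flat 0], and [s + 1] stands for the height times the scale of the
    cutoff. Beyond [1] the product is at most [2]; on [[-1, 1]] it is at most [2] times the bound
    [3 ^+ 3] of [flat 2]. *)
Lemma flat2_bounded : exists B : R, forall s, -1 <= s -> `|(s + 1) * flat 2 s| <= B.
Proof.
exists (2 + 2 * 3 ^+ 3) => s s1; have [h|h] := leP 1 s.
  rewrite (le_trans (flat2_bound _ h))// ler_wpDr ?mulr_ge0 ?exprn_ge0//.
  by rewrite ler_pdivrMr ?ler_peMr//; lra.
rewrite normrM ler_wpDl//; apply: ler_pM => //.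
  by rewrite ger0_norm; lra.
rewrite (le_trans (flat_bound 2 s))// -[leRHS]mulr1 ler_wpM2l ?exprn_ge0//.
by rewrite ler_norml; apply/andP; split; lra.
Qed.

End bump.

(** * Integration by parts against test functions *)

Section integration_by_parts.
Context {R : realType}.
Local Notation mu := (@lebesgue_measure R).
Local Notation area := (@area R).
Local Notation plane := (measurableTypeR R * measurableTypeR R)%type.
Implicit Types (f h phi : R * R -> R) (D : set (R * R)) (M : R).

Lemma integral_derive_eq0 (G g : R -> R) M : 0 < M ->
  (forall t : R, is_derive t 1 G (g t)) -> continuous g ->
  (forall t, M < `|t| -> G t = 0) -> (forall t, M < `|t| -> g t = 0) ->
  (\int[mu]_t (g t)%:E = 0)%E.
Proof.
(* The ends are [M + 1] and its opposite, as [G] is known to vanish only where [M < |t|]. *)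
move=> M0 dG cg G0 g0; have Mlt : - (M + 1) < M + 1 by lra.
have -> : (\int[mu]_t (g t)%:E = \int[mu]_(t in `[(- (M + 1))%R, (M + 1)%R]) (g t)%:E)%E.
  rewrite [RHS]integral_mkcond; apply: eq_integral => t _; rewrite patchE.
  case: ifPn => //; rewrite notin_setE /= in_itv/= => /negP tI; rewrite g0//.
  by rewrite ltNge; apply: contra tI => tM; move: (le_trans (ler_norm t) tM) (le_trans (ler_norm (- t)) (eq_ind_r (fun x => x <= M) tM (normrN t))) => h1 h2; apply/andP; split; lra.
have iG := continuous_integrable g (- (M + 1)) (M + 1) cg.
rewrite -[LHS]fineK; last exact: integrable_fin_num.
have := Rint_FTC G g _ _ Mlt dG cg; rewrite /Rintegral => ->.
have M1 : M < `|M + 1| by rewrite ger0_norm; lra.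
by rewrite !G0 ?subrr// normrN.
Qed.

Lemma continuous_slicex h y : continuous h -> continuous (fun x => h (x, y)).
Proof.
move=> ch x; apply: (@cvg_comp _ _ _ (fun x => (x, y)) h (nbhs x) (nbhs (x, y))); last exact: ch.
by apply: (@cvg_pair _ _ _ (nbhs x) (nbhs x) (nbhs y)); [exact: cvg_id|exact: cvg_cst].
Qed.

Lemma continuous_slicey h x : continuous h -> continuous (fun y => h (x, y)).
Proof.
move=> ch y; apply: (@cvg_comp _ _ _ (fun y => (x, y)) h (nbhs y) (nbhs (x, y))); last exact: ch.
by apply: (@cvg_pair _ _ _ (nbhs y) (nbhs x) (nbhs y)); [exact: cvg_cst|exact: cvg_id].
Qed.

Lemma box_integrable h M : continuous h -> 0 < M ->
  (forall x y, M < `|x| \/ M < `|y| -> h (x, y) = 0) ->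
  area.-integrable [set: plane] (EFin \o h).
Proof.
move=> ch M0 h0.
have MM : - M <= M by lra.
have [B hB] := rectangle_bound h _ _ _ _ MM MM ch.
pose box : set plane := `[- M, M]%classic `*` `[- M, M]%classic.
have mbox : measurable box by apply: measurableX; exact: measurable_itv.
have H : area.-integrable box (EFin \o h).
  apply: (bounded_integrable _ _ B) => //; first exact: area_box.
    exact: continuous_measurable_plane.
  by move=> [x y] [xI yI]; exact: hB.
have := (integrable_mkcond _ mbox).1 H; apply: eq_integrable => // -[x y] _ /=.
rewrite patchE; case: ifPn => //; rewrite notin_setE => nI; rewrite /= h0//.
have [xM|?] := leP `|x| M; last by left.
have [yM|?] := leP `|y| M; last by right.
by exfalso; apply: nI; split; rewrite /= in_itv/= -ler_norml.
Qed.

Lemma integral_dx_eq0 h M : 0 < M -> continuous h ->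
  (forall p, derivable h p ((1, 0) : R * R)) -> continuous (dx h) ->
  (forall x y, M < `|x| \/ M < `|y| -> h (x, y) = 0) ->
  (forall x y, M < `|x| \/ M < `|y| -> dx h (x, y) = 0) ->
  \int[area]_p dx h p = 0.
Proof.
move=> M0 ch dh cdh h0 dh0; rewrite /Rintegral /Defs.area.
have iF := box_integrable _ _ cdh M0 dh0.
rewrite -(integral21_prod_meas1 iF) integral0_eq// => y _.
rewrite /fubini_G; apply: (integral_derive_eq0 (fun x => h (x, y)) (fun x => dx h (x, y)) M) => //.
- by move=> t; exact: derivable_slicex.
- exact: continuous_slicex.
- by move=> t tM; apply: h0; left.
- by move=> t tM; apply: dh0; left.
Qed.

Lemma integral_dy_eq0 h M : 0 < M -> continuous h ->
  (forall p, derivable h p ((0, 1) : R * R)) -> continuous (dy h) ->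
  (forall x y, M < `|x| \/ M < `|y| -> h (x, y) = 0) ->
  (forall x y, M < `|x| \/ M < `|y| -> dy h (x, y) = 0) ->
  \int[area]_p dy h p = 0.
Proof.
move=> M0 ch dh cdh h0 dh0; rewrite /Rintegral /Defs.area.
have iF := box_integrable _ _ cdh M0 dh0.
rewrite -(integral12_prod_meas1 iF) integral0_eq// => x _.
rewrite /fubini_F; apply: (integral_derive_eq0 (fun y => h (x, y)) (fun y => dy h (x, y)) M) => //.
- by move=> t; exact: derivable_slicey.
- exact: continuous_slicey.
- by move=> t tM; apply: h0; right.
- by move=> t tM; apply: dh0; right.
Qed.

Lemma test_function_support D phi : test_function D phi ->
  exists2 M, 0 < M & forall x y, M < `|x| \/ M < `|y| ->
    [/\ phi (x, y) = 0, dx phi (x, y) = 0 & dy phi (x, y) = 0].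
Proof.
move=> [sphi cphi _]; have /compact_bounded[M [_ Mphi]] := cphi.
have oC : open (~` closed_support phi) by apply: closed_openC; exact: closed_closure.
have phi0 p : (~` closed_support phi) p -> phi p = 0.
  by move=> np; apply: contrapT => /eqP h; apply: np; exact: subset_closure.
exists (`|M| + 1); first by have := normr_ge0 M; lra.
move=> x y xyM.
have np : (~` closed_support phi) (x, y).
  move=> /(Mphi (`|M| + 1)); rewrite -[_ < _]/(M < `|M| + 1).
  have -> : M < `|M| + 1 by have := ler_norm M; lra.
  move=> /(_ isT) /=; rewrite -[`|(x, y)|]/(Num.max `|x| `|y|) ge_max => /andP[h1 h2].
  by case: xyM; lra.
by split; [exact: phi0|apply: dx_eq0 oC phi0 _ np|apply: dy_eq0 oC phi0 _ np].
Qed.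

Lemma test_function_off D phi : test_function D phi ->
  forall p, ~ D p -> [/\ phi p = 0, dx phi p = 0 & dy phi p = 0].
Proof.
move=> [sphi cphi sD] p nD.
have oC : open (~` closed_support phi) by apply: closed_openC; exact: closed_closure.
have phi0 q : (~` closed_support phi) q -> phi q = 0.
  by move=> nq; apply: contrapT => /eqP h; apply: nq; exact: subset_closure.
have np : (~` closed_support phi) p by move=> /sD.
by split; [exact: phi0|apply: dx_eq0 oC phi0 _ np|apply: dy_eq0 oC phi0 _ np].
Qed.

Lemma L2_innerT D f phi : (forall p, ~ D p -> phi p = 0) ->
  L2_inner D f phi = \int[area]_p (f p * phi p).
Proof.
move=> phi0; rewrite /L2_inner Rintegral_mkcond; apply: eq_Rintegral => p _.
by rewrite patchE; case: ifPn => //; rewrite notin_setE => /phi0 ->; rewrite mulr0.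
Qed.

(** The derivative of [f * phi] has integral [0] over the plane by Fubini; as [phi] vanishes off
    [D], the boundary of [D] does not enter. *)
Lemma L2_inner_by_parts D f phi : is_Ck 1 f -> test_function D phi ->
  L2_inner D f (dx phi) = - L2_inner D (dx f) phi /\
  L2_inner D f (dy phi) = - L2_inner D (dy f) phi.
Proof.
move=> [cf fx fy cfx cfy] tphi; have off := test_function_off _ _ tphi.
have [M M0 supp] := test_function_support _ _ tphi.
have [/(_ 1%N)[cphi phix phiy cphix cphiy] _ _] := tphi.
have supp0 x y : M < `|x| \/ M < `|y| -> phi (x, y) = 0 by move=> /supp[].
have suppx x y : M < `|x| \/ M < `|y| -> dx phi (x, y) = 0 by move=> /supp[].
have suppy x y : M < `|x| \/ M < `|y| -> dy phi (x, y) = 0 by move=> /supp[].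
have int (g k : R * R -> R) : continuous g -> continuous k ->
    (forall x y, M < `|x| \/ M < `|y| -> k (x, y) = 0) ->
    area.-integrable [set: plane] (EFin \o (fun p => g p * k p)).
  move=> cg ck k0; apply: (box_integrable _ M) => //; first by conts.
  by move=> x y /k0 ->; rewrite mulr0.
have Dx : dx (fun p => f p * phi p) = fun p => f p * dx phi p + dx f p * phi p.
  by apply/funext => p; rewrite dxM// [X in _ + X]mulrC.
have Dy : dy (fun p => f p * phi p) = fun p => f p * dy phi p + dy f p * phi p.
  by apply/funext => p; rewrite dyM// [X in _ + X]mulrC.
move: cfx cfy cphix cphiy => /= cfx cfy cphix cphiy.
split; apply/eqP; rewrite -addr_eq0 !L2_innerT; try by move=> p /off[].
- rewrite -RintegralD//; [|exact: int|exact: int].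
  have := integral_dx_eq0 (fun p => f p * phi p) M M0; rewrite Dx => H; apply/eqP/H.
  + by conts.
  + by move=> p; exact: derivableM.
  + by conts.
  + by move=> x y /supp0 ->; rewrite mulr0.
  + by move=> x y h; rewrite supp0// suppx// !mulr0 addr0.
- rewrite -RintegralD//; [|exact: int|exact: int].
  have := integral_dy_eq0 (fun p => f p * phi p) M M0; rewrite Dy => H; apply/eqP/H.
  + by conts.
  + by move=> p; exact: derivableM.
  + by conts.
  + by move=> x y /supp0 ->; rewrite mulr0.
  + by move=> x y h; rewrite supp0// suppy// !mulr0 addr0.
Qed.

End integration_by_parts.

(** * From classical solutions to weak eigenfunctions *)

Section weak_formulation.
Context {R : realType}.
Local Notation area := (@area R).
Local Notation plane := (measurableTypeR R * measurableTypeR R)%type.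
Implicit Types (u v f phi : R * R -> R).
Variables (D : set (R * R)) (M : R).
Hypotheses (oD : open D) (M0 : 0 < M).
Hypothesis D_box : forall p, D p -> `|p.1| <= M /\ `|p.2| <= M.

Lemma area_fin : (area D < +oo)%E.
Proof.
apply: le_lt_trans (area_box (- M) M (- M) M); apply: le_measure.
- by rewrite inE; exact: open_measurable_plane.
- by rewrite inE; apply: measurableX; exact: measurable_itv.
- by move=> p /D_box[h1 h2]; split; rewrite /= in_itv/= -ler_norml.
Qed.

Lemma domain_bound f : continuous f -> exists2 B, 0 <= B & forall p, D p -> `|f p| <= B.
Proof.
move=> cf; have MM : - M <= M by rewrite ge0_cp// ltW.
have [B hB] := rectangle_bound f _ _ _ _ MM MM cf.
have B0 : 0 <= B.
  by apply: le_trans (hB M M _ _) => //; rewrite in_itv/= lexx MM.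
exists B => // -[x y] /D_box[/= h1 h2].
by apply: hB; rewrite in_itv/= -ler_norml.
Qed.

Lemma L2_continuous f : continuous f -> L2 D f.
Proof.
move=> cf; have [B _ fB] := domain_bound f cf.
apply: L2_bounded fB; [exact: open_measurable_plane|exact: area_fin|].
exact: continuous_measurable_plane.
Qed.

Lemma L2_test phi : test_function D phi -> [/\ L2 D phi, L2 D (dx phi) & L2 D (dy phi)].
Proof.
by move=> [/(_ 1%N)[c0 _ _ cx cy] _ _]; split; exact: L2_continuous.
Qed.

Lemma green_test u (lam : R) phi : smooth u ->
  (forall p, dx (dx u) p + dy (dy u) p = - lam * u p) -> test_function D phi ->
  L2_inner D (dx u) (dx phi) + L2_inner D (dy u) (dy phi) = L2_inner D (lam \*o u) phi.
Proof.
move=> su hu tphi; have [phi2 _ _] := L2_test phi tphi.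
have mD := open_measurable_plane _ oD.
have [cu _ _ ux uy] := su 2%N.
have [-> _] := L2_inner_by_parts _ _ _ ux tphi.
have [_ ->] := L2_inner_by_parts _ _ _ uy tphi.
case: ux => _ _ _ cuxx _; case: uy => _ _ _ _ cuyy.
rewrite -opprD /L2_inner -RintegralD//; last 2 first.
- by apply: L2_mul_integrable => //; exact: L2_continuous.
- by apply: L2_mul_integrable => //; exact: L2_continuous.
rewrite -mulN1r -RintegralZl//.
  by apply: eq_Rintegral => p _ /=; rewrite -mulrDl hu; ring.
have -> : (fun p => dx (dx u) p * phi p + dy (dy u) p * phi p) = fun p => - lam * u p * phi p.
  by apply/funext => p; rewrite -mulrDl hu.
by apply: (L2_mul_integrable D (fun p => - lam * u p)) => //; apply: L2_continuous; conts.
Qed.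

(** The classical gradient is a weak one by parts. Any [v] in the form domain is a limit of test
    functions; Green's identity holds for each of them and both sides pass to the limit. *)
Lemma in_eigenspace_of_approx u (lam : R) (w : nat -> R * R -> R) : smooth u ->
  (forall p, dx (dx u) p + dy (dy u) p = - lam * u p) ->
  (forall n, test_function D (w n)) -> L2_cvg D w u ->
  L2_cvg D (fun n => dx (w n)) (dx u) -> L2_cvg D (fun n => dy (w n)) (dy u) ->
  in_eigenspace D lam u.
Proof.
move=> su hu tw wu wux wuy.
have mD := open_measurable_plane _ oD.
have [cu _ _ cux cuy] := su 1%N.
have Lu := L2_continuous u cu.
have Lux := L2_continuous _ cux; have Luy := L2_continuous _ cuy.
have Llu : L2 D (fun p => lam * u p) by apply: L2_continuous; conts.
split; first exact: Llu.
exists (fun p => (dx u p, dy u p)).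
  split; [split; [exact: Lu|exact: Lux|exact: Luy|]|exists w; split].
  - by move=> phi; exact: (L2_inner_by_parts _ _ _ (su 1%N)).
  - exact: tw.
  - exact: wu.
  - exact: wux.
  - exact: wuy.
move=> v g [[Lv Lgx Lgy _] [z [tz zv zx zy]]].
have Lz n : [/\ L2 D (z n), L2 D (dx (z n)) & L2 D (dy (z n))] by exact: L2_test.
have h1 : L2_inner D (dx u) (dx (z n)) + L2_inner D (dy u) (dy (z n)) @[n --> \oo] -->
    L2_inner D (dx u) (fst \o g) + L2_inner D (dy u) (snd \o g).
  by apply: cvgD; [apply: (L2_inner_cvg _ _ _ (fun n => dx (z n)))|apply: (L2_inner_cvg _ _ _ (fun n => dy (z n)))]; [exact: mD|exact: Lux|exact: Lgx| |exact: zx|exact: mD|exact: Luy|exact: Lgy| |exact: zy] => n; have [] := Lz n.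
have h2 : L2_inner D (lam \*o u) (z n) @[n --> \oo] --> L2_inner D (lam \*o u) v.
  by apply: L2_inner_cvg; [exact: mD|exact: Llu|exact: Lv| |exact: zv] => n; have [] := Lz n.
have E : (fun n => L2_inner D (dx u) (dx (z n)) + L2_inner D (dy u) (dy (z n))) =
    (fun n => L2_inner D (lam \*o u) (z n)).
  by apply/funext => n; exact: green_test.
rewrite E in h1.
by rewrite /dirichlet_form; apply: (cvg_unique _ h1 h2).
Qed.

End weak_formulation.

(** * The open ellipse and approximation by cutoffs *)

Section ellipse_domain.
Context {R : realType}.
Local Notation area := (@area R).
Variables (a b : R).
Hypotheses (a0 : 0 < a) (b0 : 0 < b).
Implicit Types (u : R * R -> R) (p q : R * R) (n : nat).

Definition height p : R := 1 - ((p.1 / a) ^+ 2 + (p.2 / b) ^+ 2).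

Lemma height_smooth : smooth height.
Proof.
move=> k; rewrite (_ : height = fun p => 1 + ((- a^-1 ^+ 2) * (p.1 * p.1) + (- b^-1 ^+ 2) * (p.2 * p.2))).
  by do ?[apply: is_CkD|apply: is_CkM|exact: is_Ck_cst|exact: smooth_fst|exact: smooth_snd].
by apply/funext => p; rewrite /height; ring.
Qed.

Lemma height_continuous : continuous height.
Proof. exact: height_smooth 0%N. Qed.

Lemma open_height : open [set p | 0 < height p].
Proof.
by apply: (@open_comp _ _ height [set x | 0 < x]); [move=> p _; exact: height_continuous|exact: open_gt].
Qed.

(** A point with [height p <= 0] is pushed out of the ellipse by dilations of ratio slightly above
    [1], so it is not interior. *)
Lemma interior_ellipse : interior (ellipse a b) = [set p | 0 < height p].
Proof.
apply/seteqP; split => [p pE|p hp]; last first.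
  have : nbhs p [set p | 0 < height p] by apply: open_nbhs_nbhs; split; [exact: open_height|].
  by apply: filterS => q /=; rewrite /ellipse /height/=; lra.
rewrite /= ltNge; apply/negP => hp.
have cl (z : R) : continuous_at (0 : R) (fun t : R => (t + 1) * z) by cont.
have ct : {for (0 : R), continuous (fun t : R => ((t + 1) * p.1, (t + 1) * p.2))}.
  apply: (@cvg_pair _ _ _ (nbhs (0 : R)) (nbhs ((0 + 1) * p.1)) (nbhs ((0 + 1) * p.2))).
    exact: cl.
  exact: cl.
have E0 : ((0 + 1) * p.1, (0 + 1) * p.2) = p :> R * R by rewrite add0r !mul1r; case: p {pE hp ct}.
move: pE; rewrite /interior /= -{1}E0 => /ct /nbhs_ballP[e /= e0 /(_ (e / 2))].
have he : ball 0 e (e / 2) by rewrite /ball /= sub0r normrN ger0_norm; lra.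
move=> /(_ he); rewrite /ellipse /=; move: hp; rewrite /height.
rewrite -!mulrA !exprMn -mulrDr; set r : R := p.1 ^+ 2 * _ + _ => r1 r2.
have : 1 < (e / 2 + 1) ^+ 2 by rewrite exprn_egt1//; lra.
by nra.
Qed.

Lemma ellipse_box p : 0 < height p -> `|p.1| <= a + b /\ `|p.2| <= a + b.
Proof.
rewrite /height => h.
have h1 : (p.1 / a) ^+ 2 <= 1 by have := sqr_ge0 (p.2 / b); lra.
have h2 : (p.2 / b) ^+ 2 <= 1 by have := sqr_ge0 (p.1 / a); lra.
have bnd (x c : R) : 0 < c -> (x / c) ^+ 2 <= 1 -> `|x| <= c.
  move=> c0 xc; have : `|x / c| <= 1.
    by rewrite -ler_sqr ?nnegrE// real_normK ?num_real// expr1n.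
  by rewrite normrM normfV (gtr0_norm c0) ler_pdivrMr// mul1r.
split; first by apply: le_trans (bnd _ _ a0 h1) _; rewrite lerDl ltW.
by apply: le_trans (bnd _ _ b0 h2) _; rewrite lerDr ltW.
Qed.

Lemma polar (x y : R) : x ^+ 2 + y ^+ 2 = 1 -> exists eta, x = cos eta /\ y = sin eta.
Proof.
move=> h; have x1 : -1 <= x <= 1.
  by apply/andP; split; have := sqr_ge0 y; nra.
have s2 : sin (acos x) ^+ 2 = y ^+ 2.
  by have := cos2Dsin2 (acos x); rewrite acosK//; lra.
have := s2; move/eqP; rewrite eqf_sqr => /orP[/eqP e|/eqP e].
  by exists (acos x); rewrite acosK.
by exists (- acos x); rewrite cosN sinN acosK// e opprK.
Qed.

(** The point is compared with its radial projection [p / r] on the boundary, where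
    [r ^+ 2 = 1 - height p]. The coordinates differ by at most [a * (1 - r)] and [b * (1 - r)], and
    [1 - r <= 1 - r ^+ 2]. *)
Lemma boundary_bound u : (exists C, forall p q, `|u p - u q| <= C * (`|p.1 - q.1| + `|p.2 - q.2|)) ->
  (forall eta, u (a * cos eta, b * sin eta) = 0) ->
  exists2 C, 0 <= C & forall p, 0 < height p -> `|u p| <= C * height p.
Proof.
move=> [C uC] u0.
have C0 : 0 <= C.
  have := uC (a, 0) (0, 0); rewrite /= !subr0 normr0 addr0 => h.
  by rewrite -(pmulr_lge0 _ (_ : 0 < `|a|)) ?(le_trans _ h)// normr_gt0 lt0r_neq0.
exists (C * (a + b)); first by rewrite mulr_ge0// addr_ge0 ?ltW.
move=> p; rewrite /height; set s : R := (p.1 / a) ^+ 2 + _ => s1.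
have s0 : 0 <= s by rewrite addr_ge0// sqr_ge0.
pose r := Num.sqrt s; have r2 : r ^+ 2 = s by rewrite sqr_sqrtr.
have r0 : 0 <= r by exact: sqrtr_ge0.
have r1 : r < 1 by rewrite ltNge; apply/negP => h; nra.
have bnd (x c : R) : 0 < c -> (x / c) ^+ 2 <= s -> `|x| <= c * r.
  move=> c0 xc; have : `|x / c| <= r.
    by rewrite -ler_sqr ?nnegrE// real_normK ?num_real// r2.
  by rewrite normrM normfV (gtr0_norm c0) ler_pdivrMr// mulrC.
have p1 := bnd p.1 a a0 (ltac:(rewrite /s lerDl sqr_ge0 //)).
have p2 := bnd p.2 b b0 (ltac:(rewrite /s lerDr sqr_ge0 //)).
(* The centre has no radial projection; it is compared with [(a, 0)]. *)
have [rz|rn] := eqVneq r 0.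
  have := uC p (a * cos 0, b * sin 0); rewrite u0 subr0 /= cos0 sin0 mulr1 mulr0.
  have -> : p.1 = 0 by apply/eqP; rewrite -normr_le0; rewrite rz mulr0 in p1.
  have -> : p.2 = 0 by apply/eqP; rewrite -normr_le0; rewrite rz mulr0 in p2.
  rewrite subr0 normr0 addr0 sub0r normrN (gtr0_norm a0) -r2 rz expr0n/= subr0 mulr1.
  by move=> h; apply: (le_trans h); rewrite ler_wpM2l// lerDl ltW.
have rp : 0 < r by rewrite lt0r rn.
have [eta [e1 e2]] : exists eta, p.1 / a / r = cos eta /\ p.2 / b / r = sin eta.
  by apply: polar; rewrite !exprMn -mulrDl -!exprMn -/s -r2 -exprMn mulfV// expr1n.
have := uC p (a * cos eta, b * sin eta); rewrite u0 subr0 /= -e1 -e2 => h.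
apply: (le_trans h).
have d (x c : R) : 0 < c -> `|x| <= c * r -> `|x - c * (x / c / r)| <= c * (1 - r).
  move=> c0 xc; have -> : x - c * (x / c / r) = - (x * ((1 - r) / r)).
    by field; rewrite ?rn ?(lt0r_neq0 c0).
  rewrite normrN normrM [X in _ * X]ger0_norm; last by rewrite divr_ge0// subr_ge0 ltW.
  by rewrite mulrA ler_pdivrMr// mulrAC ler_wpM2r// subr_ge0 ltW.
rewrite -[leRHS]mulrA ler_wpM2l//; apply: le_trans (lerD (d _ _ a0 p1) (d _ _ b0 p2)) _.
rewrite -mulrDl ler_wpM2l ?addr_ge0 ?(ltW a0) ?(ltW b0)// lerB// -r2 expr2.
by rewrite -[leRHS]mulr1 ler_wpM2l// ltW.
Qed.

(** Subtracting [1] keeps the support in [height >= 1 / (n + 1)], a compact part of the open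
    ellipse. *)
Definition cutoff u n p : R := u p * flat 0 (n.+1%:R * height p - 1).

Lemma cutoff_test u n : smooth u -> test_function [set p | 0 < height p] (cutoff u n).
Proof.
move=> su; have n0 : 0 < n.+1%:R :> R by rewrite ltr0n.
have cl : closed [set p | n.+1%:R^-1 <= height p].
  by apply: (@closed_comp _ _ height [set x | n.+1%:R^-1 <= x]); [move=> p _; exact: height_continuous|exact: closed_ge].
have sub : closed_support (cutoff u n) `<=` [set p | n.+1%:R^-1 <= height p].
  rewrite /closed_support [X in _ `<=` X]((closure_id _).1 cl); apply: closure_subset => p /=.
  apply: contraNT; rewrite -ltNge => h; rewrite /cutoff /flat.
  have -> : (0 < n.+1%:R * height p - 1) = false.
    by apply/negbTE; rewrite -leNgt subr_le0 mulrC -ler_pdivlMr// div1r ltW.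
  by rewrite mulr0.
have sub0 : closed_support (cutoff u n) `<=` [set p | 0 < height p].
  by move=> p /sub /=; apply: lt_le_trans; rewrite invr_gt0.
split => //.
- move=> k; apply: is_CkM; first exact: su.
  apply: is_Ck_flat; apply: is_CkD; last exact: is_Ck_cst.
  by apply: is_CkM; [exact: is_Ck_cst|exact: height_smooth].
- apply: (@subclosed_compact _ _ (`[- (a + b), a + b] `*` `[- (a + b), a + b])).
  + exact: closed_closure.
  + by apply: compact_setX; exact: segment_compact.
  + by move=> p /sub0 /ellipse_box[h1 h2]; split; rewrite /= in_itv/= -ler_norml.
Qed.

Lemma cutoff_dx u n p : smooth u -> dx (cutoff u n) p =
  u p * (flat 2 (n.+1%:R * height p - 1) * (n.+1%:R * dx height p)) +
  flat 0 (n.+1%:R * height p - 1) * dx u p.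
Proof.
move=> /(_ 1%N)[cu ux _ _ _]; have [_ hx _ _ _] := height_smooth 1%N.
have E : is_derive p ((1, 0) : R * R) (fun p => n.+1%:R * height p - 1) (n.+1%:R * dx height p).
  case: p => x y; apply/is_derive_dx; have hh := derivable_slicex _ _ _ (hx (x, y)).
  by der; ring.
have [Ed Ev] := E.
have [Fd Fv] := dx_flat 0 _ _ Ed.
rewrite /cutoff dxM//; congr (_ * _ + _).
by rewrite -[LHS]/('D_((1, 0) : R * R) (fun p => flat 0 (n.+1%:R * height p - 1)) p) Fv mul0r subr0 /dx Ev.
Qed.

Lemma cutoff_dy u n p : smooth u -> dy (cutoff u n) p =
  u p * (flat 2 (n.+1%:R * height p - 1) * (n.+1%:R * dy height p)) +
  flat 0 (n.+1%:R * height p - 1) * dy u p.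
Proof.
move=> /(_ 1%N)[cu _ uy _ _]; have [_ _ hy _ _] := height_smooth 1%N.
have E : is_derive p ((0, 1) : R * R) (fun p => n.+1%:R * height p - 1) (n.+1%:R * dy height p).
  case: p => x y; apply/is_derive_dy; have hh := derivable_slicey _ _ _ (hy (x, y)).
  by der; ring.
have [Ed Ev] := E.
have [Fd Fv] := dy_flat 0 _ _ Ed.
rewrite /cutoff dyM//; congr (_ * _ + _).
by rewrite -[LHS]/('D_((0, 1) : R * R) (fun p => flat 0 (n.+1%:R * height p - 1)) p) Fv mul0r subr0 /dy Ev.
Qed.

(* The factor [N] from the derivative of the cutoff is absorbed by the vanishing
   of [u] on the boundary, as [N * h = s + 1] when [s = N * h - 1]. *)
Lemma cutoff_error (N h hx up du C : R) : 0 <= N -> 0 <= C -> `|up| <= C * h ->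
  let s := N * h - 1 in
  `|up * (flat 2 s * (N * hx)) + flat 0 s * du - du| <=
  C * `|hx| * `|(s + 1) * flat 2 s| + `|du| * `|flat 0 s - 1|.
Proof.
move=> N0 C0 uC /=; set s := N * h - 1.
rewrite (_ : _ - du = up * (flat 2 s * (N * hx)) + du * (flat 0 s - 1)); last by ring.
apply: le_trans (ler_normD _ _) _; rewrite [X in _ + X]normrM lerD2r.
rewrite subrK !normrM (ger0_norm N0).
have -> : C * `|hx| * (N * `|h| * `|flat 2 s|) = C * `|h| * (`|flat 2 s| * (N * `|hx|)) by ring.
apply: ler_wpM2r; first by rewrite !mulr_ge0.
by apply: (le_trans uC); rewrite ler_wpM2l// ler_norm.
Qed.

Lemma cvg_of_slow_bound (h K l : R) (x : nat -> R) : 0 < h -> 0 <= K ->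
  (forall n, 1 <= n.+1%:R * h - 1 -> `|x n - l| <= K / (n.+1%:R * h - 1)) ->
  x n @[n --> \oo] --> l.
Proof.
move=> h0 K0 xK; apply/cvgrPdist_lt => e e0.
near=> n.
(* Makes [(n + 1) * h - 1] larger than both [1] and [K / e]. *)
have n1 : (2 + K / e) / h < n%:R by near: n; exact: nbhs_infty_gtr.
have Ke : 0 <= K / e by rewrite divr_ge0// ltW.
have nh : 2 + K / e < n.+1%:R * h.
  by rewrite ltr_pdivrMr// in n1; rewrite -(natr1 n) mulrDl mul1r; lra.
rewrite distrC (le_lt_trans (xK n _))//; first lra.
rewrite ltr_pdivrMr; last lra.
have -> : K = e * (K / e) by field; rewrite lt0r_neq0.
by rewrite ltr_pM2l//; lra.
Unshelve. all: by end_near. Qed.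

Lemma eigenfunction u (lam : R) : smooth u ->
  (exists C, forall p q, `|u p - u q| <= C * (`|p.1 - q.1| + `|p.2 - q.2|)) ->
  (forall p, dx (dx u) p + dy (dy u) p = - lam * u p) ->
  (forall eta, u (a * cos eta, b * sin eta) = 0) ->
  in_eigenspace (interior (ellipse a b)) lam u.
Proof.
move=> su lu hu u0; rewrite interior_ellipse.
have [C C0 uC] := boundary_bound u lu u0.
have oD := open_height; set D := [set p | 0 < height p] in oD *.
have mD := open_measurable_plane _ oD.
have ab0 : 0 < a + b by rewrite addr_gt0.
have aD := area_fin D (a + b) oD ellipse_box.
have bnd f (cf : continuous f) := domain_bound D (a + b) ab0 ellipse_box f cf.
have meas f (cf : continuous f) := continuous_measurable_plane f cf.
have [cu _ _ cux cuy] := su 1%N; have [_ _ _ chx chy] := height_smooth 1%N.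
have tw n := cutoff_test u n su.
have [B Bf] := @flat2_bounded R.
have B0 : 0 <= B by apply: le_trans (Bf 0 _); rewrite ?normr_ge0//; lra.
have N0 n : 0 <= n.+1%:R :> R by rewrite ler0n.
have sD n p : D p -> -1 <= n.+1%:R * height p - 1.
  by move=> Dp; rewrite -subr_ge0 opprK subrK mulr_ge0// ltW.
have f1 n p : `|flat 0 (n.+1%:R * height p - 1) - 1| <= 1.
  rewrite ler_norml; have := flat0_ge0 (n.+1%:R * height p - 1); have := flat0_le1 (n.+1%:R * height p - 1).
  by move=> h1 h2; apply/andP; split; lra.
(* Serves both partial derivatives: the error is bounded on [D] uniformly in [n] and tends to [0] at
   each point, so dominated convergence applies. *)
have key (z : nat -> R * R -> R) (du hx : R * R -> R) :
    (forall n, measurable_fun setT (z n : measurableTypeR R * measurableTypeR R -> R)) ->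
    continuous du -> continuous hx ->
    (forall n p, D p -> z n p = u p * (flat 2 (n.+1%:R * height p - 1) * (n.+1%:R * hx p)) +
      flat 0 (n.+1%:R * height p - 1) * du p) -> L2_cvg D z du.
  move=> mz cdu chx0 zE; have [U U0 dU] := bnd _ cdu; have [H H0 hH] := bnd _ chx0.
  have err n p : D p -> `|z n p - du p| <= C * `|hx p| * `|(n.+1%:R * height p - 1 + 1) * flat 2 (n.+1%:R * height p - 1)| + `|du p| * `|flat 0 (n.+1%:R * height p - 1) - 1|.
    by move=> Dp; rewrite zE//; apply: cutoff_error => //; exact: uC.
  apply: (L2_cvg_dominated _ _ _ (C * H * B + U)) => //; first exact: meas.
  - move=> n p Dp; apply: le_trans (err n p Dp) _; apply: lerD.
      apply: ler_pM; rewrite ?mulr_ge0//; last by apply: Bf; exact: sD.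
      by rewrite ler_wpM2l// hH.
    by rewrite -[leRHS]mulr1; apply: ler_pM => //; exact: dU.
  - move=> p Dp; apply: (cvg_of_slow_bound (height p) (C * `|hx p| * 2 + `|du p|)) => //.
      by rewrite addr_ge0// !mulr_ge0.
    move=> n s1; apply: le_trans (err n p Dp) _; rewrite [leRHS]mulrDl; apply: lerD.
      by rewrite -[leRHS]mulrA ler_wpM2l ?mulr_ge0// flat2_bound.
    by rewrite ler_wpM2l// flat0_near1//; lra.
have mw n : measurable_fun setT (cutoff u n : measurableTypeR R * measurableTypeR R -> R).
  by apply: meas; have [/(_ 0%N)] := tw n.
apply: (in_eigenspace_of_approx D (a + b) oD ab0 ellipse_box u lam (cutoff u)) => //.
- have [U U0 dU] := bnd _ cu; apply: (L2_cvg_dominated _ _ _ U) => //; first exact: meas.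
  + move=> n p Dp; rewrite /cutoff -{2}[u p]mulr1 -mulrBr normrM -[leRHS]mulr1.
    by apply: ler_pM => //; exact: dU.
  + move=> p Dp; apply: (cvg_of_slow_bound (height p) `|u p|) => // n s1.
    rewrite /cutoff -{2}[u p]mulr1 -mulrBr normrM ler_wpM2l// flat0_near1//; lra.
- apply: (key _ _ (dx height)) => // [n|n p _]; last exact: cutoff_dx.
  by apply: meas; have [/(_ 1%N)[]] := tw n.
- apply: (key _ _ (dy height)) => // [n|n p _]; last exact: cutoff_dy.
  by apply: meas; have [/(_ 1%N)[]] := tw n.
Qed.

End ellipse_domain.

Section continuous_ae_zero.
Context {R : realType}.
Local Notation area := (@area R).

(** A nonzero value would persist, by continuity, on a box of positive area inside [D]. *)
Lemma continuous_L2_eq0 (D : set (R * R)) (u : R * R -> R) : open D -> continuous u ->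
  L2_eq D u (cst 0) -> forall p, D p -> u p = 0.
Proof.
move=> oD cu [B [mB B0 DB]] p Dp; apply: contrapT => /eqP up.
have oU : open (u @^-1` [set x | x != 0]).
  by apply: (@open_comp _ _ u); [move=> q _; exact: cu|exact: open_neq].
have [[P Q] /= [nP nQ] PQ] : nbhs p (D `&` u @^-1` [set x | x != 0]).
  by apply: open_nbhs_nbhs; split; [exact: openI|].
have [e1 /= e10 H1] := (nbhs_ballP _ _).1 nP.
have [e2 /= e20 H2] := (nbhs_ballP _ _).1 nQ.
pose box : set (measurableTypeR R * measurableTypeR R) := `[p.1, p.1 + e1 / 2]%classic `*` `[p.2, p.2 + e2 / 2]%classic.
have mbox : measurable box by apply: measurableX; exact: measurable_itv.
have boxB : box `<=` B.
  move=> [x y] [/= xI yI]; apply: DB => /= h.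
  have [Dxy /eqP uxy] : (D `&` u @^-1` [set x | x != 0]) (x, y).
    apply: PQ; split; [apply: H1|apply: H2]; rewrite /ball/= ltr_distlC.
      by move: xI; rewrite in_itv/= => /andP[? ?]; apply/andP; split; lra.
    by move: yI; rewrite in_itv/= => /andP[? ?]; apply/andP; split; lra.
  exact: uxy (h Dxy).
have : (area box <= area B)%E by apply: le_measure; rewrite ?inE.
rewrite B0 leNgt => /negP; apply; rewrite /Defs.area product_measure1E; [|exact: measurable_itv|exact: measurable_itv].
have pos (s e : R) : 0 < e -> (0 < @lebesgue_measure R `[s, (s + e / 2)%R])%E.
  move=> e0; rewrite lebesgue_measure_itv /= lte_fin ltrDl divr_gt0//.
  by rewrite -EFinB lte_fin; lra.
by apply: mule_gt0; exact: pos.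
Qed.

End continuous_ae_zero.

(** * Double eigenvalues of ellipses *)

Section mathieu_modes.
Context {R : realType}.
Implicit Types (w tau psi eta x a k : R).

(* [(y0, psi) = (pi / 2, 0)] gives the modes even in the second variable and
   [(y0, psi) = (0, - pi / 2)] the odd ones. *)
Lemma mathieu_mode w tau (y0 : R) psi x : 0 < w -> 0 <= x -> x <= 1 / 9 ->
  sin y0 * sin psi = 0 -> cos y0 * cos psi = 0 ->
  cos (ang w tau y0 (pi / 2)) = 0 -> rad w tau y0 x = pi ->
  exists Phi Psi : R -> R,
    [/\ forall t : R, is_derive t 1 Phi (w * Psi t), continuous Psi,
       Phi 0 = sin y0 /\ Psi 0 = cos y0 &
       forall eta : R, \int[lebesgue_measure]_(t in `[0, pi / 2]) (Phi t * (cos (w * coshR x * cos eta * cos t) *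
         cos (w * sinhR x * sin eta * sin t + psi))) = 0].
Proof.
move=> w0 x0 x9 s0 c0 angE radE.
have pa : phase w (fun t => mcos2 t + tau) y0 (ang w tau y0).
  exact: (fam_phase _ continuous_mcos2 mcos2_bound).
have pr : phase w (fun t => cosh2cap t - tau) y0 (rad w tau y0).
  exact: (fam_phase _ continuous_cosh2cap cosh2cap_bound).
have cm := @continuous_mcos2 R; have cc := @continuous_cosh2cap R.
have [|r [r0 rpos dP dS]] := phase_linear w (fun t => mcos2 t + tau) y0 _ _ pa; first by conts.
have [|q [q0 qpos dQ dT]] := phase_linear w (fun t => cosh2cap t - tau) y0 _ _ pr; first by conts.
exists (fun t => r t * sin (ang w tau y0 t)), (fun t => r t * cos (ang w tau y0 t)); split.
- exact: dP.
- by move=> t; exact: drv_continuous (dS t).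
- by rewrite r0 pa.1 !mul1r.
- move=> eta; apply: (separated_zero _ (fun t => r t * cos (ang w tau y0 t)) w tau psi eta _ _ _ _ _
    (fun t => q t * sin (rad w tau y0 t)) (fun t => q t * cos (rad w tau y0 t)) x) => //.
  + by move=> t; have := dS t; rewrite /mcos2 => /drv_eq; apply; ring.
  + by rewrite r0 pa.1 mul1r.
  + by rewrite r0 pa.1 mul1r.
  + by rewrite angE mulr0.
  + by rewrite gt_eqF.
  + move=> t; rewrite in_itv/= => /andP[t0 tx].
    by have := dT t; rewrite cosh2capE ?t0 ?(le_trans tx)// => /drv_eq; apply; ring.
  + by rewrite q0 pr.1 mul1r mulrC.
  + by rewrite q0 pr.1 mul1r mulrC.
  + by rewrite radE sinpi mulr0.
  + by rewrite radE cospi mulrN1 oppr_eq0 gt_eqF.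
Qed.

Lemma positive_right_cos (Phi : R -> R) : continuous Phi -> 0 < Phi 0 ->
  exists d : R, [/\ 0 < d, d < pi / 2 & forall t : R, 0 < t <= d -> 0 < Phi t].
Proof.
move=> cP P0; have [e /= e0 he] := (nbhs_ballP _ _).1 (cvgr_gt _ (cP 0) _ P0).
have p0 := pi_gt0 R.
pose d := Num.min (e / 2) (pi / 4).
have d1 : d <= e / 2 by rewrite /d ge_min lexx.
have d2 : d <= pi / 4 by rewrite /d ge_min lexx orbT.
have d0 : 0 < d by rewrite /d lt_min !divr_gt0.
exists d; split => //; first by lra.
move=> t /andP[t0 td]; apply: he; rewrite /ball/= sub0r normrN gtr0_norm//; lra.
Qed.

Lemma positive_right_sin w (Phi Psi : R -> R) : 0 < w ->
  (forall t : R, is_derive t 1 Phi (w * Psi t)) -> continuous Psi -> Phi 0 = 0 -> 0 < Psi 0 ->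
  exists d : R, [/\ 0 < d, d < pi / 2 & forall t : R, 0 < t <= d -> 0 < Phi t].
Proof.
move=> w0 dP cP P0 S0; have [d [d0 dpi dpos]] := positive_right_cos Psi cP S0.
exists d; split => // t /andP[t0 td].
have [|c cI] := MVT t0 (fun x _ => dP x).
  by apply: drv_within_continuous => s _; exact: dP.
move: cI; rewrite in_itv/= => /andP[c0 ct]; rewrite P0 !subr0 => ->.
by rewrite mulr_gt0// mulr_gt0// dpos// c0/= (le_trans (ltW ct)).
Qed.

Definition plane_wave k g psi : R * R -> R :=
  wave (fun t => k * cos t) (fun t => k * sin t) g 0 psi.

Lemma plane_wave_continuous k g psi : continuous g -> continuous (plane_wave k g psi).
Proof. by move=> cg; apply: wave_continuous => //; conts. Qed.

Lemma plane_wave_reflect k g psi (x y : R) :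
  plane_wave k g psi (x, - y) = plane_wave k g (- psi) (x, y).
Proof.
rewrite /plane_wave /wave /=; apply: eq_Rintegral => t _.
by rewrite -[in RHS](opprK (y * _ + _)) cosN opprD opprK mulNr.
Qed.

Lemma plane_wave_odd k g (x y : R) :
  continuous g ->
  plane_wave k g (pi / 2) (x, y) = - plane_wave k g (- (pi / 2)) (x, y).
Proof.
move=> cg; rewrite /plane_wave /wave /= -mulN1r -RintegralZl//; last first.
  by apply: continuous_integrable; conts.
apply: eq_Rintegral => t _ /=; set s := y * _.
rewrite (_ : cos (s + pi / 2) = - cos (s - pi / 2)); first by ring.
by rewrite cosD cosB cos_pihalf !mulr0 sub0r add0r.
Qed.

(** The semi-axes are [cosh x] and [sinh x] times [w / k], half the distance between the foci; the
    vanishing integral is the wave on the boundary in these coordinates. *)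
Lemma mode_eigenfunction (a b : R) w k psi x (g : R -> R) : 0 < a -> 0 < b ->
  a * k = w * coshR x -> b * k = w * sinhR x -> continuous g ->
  (forall eta : R, \int[lebesgue_measure]_(t in `[0, pi / 2]) (g t * (cos (w * coshR x * cos eta * cos t) *
         cos (w * sinhR x * sin eta * sin t + psi))) = 0) ->
  in_eigenspace (interior (ellipse a b)) (k ^+ 2) (plane_wave k g psi).
Proof.
move=> a0 b0 ak bk cg g0.
have ca : continuous (fun t : R => k * cos t) by conts.
have cb : continuous (fun t : R => k * sin t) by conts.
apply: eigenfunction => //.
- exact: wave_smooth.
- exact: wave_lipschitz.
- move=> p; apply: wave_helmholtz => // t.
  by rewrite !exprMn -mulrDr cos2Dsin2 mulr1.
- move=> eta; rewrite -[RHS](g0 eta) /plane_wave /wave/=; apply: eq_Rintegral => t _.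
  rewrite -ak -bk addr0; congr (_ * (cos _ * cos (_ + _))); ring.
Qed.

End mathieu_modes.

(** * Independence of the two modes and conclusion *)

Section double_eigenvalue.
Context {R : realType}.

(** Evaluation at [(x, y)] and [(x, - y)] separates the even and odd terms of a vanishing
    combination; continuity makes almost everywhere into everywhere. *)
Lemma multiple_of_parity (D : set (R * R)) (lam : R) (ue uo : R * R -> R) : open D ->
  (forall x y, D (x, y) -> D (x, - y)) -> continuous ue -> continuous uo ->
  (forall x y, ue (x, - y) = ue (x, y)) -> (forall x y, uo (x, - y) = - uo (x, y)) ->
  in_eigenspace D lam ue -> in_eigenspace D lam uo ->
  ~ (forall p, D p -> ue p = 0) -> ~ (forall p, D p -> uo p = 0) ->
  multiple_eigenvalue D lam.
Proof.
move=> oD symD ce co even odd he ho ne no; split.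
  by exists ue => // /(continuous_L2_eq0 _ _ oD ce).
exists (fun i : 'I_2 => if val i == 0%N then ue else uo) => [i|c].
  by case: ifPn.
under eq_fun do rewrite big_ord_recl big_ord1 /=.
set c0 := c ord0; set c1 := c (lift ord0 ord0) => H.
have cs : continuous (fun p => c0 * ue p + c1 * uo p) by conts.
have Z := continuous_L2_eq0 _ _ oD cs H.
have Z2 x y : D (x, y) -> c0 * ue (x, y) = 0 /\ c1 * uo (x, y) = 0.
  move=> Dxy; have := Z _ Dxy; have := Z _ (symD _ _ Dxy).
  by rewrite even odd => h1 h2; split; lra.
have c00 : c0 = 0.
  apply: contrapT => /eqP h; apply: ne => -[x y] /Z2[/eqP + _].
  by rewrite mulf_eq0 (negbTE h) => /eqP.
have c10 : c1 = 0.
  apply: contrapT => /eqP h; apply: no => -[x y] /Z2[_ /eqP].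
  by rewrite mulf_eq0 (negbTE h) => /eqP.
move=> i; case: (unliftP ord0 i) => [j ->|->] //.
by rewrite (ord1 j).
Qed.

Lemma ellipse_multiple (m : nat) (a b w taue tauo x : R) : 0 < w -> 0 < x -> x <= 1 / 9 ->
  ang w taue (pi / 2) (pi / 2) = pi / 2 + m%:R * pi -> ang w tauo 0 (pi / 2) = pi / 2 ->
  rad w taue (pi / 2) x = pi -> rad w tauo 0 x = pi ->
  0 < a -> 0 < b -> b / a = sinhR x / coshR x ->
  multiple_eigenvalue (interior (ellipse a b)) ((w * coshR x / a) ^+ 2).
Proof.
move=> w0 x0 x9 ae ao re ro a0 b0 ba.
have ch0 : 0 < coshR x by exact: coshR_gt0.
pose k := w * coshR x / a.
have k0 : 0 < k by rewrite divr_gt0// mulr_gt0.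
have ak : a * k = w * coshR x by rewrite /k mulrC divfK// gt_eqF.
have bk : b * k = w * sinhR x.
  have -> : b = a * (sinhR x / coshR x) by rewrite -ba mulrC divfK// gt_eqF.
  by rewrite /k; field; rewrite !gt_eqF.
have D0 : interior (ellipse a b) (0, 0).
  by rewrite interior_ellipse//= /height/= !mul0r expr0n/= addr0 subr0.
have oD : open (interior (ellipse a b)) by exact: open_interior.
have [] := mathieu_mode w taue (pi / 2) 0 x w0 (ltW x0) x9 _ _ _ re.
- by rewrite sin0 mulr0.
- by rewrite cos_pihalf mul0r.
- rewrite ae; elim: m {ae} => [|m IH]; first by rewrite mul0r addr0 cos_pihalf.
  rewrite (_ : _ + m.+1%:R * pi = pi / 2 + m%:R * pi + pi); last by rewrite -(natr1 m); ring.
  by rewrite cosDpi IH oppr0.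
move=> P [P' [dP cP' [P0 _] Pz]].
have [] := mathieu_mode w tauo 0 (- (pi / 2)) x w0 (ltW x0) x9 _ _ _ ro.
- by rewrite sin0 mul0r.
- by rewrite cosN cos_pihalf mulr0.
- by rewrite ao cos_pihalf.
move=> Q [Q' [dQ cQ' [Q0 Q'0] Qz]].
have cP : continuous P by move=> t; exact: drv_continuous (dP t).
have cQ : continuous Q by move=> t; exact: drv_continuous (dQ t).
apply: (multiple_of_parity _ _ (plane_wave k P 0) (plane_wave k Q (- (pi / 2)))) => //.
- by move=> u v; rewrite interior_ellipse//= /height/= mulNr sqrrN.
- exact: plane_wave_continuous.
- exact: plane_wave_continuous.
- by move=> u v; rewrite plane_wave_reflect oppr0.
- by move=> u v; rewrite plane_wave_reflect opprK plane_wave_odd.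
- exact: (mode_eigenfunction a b w k 0 x P).
- exact: (mode_eigenfunction a b w k (- (pi / 2)) x Q).
- have [|d [d0 dpi dpos]] := positive_right_cos P cP; first by rewrite P0 sin_pihalf.
  exact: (wave_cos_nonzero P k d _ (lt0r_neq0 k0) cP d0 dpi dpos oD D0).
- have [||d [d0 dpi dpos]] := positive_right_sin w Q Q' w0 dQ cQ'.
  + by rewrite Q0 sin0.
  + by rewrite Q'0 cos0.
  exact: (wave_sin_nonzero Q k d _ k0 cQ d0 dpi dpos oD D0).
Qed.

End double_eigenvalue.

Theorem proposition6p3 (R : realType) :
  exists h : nat -> R,
    [/\ forall n, 0 < h n,
        h n @[n --> \oo] --> 0 &
        forall n (a b : R), 0 < b -> b <= a -> b / a = h n ->
          exists lam : R, multiple_eigenvalue (interior (ellipse a b)) lam].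
Proof.
(* The shift by [60] meets the condition on [m] in [phase_crossing]. *)
have /choice[X HX] : forall n : nat, exists x : R, exists w taue tauo : R,
    [/\ 2 * (n + 60)%:R <= w, 0 < x /\ 3 * w * x <= 16,
      ang w taue (pi / 2) (pi / 2) = pi / 2 + (n + 60)%:R * pi /\ ang w tauo 0 (pi / 2) = pi / 2 &
      rad w taue (pi / 2) x = pi /\ rad w tauo 0 x = pi].
  move=> n; have [|w [taue [tauo [x H]]]] := @phase_crossing R (n + 60); first by rewrite leq_addl.
  by exists x, w, taue, tauo.
have Xb n : 0 < X n /\ 6 * (n + 60)%:R * X n <= 16.
  have [w [taue [tauo [w1 [x0 wx] _ _]]]] := HX n; split => //.
  by apply: le_trans wx; apply: ler_wpM2r; [exact: ltW|lra].
have X9 n : X n <= 1 / 9.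
  have [x0 xb] := Xb n; have h : 60 <= (n + 60)%:R :> R by rewrite ler_nat leq_addl.
  by nra.
have X0 : X n @[n --> \oo] --> 0.
  (* With [h = 1] the denominator is [n], and [6 * (n + 60) * X n <= 16] gives [n * X n <= 3]. *)
  apply: (cvg_of_slow_bound 1 3) => // n; rewrite mulr1 => n1; have [x0 xb] := Xb n.
  rewrite subr0 gtr0_norm// ler_pdivlMr; last by lra.
  by move: xb n1; rewrite natrD -natr1; nra.
exists (fun n => sinhR (X n) / coshR (X n)); split.
- by move=> n; rewrite divr_gt0 ?coshR_gt0// sinhR_gt0//; have [] := Xb n.
- have c0 : {for (0 : R), continuous (fun x : R => sinhR x / coshR x)}.
    apply: cvgM; first exact: drv_continuous (is_derive_sinhR 0).
    by apply: cvgV; [rewrite gt_eqF// coshR_gt0|exact: drv_continuous (is_derive_coshR 0)].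
  have := cvg_comp X (fun x : R => sinhR x / coshR x) X0 c0.
  by rewrite sinhR0 mul0r.
- move=> n a b b0 ba hab; have [w [taue [tauo [w1 [x0 wx] [ae ao] [re ro]]]]] := HX n.
  have w0 : 0 < w by apply: lt_le_trans w1; rewrite mulr_gt0// ltr0n addn_gt0 orbT.
  exists ((w * coshR (X n) / a) ^+ 2).
  by apply: (ellipse_multiple (n + 60) a b w taue tauo (X n)) => //; exact: lt_le_trans ba.
Qed.
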